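(* Let $E$ be an admissible sequentially complete $\mathbb{C}$-lcHs and let $A\colon F:=D(A)\subset E\to E$ be a sequentially closed linear operator such that $F_{A}=(F,\tau_{A})$ is admissible. Then the abstract Cauchy problem $x'(t)=Ax(t)$, $t>0$, $x(0)=x_0$, has the uniqueness property (in the sense of hyperfunctions) if for any $y\in F_{A}'$ and any $n\in\mathbb{N}$ there are $k\in\mathbb{N}$, $\alpha\in\mathfrak{A}$, $C_{1}>0$ and $t_{y,n}>0$ such that for any $t\geq t_{y,n}$ there are $\widetilde{y}_{y,n}(t)\in E'$ and $s_{y,n}(t)\in F_{A}'$ such that for all $t\geq t_{y,n}$ and all $x\in E$, $z\in F$ it holds that $$(t-A^{\mathrm{t}})\widetilde{y}_{y,n}(t)=y+s_{y,n}(t),\quad |\langle \widetilde{y}_{y,n}(t), x\rangle| \leq C_{1}p_{\alpha}(x)e^{kt},$$ $$|\langle s_{y,n}(t),z\rangle|\leq C_{1}(p_{\alpha}(z)+p_{\alpha}(Az))e^{-nt}.$$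
   Context: Conventions: $\mathbb{N}=\{1,2,\dots\}$, $\mathbb{N}_0=\mathbb{N}\cup\{0\}$. A $\mathbb{C}$-lcHs is a locally convex Hausdorff space $E$ over $\mathbb{C}$, whose topology is given by a directed system of seminorms $(p_\alpha)_{\alpha\in\mathfrak{A}}$. $E'$ is the space of continuous linear functionals on $E$, and $\langle T,f\rangle=T(f)$. $\mathcal{O}(\Omega,E)$ is the space of $E$-valued holomorphic functions on an open set $\Omega\subset\mathbb{C}$, $\mathcal{C}^\infty(\Omega,E)$ the space of infinitely continuously partially differentiable $E$-valued functions on $\Omega\subset\mathbb{C}=\mathbb{R}^2$. Admissibility. Let $\overline{\mathbb{R}}=\mathbb{R}\cup\{\pm\infty\}$ be the two-point compactification of $\mathbb{R}$. For compact $K\subset\overline{\mathbb{R}}$ and $n\in\mathbb{N}$ let $U_n(K)$ be the union of $\{z\in\mathbb{C}\mid \mathrm{d}(z,K\cap\mathbb{C})<1/n\}$ (with $\mathrm{d}(z,\emptyset)=\infty$), of $]n,\infty[+i]-\tfrac1n,\tfrac1n[$ if $\infty\in K$, and of $]-\infty,-n[+i]-\tfrac1n,\tfrac1n[$ if $-\infty\in K$. Let $S_n(K)=(\mathbb{C}\setminus\overline{U_n(K)})\cap\{z\mid |\mathrm{Im}(z)|<n\}$. Let $\mathcal{E}^{exp}(\overline{\mathbb{C}}\setminus K,E)$ be the space of all $f\in\mathcal{C}^\infty(\mathbb{C}\setminus K,E)$ such that $\sup\{p_\alpha(\partial^\beta f(z))e^{-\frac1n|\mathrm{Re}(z)|}\mid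 z\in S_n(K),\ \beta\in\mathbb{N}_0^2,\ |\beta|\le m\}<\infty$ for all $n\in\mathbb{N}$, $m\in\mathbb{N}_0$, $\alpha\in\mathfrak{A}$. $E$ is called admissible if the Cauchy–Riemann operator $\overline\partial\colon\mathcal{E}^{exp}(\overline{\mathbb{C}}\setminus K,E)\to\mathcal{E}^{exp}(\overline{\mathbb{C}}\setminus K,E)$ is surjective for every compact $K\subset\overline{\mathbb{R}}$. The space $F_A$. For a sequentially complete $\mathbb{C}$-lcHs $E$ and a sequentially closed linear operator $A\colon F=D(A)\subset E\to E$ (sequentially closed graph), $\tau_A$ is the graph topology on $F$ given by the seminorms $p_{\alpha,A}(x)=p_\alpha(x)+p_\alpha(Ax)$, $\alpha\in\mathfrak{A}$, and $F_A=(F,\tau_A)$; it is a sequentially complete $\mathbb{C}$-lcHs and $A\colon F_A\to E$ is continuous. $A^{\mathrm{t}}\colon E'\to F_A'$, $A^{\mathrm{t}}(y)=y\circ A$, is the dual map of $A\colon F_A\to E$; for $\widetilde y\in E'$ and $t>0$, $(t-A^{\mathrm{t}})\widetilde y\in F_A'$ is the functional $z\mapsto\widetilde y(tz-Az)$ on $F$. Hyperfunctions and the uniqueness property. $\mathcal{B}([0,\infty[,E)=\mathcal{O}(\mathbb{C}\setminus[0,\infty[,E)/\mathcal{O}(\mathbb{C},E)$, with classes $[u]$. A solution (in the sense of hyperfunctions) of the abstract Cauchy problem $x'(t)=Ax(t)$, $t>0$, $x(0)=x_0\in E$, is an element $[u]\in\mathcal{B}([0,\infty[,F_A)$ with $\frac{d}{dt}[u]-A[u]=x_0\otimes\delta_0$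 in $\mathcal{B}([0,\infty[,E)$, where $\frac{d}{dt}[u]=[\frac{d}{dz}u]$, $A[u]=[z\mapsto Au(z)]$ and $x_0\otimes\delta_0=[z\mapsto-\frac{1}{2\pi i z}x_0]$. The problem has the uniqueness property (in the sense of hyperfunctions) if $[u]=0$ is the only solution for $x_0=0$. *)

(* Defs.v *)
From HB Require Import structures.
From mathcomp Require Import all_boot all_order all_algebra complex.
From mathcomp Require Import all_classical all_reals all_analysis.

Set Implicit Arguments.
Unset Strict Implicit.
Unset Printing Implicit Defensive.

Import Order.TTheory GRing.Theory Num.Theory.
Import numFieldNormedType.Exports.

Local Open Scope classical_set_scope.
Local Open Scope complex_scope.
Local Open Scope ring_scope.

(* R[i] has no topology in the library; it gets the one of its own norm, which
   the library attaches to the regular module R[i]^o. *)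
HB.instance Definition _ (R : realType) := NormedModule.copy R[i] R[i]^o.

(* The modulus as a real number; the library norm `|z| lives in R[i]. *)
Definition modulus (R : realType) (z : R[i]) : R := complex.Re `|z|.

(* A nonempty family of seminorms, directed up to constants. *)
Record seminorms (R : realType) (V : lmodType R[i]) := Seminorms {
  sn_index : Type;
  sn_fun :> sn_index -> V -> R;
  sn_ler_add : forall a x y, sn_fun a (x + y) <= sn_fun a x + sn_fun a y;
  sn_scale : forall a (l : R[i]) x, sn_fun a (l *: x) = modulus l * sn_fun a x;
  sn_nonempty : inhabited sn_index;
  sn_directed : forall a b, exists c, exists2 M : R, 0 < M &
    forall x, sn_fun a x <= M * sn_fun c x /\ sn_fun b x <= M * sn_fun c x }.

Section SeminormsTheory.
Context (R : realType) (V : lmodType R[i]) (p : seminorms V).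

Lemma modulusE (l : R[i]) : (modulus l)%:C = `|l|.
Proof. by rewrite /modulus normc_def. Qed.

Lemma modulus_real (t : R) : modulus (t%:C : R[i]) = `|t|.
Proof. by rewrite /modulus normc_def /= expr0n /= addr0 sqrtr_sqr. Qed.

Lemma modulus_ge0 (l : R[i]) : 0 <= modulus l.
Proof. rewrite -lecR modulusE; exact: normr_ge0. Qed.

Lemma sn0 a : p a 0 = 0.
Proof.
have := sn_scale (s := p) a (0%:C : R[i]) 0.
by rewrite modulus_real normr0 mul0r scaler0.
Qed.

Lemma snN a x : p a (- x) = p a x.
Proof.
have := sn_scale (s := p) a ((-1)%:C : R[i]) x.
by rewrite modulus_real normrN1 mul1r rmorphN1 scaleN1r.
Qed.

Lemma sn_ge0 a x : 0 <= p a x.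
Proof.
have := sn_ler_add (s := p) a x (- x); rewrite subrr sn0 snN.
by rewrite -mulr2n pmulrn_lge0.
Qed.

End SeminormsTheory.

(* V with the topology generated by p; its uniformity is that of the group V. *)
Definition seminormed_space (R : realType) (V : lmodType R[i])
  (p : seminorms V) : Type := V.

Section SeminormedSpace.
Context (R : realType) (V : lmodType R[i]) (p : seminorms V).
Local Notation T := (seminormed_space p).

HB.instance Definition _ := GRing.Lmodule.on T.

Definition sn_ball (a : sn_index p) (x : T) (e : R) : set T :=
  [set y | p a (y - x) < e].

Definition sn_nbhs (x : T) : set_system T :=
  [set U | exists a, exists2 e : R, 0 < e & sn_ball a x e `<=` U].

Let sn_nbhs_filter (x : T) : ProperFilter (sn_nbhs x).
Proof.
split.
  move=> [a [e e0]] /(_ x); apply.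
  by rewrite /sn_ball /= subrr sn0.
split.
- by have [a] := sn_nonempty p; exists a, 1.
- move=> P Q [a [e e0 aP]] [b [d d0 bQ]].
  have [c [M M0 cM]] := sn_directed (s := p) a b.
  exists c, (Num.min e d / M).
    by rewrite divr_gt0 // lt_min e0 d0.
  move=> y; rewrite /sn_ball /= ltr_pdivlMr // mulrC lt_min => /andP[h1 h2].
  split; [apply: aP|apply: bQ].
    exact: le_lt_trans (cM _).1 h1.
  exact: le_lt_trans (cM _).2 h2.
- move=> P Q PQ [a [e e0 aP]]; exists a, e => //.
  exact: subset_trans PQ.
Qed.

Let sn_nbhs_singleton (x : T) (A : set T) : sn_nbhs x A -> A x.
Proof. by move=> [a [e e0]]; apply; rewrite /sn_ball /= subrr sn0. Qed.

Let sn_nbhs_ball a (x y : T) e : sn_ball a x e y -> sn_nbhs y (sn_ball a x e).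
Proof.
rewrite /sn_ball /= => h; exists a, (e - p a (y - x)); first by rewrite subr_gt0.
move=> z; rewrite /sn_ball /= ltrBrDr => h'.
apply: le_lt_trans h'.
by rewrite -[z - x](subrKA y) sn_ler_add.
Qed.

Let sn_nbhs_nbhs (x : T) (A : set T) :
  sn_nbhs x A -> sn_nbhs x (sn_nbhs^~ A).
Proof.
move=> [a [e e0 aA]]; exists a, e => // y /sn_nbhs_ball [b [d d0 bd]].
by exists b, d => //; exact: subset_trans aA.
Qed.

HB.instance Definition _ := hasNbhs.Build T sn_nbhs.
HB.instance Definition _ := Nbhs_isNbhsTopological.Build T
  sn_nbhs_filter sn_nbhs_singleton sn_nbhs_nbhs.

Lemma sn_nbhsE (x : T) (U : set T) : nbhs x U <->
  exists a, exists2 e : R, 0 < e & [set y | p a (y - x) < e] `<=` U.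
Proof. by []. Qed.

Let sn_add_continuous : continuous (fun x : T * T => x.1 + x.2).
Proof.
move=> [x y] U [a [e e0 aU]].
have e20 : 0 < e / 2 by rewrite divr_gt0.
exists (sn_ball a x (e / 2), sn_ball a y (e / 2)).
  by split; exists a, (e / 2).
move=> [x' y'] [/= hx hy]; apply: aU.
rewrite /sn_ball /= opprD addrACA [e]splitr.
exact: le_lt_trans (sn_ler_add _ _ _) (ltrD hx hy).
Qed.

Let sn_scale_continuous : continuous (fun z : R[i] * T => z.1 *: z.2).
Proof.
move=> [l x] U [a [e e0 aU]].
pose c := modulus (l : R[i]) + 1; pose d := p a x + 1.
have c0 : 0 < c by rewrite ltr_wpDl // modulus_ge0.
have d0 : 0 < d by rewrite ltr_wpDl // sn_ge0.
have ed : 0 < Num.min 1 (e / 2 / d).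
  by rewrite lt_min ltr01 !divr_gt0.
have ec : 0 < e / 2 / c by rewrite !divr_gt0.
exists (ball (l : R[i]) (Num.min 1 (e / 2 / d))%:C, sn_ball a x (e / 2 / c)).
  split; last by exists a, (e / 2 / c).
  by apply: nbhsx_ballx; rewrite ltcR.
move=> [l' x'] [/= hl hx]; apply: aU.
have {}hl : modulus ((l' - l) : R[i]) < Num.min 1 (e / 2 / d).
  move: hl; rewrite -ball_normE /ball_ /= distrC -modulusE.
  by rewrite ltcR.
move: hl; rewrite lt_min => /andP[hl1 hl2].
have hl' : modulus (l' : R[i]) <= c.
  rewrite -lecR modulusE rmorphD /= modulusE -[l'](subrK l) addrC.
  rewrite (le_trans (ler_normD _ _)) // lerD2l.
  by rewrite -[`|_|](@modulusE R) lecR ltW.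
rewrite /sn_ball /=.
have -> : l' *: x' - l *: x = l' *: (x' - x) + (l' - l) *: x.
  by rewrite scalerBr scalerBl addrA subrK.
apply: (le_lt_trans (sn_ler_add _ _ _)); rewrite !sn_scale [e]splitr.
apply: ltr_leD.
  apply: (@le_lt_trans _ _ (c * p a (x' - x))).
    by rewrite ler_wpM2r // sn_ge0.
  by rewrite mulrC -ltr_pdivlMr.
apply: (@le_trans _ _ (e / 2 / d * d)); last by rewrite divfK // gt_eqF.
apply: ler_pM; rewrite ?modulus_ge0 ?sn_ge0 ?ltW //.
by rewrite /d ltrDl.
Qed.

Local Open Scope convex_scope.

Let sn_locally_convex : exists2 B : set_system T,
  (forall b, b \in B -> convex_set b) & basis B.
Proof.
exists [set B | exists a x e, B = sn_ball a x e].
  move=> B /[!inE] -[a [x [e ->]]] y z l /[!inE] hy hz.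
  rewrite /sn_ball /= in hy hz *.
  have l0 : 0 <= l%:num :> R[i] by [].
  have l1 : 0 <= 1 - l%:num :> R[i] by rewrite subr_ge0.
  have [t t0 lt] : exists2 t : R, 0 <= t & l%:num = t%:C.
    exists (complex.Re l%:num); first by move: l0; rewrite lecE => /andP[].
    by rewrite RRe_real // ger0_real.
  have t1 : 0 <= 1 - t by rewrite -lecR rmorphB /= -lt.
  have -> : ((y : convex_lmodType V) <| l |> z) - x =
      t%:C *: (y - x) + (1 - t)%:C *: (z - x).
    rewrite /conv /= /unstable.onem lt rmorphB rmorph1.
    rewrite !scalerBr addrACA -opprD; congr (_ - _).
    by rewrite -scalerDl addrC subrK scale1r.
  apply: le_lt_trans (sn_ler_add _ _ _) _.
  rewrite !sn_scale !modulus_real !ger0_norm //.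
  have -> : e = t * e + (1 - t) * e by rewrite -mulrDl addrC subrK mul1r.
  have [->|tn0] := eqVneq t 0.
    by rewrite !mul0r !add0r subr0 !mul1r.
  apply: ltr_leD; last by rewrite ler_wpM2l // ltW.
  by rewrite ltr_pM2l // lt_neqAle eq_sym tn0.
split.
  move=> B [a [x [e ->]]]; rewrite openE => y; exact: sn_nbhs_ball.
move=> x U [a [e e0 aU]]; exists (sn_ball a x e) => //.
by split; [exists a, x, e|rewrite /sn_ball /= subrr sn0].
Qed.

HB.instance Definition _ := PreTopologicalLmod_isTvs.Build R[i] T
  sn_add_continuous sn_scale_continuous sn_locally_convex.
HB.instance Definition _ :=
  PreTopologicalNmodule_isTopologicalNmodule.Build T sn_add_continuous.
HB.instance Definition _ :=
  TopologicalNmodule_isTopologicalLmodule.Build R[i] T sn_scale_continuous.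
HB.instance Definition _ := Uniform_isTvs.Build R[i] T sn_locally_convex.

End SeminormedSpace.


Definition generates_topology (R : realType) (E : tvsType R[i])
    (p : seminorms E) : Prop :=
  forall U : set E, nbhs (0 : E) U <->
    exists a, exists2 e : R, 0 < e & [set x | p a x < e] `<=` U.

(* Cauchy sequences are those of the additive group of E.  A tvsType may carry
   any uniformity compatible with its topology, so the library's cauchy, which
   refers to that uniformity, could be a different notion. *)
Definition sequentially_complete (R : realType) (E : tvsType R[i]) : Prop :=
  forall u : nat -> E,
    u mn.1 - u mn.2 @[mn --> (\oo, \oo)] --> (0 : E) ->
    exists l : E, u @ \oo --> l.

Section Calculus.
Context (R : realType) (E : tvsType R[i]).
Implicit Types (f : R[i] -> E) (z v : R[i]) (Omega : set R[i]).

(* A tvsType is not pointed, which the library's lim requires. *)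
Definition limit_value (F : set_system E) : E := xget 0 [set l : E | F --> l].

Definition complex_quotient f z (h : R[i]) : E := h^-1 *: (f (z + h) - f z).

Definition complex_derivable f z : Prop :=
  exists l : E, complex_quotient f z h @[h --> (0 : R[i])^'] --> l.

Definition complex_derive f z : E :=
  limit_value (complex_quotient f z h @[h --> (0 : R[i])^']).

(* Functions on an open set Omega are represented by total functions whose
   values outside Omega are irrelevant. *)
Definition holomorphic_on Omega f : Prop :=
  forall z, Omega z -> complex_derivable f z.

(* Real difference quotient in the direction v; v = 1 and v = 'i give the
   partial derivatives on C = R^2. *)
Definition real_quotient v f z (h : R) : E :=
  (h^-1)%:C *: (f (z + h%:C * v) - f z).

Definition partially_derivable v f z : Prop :=
  exists l : E, real_quotient v f z h @[h --> (0 : R)^'] --> l.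

Definition partial v f z : E :=
  limit_value (real_quotient v f z h @[h --> (0 : R)^']).

Fixpoint continuously_derivable (k : nat) Omega f : Prop :=
  if k is k'.+1 then
    forall v, v = 1 \/ v = 'i ->
      (forall z, Omega z -> partially_derivable v f z) /\
      continuously_derivable k' Omega (partial v f)
  else forall z, Omega z -> {for z, continuous f}.

Definition smooth_on Omega f : Prop :=
  forall k, continuously_derivable k Omega f.

Definition partials (b : nat * nat) f : R[i] -> E :=
  iter b.1 (partial 1) (iter b.2 (partial 'i) f).

Definition dbar f z : E := (2^-1)%:C *: (partial 1 f z + 'i *: partial 'i f z).

End Calculus.

Section Admissibility.
Context (R : realType).
Implicit Types (K : set (\bar R)) (n m : nat).

Definition finite_part K : set R[i] := [set x%:C | x in [set x : R | K x%:E]].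

(* The infimum over the empty set is +oo. *)
Definition distance (z : R[i]) (S : set R[i]) : \bar R :=
  ereal_inf [set (modulus (z - w))%:E | w in S].

Definition U_ K n : set R[i] :=
  [set z | (distance z (finite_part K) < (n%:R^-1)%:E)%E] `|`
  [set z | K +oo%E /\ n%:R < complex.Re z /\ `|complex.Im z| < n%:R^-1] `|`
  [set z | K -oo%E /\ complex.Re z < - n%:R /\ `|complex.Im z| < n%:R^-1].

Definition S_ K n : set R[i] :=
  ~` closure (U_ K n) `&` [set z | `|complex.Im z| < n%:R].

Definition E_exp (E : tvsType R[i]) (p : seminorms E) K : set (R[i] -> E) :=
  [set f | smooth_on (~` finite_part K) f /\
    forall n m a, (0 < n)%N ->
      has_ubound [set r | exists z b, [/\ S_ K n z, (b.1 + b.2 <= m)%N &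
        r = p a (partials b f z) * expR (- (n%:R^-1 * `|complex.Re z|))]]].

(* The elements of E_exp p K are functions on the complement of K, hence the
   restriction of the final equation to that set. *)
Definition admissible (E : tvsType R[i]) (p : seminorms E) : Prop :=
  forall K, compact K -> forall g, E_exp p K g ->
    exists2 f, E_exp p K f & forall z, (~` finite_part K) z -> dbar f z = g z.

End Admissibility.

(* A is an unbounded operator in E: D is its domain as a subset of E, and F is
   that domain as a vector space, embedded in E by val. *)
Section GraphSpace.
Context (R : realType) (E : tvsType R[i]) (p : seminorms E).
Context (D : pred E) (F : subLmodType D) (A : {linear F -> E}).

Definition sequentially_closed : Prop :=
  forall (u : nat -> F) (x y : E),
    (val \o u) @ \oo --> x -> (A \o u) @ \oo --> y ->
    exists2 w : F, val w = x & A w = y.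

Definition graph_sn (a : sn_index p) (x : F) : R := p a (val x) + p a (A x).

Let graph_sn_ler_add a x y : graph_sn a (x + y) <= graph_sn a x + graph_sn a y.
Proof. by rewrite /graph_sn !raddfD addrACA lerD // sn_ler_add. Qed.

Let graph_sn_scale a (l : R[i]) x :
  graph_sn a (l *: x) = modulus l * graph_sn a x.
Proof. by rewrite /graph_sn !linearZ !sn_scale mulrDr. Qed.

Let graph_sn_directed a b : exists c, exists2 M : R, 0 < M & forall x,
  graph_sn a x <= M * graph_sn c x /\ graph_sn b x <= M * graph_sn c x.
Proof.
have [c [M M0 cM]] := sn_directed (s := p) a b; exists c, M => // x.
by rewrite /graph_sn mulrDr !lerD //; case: (cM (val x)); case: (cM (A x)).
Qed.

Definition graph_seminorms : seminorms F :=
  Seminorms graph_sn_ler_add graph_sn_scale (sn_nonempty p) graph_sn_directed.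

Definition graph_space : tvsType R[i] := seminormed_space graph_seminorms.

End GraphSpace.

Section Hyperfunctions.
Context (R : realType).

Definition nonneg_axis : set R[i] := [set x%:C | x in [set x : R | 0 <= x]].

(* The coset of u modulo O(C, E), as functions on the complement of [0, oo[. *)
Definition hyperfunction (E : tvsType R[i]) (u : R[i] -> E) : set (R[i] -> E) :=
  [set v | exists2 g, holomorphic_on setT g &
     forall z, (~` nonneg_axis) z -> v z - u z = g z].

Context (E : tvsType R[i]) (p : seminorms E).
Context (D : pred E) (F : subLmodType D) (A : {linear F -> E}).
Local Notation F_A := (graph_space p A).

(* The difference d/dt [u] - A[u] is formed on representatives, after the
   inclusion of F_A into E. *)
Definition hyperfunction_solution (x0 : E) (c : set (R[i] -> F_A)) : Prop :=
  exists u : R[i] -> F_A, [/\ holomorphic_on (~` nonneg_axis) u,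
    c = hyperfunction u &
    hyperfunction (fun z => val (complex_derive u z : F) - A (u z)) =
    hyperfunction (fun z => - (2 * (pi : R)%:C * 'i * z)^-1 *: x0)].

Definition uniqueness_property : Prop :=
  forall c, hyperfunction_solution 0 c <-> c = hyperfunction (fun=> 0).

End Hyperfunctions.

(* Main.v *)
Require Import Defs.
From HB Require Import structures.
From mathcomp Require Import all_boot all_order all_algebra complex ring lra.
From mathcomp Require Import all_classical all_reals all_analysis.

Set Implicit Arguments.
Unset Strict Implicit.
Unset Printing Implicit Defensive.

Import Order.TTheory GRing.Theory Num.Theory.
Import numFieldNormedType.Exports.

Local Open Scope classical_set_scope.
Local Open Scope complex_scope.
Local Open Scope ring_scope.

(** Let [u] be holomorphic off [[0, oo[] with values in [F_A], and suppose that
    [u' - A u] extends to an entire function [g]. The theorem says that [u]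
    extends to an entire function. The proof studies Laplace integrals of [u]
    over bounded contours, which makes sense without any growth condition on [u].

    Let the contour [G_a] run from [a - i/2] to [a + i/2] around [- 1], and let
    [y] be a continuous functional on [F_A]. Writing [y = (t - A^t) yt - s] gives

      y (u) e^(-tw) = - (yt (u) e^(-tw))' + yt (g) e^(-tw) - s (u) e^(-tw).

    Integrated over [G_a], the first term leaves values at [a - i/2] and
    [a + i/2], and the second, being entire, can be integrated over the segment
    between these points instead. Both are [O(e^((k - a) t))], the last is
    [O(e^(-(n - 1) t))]. As [a] may be chosen after [k], the truncated Laplace
    transform of [y (u)] is [O(e^(-n t))] for every [n], for a suitable [a]
    depending on [n] ([u_integral_decay]).

    This decay continues the scalar function [f = y (u)] across the half-line
    ([holomorphic_extension]). For [z] slightly to the left of [G_a], the residue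
    theorem gives [2 pi i f(z)] as the difference of the integrals of
    [f(w) / (1 - e^(z - w))] over [G_a] and over the same contour with its left
    side moved beyond [z]. The second integral is holomorphic
    in [z] inside its contour. The first, expanded geometrically, is the series
    of the [F(j) e^(jz)], where [F] is the truncated transform; by the decay it
    converges for [Re z < n]. So the difference continues [f] up to [Re z < n], and
    by the identity theorem it agrees with [f] on both sides of the half-line.

    Finally, each [y (u)] having a continuation, the divided differences of [u]
    near a point of the half-line are weakly bounded, hence bounded in every
    seminorm ([weakly_bounded_bounded], from [hahn_banach] and a gliding hump).
    Completeness of [F_A] then yields boundary values of [u] on the half-line and
    complex derivatives there ([entire_extension]).

    The function theory this rests on (Goursat's theorem, the residue formula,
    bounds for divided differences, the identity theorem) is developed on
    rectangles. *)

(** * The modulus of a complex number *)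

Ltac by_parts :=
  apply/eqP; rewrite eq_complex /=; apply/andP; split; apply/eqP; ring.

Section Modulus.
Context {R : realType}.
Implicit Types (z w : R[i]) (x y : R).

Lemma modulusM z w : modulus (z * w) = modulus z * modulus w.
Proof. by apply: complexI; rewrite rmorphM /= !modulusE normrM. Qed.

Lemma modulus_le_add z w : modulus (z + w) <= modulus z + modulus w.
Proof. by rewrite -lecR rmorphD /= !modulusE ler_normD. Qed.

Lemma modulusN z : modulus (- z) = modulus z.
Proof. by apply: complexI; rewrite !modulusE normrN. Qed.

Lemma modulus_distC z w : modulus (z - w) = modulus (w - z).
Proof. by rewrite -modulusN opprB. Qed.

Lemma modulus_le_sub z w : modulus (z - w) <= modulus z + modulus w.
Proof. by rewrite -(modulusN w) modulus_le_add. Qed.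

Lemma modulus_triangle t z w :
  modulus (z - w) <= modulus (z - t) + modulus (t - w).
Proof. by rewrite -[z - w](subrKA t) modulus_le_add. Qed.

Lemma modulusV z : modulus z^-1 = (modulus z)^-1.
Proof. by apply: complexI; rewrite fmorphV /= !modulusE normfV. Qed.

Lemma modulus0 : modulus (0 : R[i]) = 0.
Proof. by apply: complexI; rewrite modulusE normr0. Qed.

Lemma modulus1 : modulus (1 : R[i]) = 1.
Proof. by apply: complexI; rewrite modulusE normr1. Qed.

Lemma modulusX z n : modulus (z ^+ n) = modulus z ^+ n.
Proof. by apply: complexI; rewrite rmorphXn /= !modulusE normrX. Qed.

Lemma modulus_i : modulus ('i : R[i]) = 1.
Proof. by rewrite /modulus normc_def /= expr0n expr1n add0r sqrtr1. Qed.

Lemma modulus_eq0 z : (modulus z == 0) = (z == 0).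
Proof.
by rewrite -(inj_eq (@complexI _)) modulusE (_ : 0%:C = 0) // normr_eq0.
Qed.

Lemma modulus_gt0 z : (0 < modulus z) = (z != 0).
Proof. by rewrite lt_neqAle modulus_ge0 andbT eq_sym modulus_eq0. Qed.

Lemma modulusiM z : modulus ('i * z) = modulus z.
Proof. by rewrite modulusM modulus_i mul1r. Qed.

Lemma ReD z w : complex.Re (z + w) = complex.Re z + complex.Re w.
Proof. by case: z w => [? ?] [? ?]. Qed.

Lemma ImD z w : complex.Im (z + w) = complex.Im z + complex.Im w.
Proof. by case: z w => [? ?] [? ?]. Qed.

Lemma ReB z w : complex.Re (z - w) = complex.Re z - complex.Re w.
Proof. by case: z w => [? ?] [? ?]. Qed.

Lemma ImB z w : complex.Im (z - w) = complex.Im z - complex.Im w.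
Proof. by case: z w => [? ?] [? ?]. Qed.

Lemma Re_le_modulus z : `|complex.Re z| <= modulus z.
Proof. by rewrite -lecR modulusE normc_ge_Re. Qed.

Lemma Im_le_modulus z : `|complex.Im z| <= modulus z.
Proof.
rewrite -modulusiM; apply: le_trans (Re_le_modulus _).
by case: z => a b /=; rewrite mul0r mul1r sub0r normrN.
Qed.

Lemma modulus_le_ReIm z :
  modulus z <= `|complex.Re z| + `|complex.Im z|.
Proof.
rewrite {1}[z]complexE; apply: le_trans (modulus_le_add _ _) _.
by rewrite modulusiM !modulus_real.
Qed.

Lemma modulus_Complex x y : modulus (x +i* y) <= `|x| + `|y|.
Proof. exact: modulus_le_ReIm. Qed.

Lemma modulus_sub_ge z w : modulus z - modulus w <= modulus (z - w).
Proof. by rewrite lerBlDr -{1}(subrK w z) modulus_le_add. Qed.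

Lemma modulus_le0 z : (forall e, 0 < e -> modulus z <= e) -> z = 0.
Proof.
move=> h; apply/eqP; rewrite -modulus_eq0 eq_le modulus_ge0 andbT.
by apply/ler_addgt0Pl => e e0; rewrite addr0 h.
Qed.

Lemma cvg_modulusP (T : Type) (F : set_system T) {FF : Filter F} (f : T -> R[i])
    (l : R[i]) :
  f @ F --> l <-> forall e : R, 0 < e -> \forall x \near F, modulus (f x - l) < e.
Proof.
rewrite (@cvgrPdist_lt _ _ _ F FF f l); split=> h e e0.
  have /h : (0 : R[i]) < e%:C by rewrite ltcR.
  apply: filterS => x; rewrite distrC -modulusE ltcR; exact.
have [e' e'0 ->] : exists2 e' : R, 0 < e' & e = e'%:C.
  case: e e0 => a b; rewrite ltcE /= => /andP[/eqP -> a0]; by exists a.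
have := h _ e'0; apply: filterS => x.
by rewrite distrC -modulusE ltcR.
Qed.

Lemma nbhs_modulusP z (U : set R[i]) :
  nbhs z U <-> exists2 d : R, 0 < d & forall w, modulus (w - z) < d -> U w.
Proof.
split.
  rewrite -nbhs_ballE => -[e e0 h].
  have [e' e'0 ee] : exists2 e' : R, 0 < e' & e = e'%:C.
    by case: e e0 {h} => a b /=; rewrite ltcE /= => /andP[/eqP -> a0]; exists a.
  exists e' => // w hw; apply: h; rewrite /ball /= ee distrC -modulusE ltcR //.
move=> [d d0 h]; rewrite -nbhs_ballE; exists d%:C; first by rewrite /= ltcR.
move=> w; rewrite /ball /= distrC -modulusE ltcR; exact: h.
Qed.

Lemma continuous_modulusP (f : R[i] -> R[i]) z :
  {for z, continuous f} <->
  forall e : R, 0 < e ->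
  exists2 d : R, 0 < d & forall w, modulus (w - z) < d -> modulus (f w - f z) < e.
Proof.
have P := @cvg_modulusP _ (nbhs z) (nbhs_filter z) f (f z).
by split=> [/P h e /h /nbhs_modulusP | h]; last by apply/P => e /h /nbhs_modulusP.
Qed.

End Modulus.

(** * Complex differentiation *)

Section ComplexDerivative.
Context {R : realType}.
Implicit Types (f g : R[i] -> R[i]) (z w l : R[i]).

Definition continuous_pt f z : Prop := forall e : R, 0 < e ->
  exists2 d : R, 0 < d &
    forall w, modulus (w - z) < d -> modulus (f w - f z) < e.

Lemma continuous_ptP f z : continuous_pt f z <-> {for z, continuous f}.
Proof. exact: (iff_sym (continuous_modulusP f z)). Qed.

Lemma continuous_pt_cst c z : continuous_pt (fun=> c) z.
Proof. by move=> e e0; exists 1 => // w _; rewrite subrr modulus0. Qed.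

Lemma continuous_pt_id z : continuous_pt id z.
Proof. by move=> e e0; exists e. Qed.

Lemma continuous_ptD f g z : continuous_pt f z -> continuous_pt g z ->
  continuous_pt (fun w => f w + g w) z.
Proof.
move=> /continuous_ptP cf /continuous_ptP cg; apply/continuous_ptP.
exact: (@continuousD R[i] R[i] R[i] f g z cf cg).
Qed.

Lemma continuous_ptN f z : continuous_pt f z -> continuous_pt (fun w => - f w) z.
Proof.
move=> /continuous_ptP cf; apply/continuous_ptP.
exact: (@continuousN R[i] R[i] R[i] f z cf).
Qed.

Lemma continuous_ptB f g z : continuous_pt f z -> continuous_pt g z ->
  continuous_pt (fun w => f w - g w) z.
Proof. by move=> cf /continuous_ptN; exact: continuous_ptD. Qed.

Lemma continuous_ptM f g z : continuous_pt f z -> continuous_pt g z ->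
  continuous_pt (fun w => f w * g w) z.
Proof.
move=> /continuous_ptP cf /continuous_ptP cg; apply/continuous_ptP.
exact: (@continuousM R[i] R[i] f g z cf cg).
Qed.

Lemma continuous_ptV f z : f z != 0 -> continuous_pt f z ->
  continuous_pt (fun w => (f w)^-1) z.
Proof.
move=> fz /continuous_ptP cf; apply/continuous_ptP.
exact: (@cvgV R[i] R[i] (nbhs z) _ f (f z) fz cf).
Qed.

Lemma continuous_pt_comp f g z : continuous_pt g z -> continuous_pt f (g z) ->
  continuous_pt (fun w => f (g w)) z.
Proof.
move=> cg cf e /cf[d d0 fd]; have [d' d'0 gd] := cg _ d0.
by exists d' => // w /gd /fd.
Qed.

Lemma continuous_pt_ext f g z : (forall w, f w = g w) ->
  continuous_pt f z -> continuous_pt g z.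
Proof. by move=> /funext ->. Qed.

Lemma continuous_pt_sum (n : nat) (F : nat -> R[i] -> R[i]) z :
  (forall i, continuous_pt (F i) z) ->
  continuous_pt (fun w => \sum_(i < n) F i w) z.
Proof.
move=> cF; elim: n => [|n IH].
  by apply: continuous_pt_ext (continuous_pt_cst 0 z) => w; rewrite big_ord0.
by apply: continuous_pt_ext (continuous_ptD IH (cF n)) => w; rewrite big_ord_recr.
Qed.

Lemma continuous_pt_near f g z d : 0 < d ->
  (forall w, modulus (w - z) < d -> f w = g w) ->
  continuous_pt f z -> continuous_pt g z.
Proof.
move=> d0 fg cf e /cf[d' d'0 h].
exists (Num.min d d'); first by rewrite lt_min d0.
move=> w; rewrite lt_min => /andP[wd wd']; rewrite -!fg ?subrr ?modulus0 //.
exact: h.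
Qed.

(** Caratheodory's form of the derivative reduces products, inverses and
    compositions to the algebra of continuous functions. *)
Definition cderiv f z l := exists phi : R[i] -> R[i],
  [/\ continuous_pt phi z, phi z = l &
      forall w, f w = f z + phi w * (w - z)].

(** Differentiability at the single point [z]; neighbourhoods appear only where a
    contour needs them. *)
Definition holomorphic_at f z := exists l, cderiv f z l.

Lemma cderiv_continuous f z l : cderiv f z l -> continuous_pt f z.
Proof.
move=> [phi [cphi _ fE]].
have -> : f = (fun w => f z + phi w * (w - z)) by apply/funext.
apply: continuous_ptD; first exact: continuous_pt_cst.
apply: continuous_ptM; first exact: cphi.
by apply: continuous_ptB; [exact: continuous_pt_id | exact: continuous_pt_cst].
Qed.

Lemma holomorphic_continuous f z :
  holomorphic_at f z -> continuous_pt f z.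
Proof. by move=> [l /cderiv_continuous]. Qed.

Lemma cderiv_cst c z : cderiv (fun=> c) z 0.
Proof.
by exists (fun=> 0); split=> //; [exact: continuous_pt_cst | move=> w; rewrite mul0r addr0].
Qed.

Lemma cderiv_id z : cderiv id z 1.
Proof.
exists (fun=> 1); split=> //; [exact: continuous_pt_cst | move=> w /=; ring].
Qed.

Lemma cderivD f g z l m : cderiv f z l -> cderiv g z m ->
  cderiv (fun w => f w + g w) z (l + m).
Proof.
move=> [p [cp <- fE]] [q [cq <- gE]]; exists (fun w => p w + q w); split=> //.
  exact: continuous_ptD.
by move=> w; rewrite (fE w) (gE w) /=; ring.
Qed.

Lemma cderivM f g z l m : cderiv f z l -> cderiv g z m ->
  cderiv (fun w => f w * g w) z (l * g z + f z * m).
Proof.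
move=> df [q [cq <- gE]]; have [p [cp <- fE]] := df.
exists (fun w => p w * g z + f w * q w); split=> //.
  apply: continuous_ptD; first by apply: continuous_ptM; [exact: cp | exact: continuous_pt_cst].
  by apply: continuous_ptM; [exact: (cderiv_continuous df) | exact: cq].
by move=> w; rewrite (gE w) mulrDr {1}(fE w); ring.
Qed.

Lemma cderivV f z l : cderiv f z l -> f z != 0 ->
  cderiv (fun w => (f w)^-1) z (- l / f z ^+ 2).
Proof.
move=> df fz0; have [p [cp <- fE]] := df.
have cf := cderiv_continuous df.
(* the quotient -p/(f z f w) is only correct where f w <> 0; elsewhere the
   convention 0^-1 = 0 forces another value *)
pose q w := if f w == 0 then - (f z)^-1 / (w - z) else - p w / (f z * f w).
exists q; split; last 1 first.
- move=> w; rewrite /q; case: eqVneq => fw0.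
    have wz : w - z != 0.
      by apply: contra_eqN fw0 => /eqP wz; rewrite fE wz mulr0 addr0.
    by rewrite fw0 invr0 divfK // subrr.
  have fwz : f w - f z = p w * (w - z) by rewrite (fE w); ring.
  transitivity ((f z)^-1 - (f w - f z) / (f z * f w)); last by rewrite fwz; ring.
  by field; rewrite fz0 fw0.
- have fz : continuous_pt (fun w => - p w / (f z * f w)) z.
    apply: continuous_ptM; first by apply: continuous_ptN; exact: cp.
    apply: continuous_ptV; first by rewrite mulf_neq0.
    by apply: continuous_ptM; [exact: continuous_pt_cst | exact: cf].
  have := cf (modulus (f z)).
  rewrite modulus_gt0 => /(_ fz0)[d d0 fd].
  apply: continuous_pt_near d0 _ fz => w /fd; rewrite /q.
  by case: eqVneq => // ->; rewrite sub0r modulusN ltxx.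
- by rewrite /q (negbTE fz0) expr2.
Qed.

Lemma cderiv_ext f g z l : (forall w, f w = g w) -> cderiv f z l -> cderiv g z l.
Proof. by move=> /funext ->. Qed.

Lemma cderiv_near f g z l d : 0 < d ->
  (forall w, modulus (w - z) < d -> f w = g w) -> cderiv f z l -> cderiv g z l.
Proof.
move=> d0 fg [p [cp pz fE]].
exists (fun w => if modulus (w - z) < d then p w else (g w - g z) / (w - z)).
have zz : modulus (z - z) < d by rewrite subrr modulus0.
split.
- by apply: continuous_pt_near d0 _ cp => w ->.
- by rewrite zz.
- move=> w; case: ifPn => wd; first by rewrite -!fg.
  rewrite divfK; first by rewrite subrKC.
  by apply: contraNneq wd => ->; rewrite modulus0.
Qed.

Lemma cderiv_comp f g z l m : cderiv g z m -> cderiv f (g z) l ->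
  cderiv (fun w => f (g w)) z (l * m).
Proof.
move=> dg [p [cp <- fE]]; have [q [cq <- gE]] := dg.
exists (fun w => p (g w) * q w); split=> //.
  apply: continuous_ptM; last exact: cq.
  exact: continuous_pt_comp (cderiv_continuous dg) cp.
move=> w; rewrite (fE (g w)) {2}(gE w); ring.
Qed.

Lemma holomorphic_cst c z : holomorphic_at (fun=> c) z.
Proof. by exists 0; exact: cderiv_cst. Qed.

Lemma holomorphicD f g z : holomorphic_at f z -> holomorphic_at g z ->
  holomorphic_at (fun w => f w + g w) z.
Proof. by move=> [l fl] [m gm]; eexists; exact: cderivD fl gm. Qed.

Lemma holomorphicM f g z : holomorphic_at f z -> holomorphic_at g z ->
  holomorphic_at (fun w => f w * g w) z.
Proof. by move=> [l fl] [m gm]; eexists; exact: cderivM fl gm. Qed.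

Lemma holomorphicN f z : holomorphic_at f z ->
  holomorphic_at (fun w => - f w) z.
Proof.
move=> /(holomorphicM (holomorphic_cst (-1) z))[l fl]; exists l.
by apply: cderiv_ext fl => w /=; rewrite mulN1r.
Qed.

Lemma holomorphicB f g z : holomorphic_at f z -> holomorphic_at g z ->
  holomorphic_at (fun w => f w - g w) z.
Proof. by move=> fz /holomorphicN; exact: holomorphicD. Qed.

Lemma holomorphicV f z : holomorphic_at f z -> f z != 0 ->
  holomorphic_at (fun w => (f w)^-1) z.
Proof. by move=> [l fl] fz; eexists; exact: cderivV fl fz. Qed.

Lemma holomorphicX f n z : holomorphic_at f z ->
  holomorphic_at (fun w => f w ^+ n) z.
Proof.
move=> fz; elim: n => [|n [l IH]]; first exact: holomorphic_cst.
have [m gm] := holomorphicM fz (ex_intro _ _ IH); exists m.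
by apply: cderiv_ext gm => w; rewrite exprS.
Qed.

Lemma holomorphic_sub_cst a z : holomorphic_at (fun w => w - a) z.
Proof.
by apply: holomorphicB; [exists 1; exact: cderiv_id | exact: holomorphic_cst].
Qed.

Lemma holomorphic_cst_sub a z : holomorphic_at (fun w => a - w) z.
Proof.
by apply: holomorphicB; [exact: holomorphic_cst | exists 1; exact: cderiv_id].
Qed.

Lemma holomorphic_near f g z d : 0 < d ->
  (forall w, modulus (w - z) < d -> f w = g w) ->
  holomorphic_at f z -> holomorphic_at g z.
Proof. by move=> d0 fg [l fl]; exists l; exact: cderiv_near d0 fg fl. Qed.

Lemma holomorphic_sum (I : Type) (s : seq I) (F : I -> R[i] -> R[i]) z :
  (forall i, holomorphic_at (F i) z) ->
  holomorphic_at (fun w => \sum_(i <- s) F i w) z.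
Proof.
move=> dF; elim: s => [|i s [l IH]].
  by exists 0; apply: cderiv_ext (cderiv_cst 0 z) => w /=; rewrite big_nil.
have [m gm] := holomorphicD (dF i) (ex_intro _ _ IH); exists m.
by apply: cderiv_ext gm => w; rewrite big_cons.
Qed.

End ComplexDerivative.

(** * Integrals of complex-valued functions over intervals *)

Section PathIntegral.
Context {R : realType}.
Local Notation mu := (@lebesgue_measure R).
Implicit Types (a b c : R) (phi psi : R -> R[i]).

Definition path_integral a b phi : R[i] :=
  (\int[mu]_(x in `[a, b]) complex.Re (phi x)) +i*
  (\int[mu]_(x in `[a, b]) complex.Im (phi x)).

Definition continuous_path a b phi : Prop :=
  {within `[a, b], continuous (fun x => complex.Re (phi x))} /\
  {within `[a, b], continuous (fun x => complex.Im (phi x))}.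

Lemma continuous_pathP a b phi :
  (forall x, a <= x <= b -> forall e : R, 0 < e -> exists2 d : R, 0 < d &
     forall x', `|x' - x| < d -> modulus (phi x' - phi x) < e) ->
  continuous_path a b phi.
Proof.
move=> cphi; split; apply: continuous_in_subspaceT => x /set_mem /=;
  rewrite in_itv /= => xab; apply/cvgrPdist_lt => e e0;
  have [d d0 hd] := cphi x xab e e0; apply/nbhs_ballP; exists d => // x' /=;
  rewrite /ball /= distrC => /hd; apply: le_lt_trans.
- by rewrite modulus_distC -ReB Re_le_modulus.
- by rewrite modulus_distC -ImB Im_le_modulus.
Qed.

Lemma continuous_path_sub a b a' b' phi : a <= a' -> b' <= b ->
  continuous_path a b phi -> continuous_path a' b' phi.
Proof.
move=> aa bb [cR cI]; split; [apply: continuous_subspaceW cR |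
  apply: continuous_subspaceW cI] => x /=; rewrite !in_itv /= => /andP[h1 h2];
  by rewrite (le_trans aa h1) (le_trans h2 bb).
Qed.

Lemma continuous_path_integrable a b phi : continuous_path a b phi ->
  mu.-integrable `[a, b] (EFin \o (fun x => complex.Re (phi x))) /\
  mu.-integrable `[a, b] (EFin \o (fun x => complex.Im (phi x))).
Proof.
by move=> [cR cI]; split; apply: continuous_compact_integrable => //;
  exact: segment_compact.
Qed.

Lemma continuous_path_bounded a b phi : a <= b -> continuous_path a b phi ->
  exists2 B : R, 0 < B & forall x, a <= x <= b -> modulus (phi x) <= B.
Proof.
move=> ab [cR cI].
have bnd (g : R -> R) : {within `[a, b], continuous g} ->
    exists2 B : R, 0 <= B & forall x, a <= x <= b -> `|g x| <= B.
  move=> cg; have [M [_ hM]] :=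
    compact_bounded (continuous_compact cg (@segment_compact _ a b)).
  exists (`|M| + 1); first by rewrite addr_ge0.
  move=> x xab; apply: (hM (`|M| + 1)); first by rewrite ltr_pwDr // ler_norm.
  by exists x => //=; rewrite in_itv.
have [B1 B10 h1] := bnd _ cR; have [B2 B20 h2] := bnd _ cI.
exists (B1 + B2 + 1); first by rewrite ltr_wpDl // addr_ge0.
move=> x xab; apply: le_trans (modulus_le_ReIm _) _.
by apply: ler_wpDr => //; rewrite lerD // ?h1 ?h2.
Qed.

Lemma path_integralD a b phi psi :
  continuous_path a b phi -> continuous_path a b psi ->
  path_integral a b (fun x => phi x + psi x) =
  path_integral a b phi + path_integral a b psi.
Proof.
move=> /continuous_path_integrable[f1 f2] /continuous_path_integrable[g1 g2].
rewrite /path_integral; apply/eqP; rewrite eq_complex /=.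
rewrite -!RintegralD //; apply/andP; split; apply/eqP; apply: eq_Rintegral => x _;
  by rewrite ?ReD ?ImD.
Qed.

Lemma path_integralZ a b (l : R[i]) phi : continuous_path a b phi ->
  path_integral a b (fun x => l * phi x) = l * path_integral a b phi.
Proof.
move=> /continuous_path_integrable[f1 f2].
have ZR (r : R) g : mu.-integrable `[a, b] (EFin \o g) ->
    mu.-integrable `[a, b] (EFin \o (fun x => r * g x)).
  by move=> /(integrableZl _ r); apply => //; exact: measurable_itv.
case: l => l m; rewrite /path_integral; apply/eqP; rewrite eq_complex /=.
rewrite -!RintegralZl // -RintegralB -?RintegralD //; try exact: ZR.
apply/andP; split; apply/eqP; apply: eq_Rintegral => x _;
  by case: (phi x) => u v /=.
Qed.

Lemma path_integralN a b phi : continuous_path a b phi ->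
  path_integral a b (fun x => - phi x) = - path_integral a b phi.
Proof.
move=> cphi; rewrite -mulN1r -path_integralZ //.
by congr path_integral; apply/funext => x; rewrite mulN1r.
Qed.

Lemma continuous_pathN a b phi :
  continuous_path a b phi -> continuous_path a b (fun x => - phi x).
Proof.
move=> [cR cI]; split.
  have -> : (fun x => complex.Re (- phi x)) = (fun x => - complex.Re (phi x)).
    by apply/funext => x; case: (phi x).
  exact: (fun x => @continuousN _ _ _ _ x (cR x)).
have -> : (fun x => complex.Im (- phi x)) = (fun x => - complex.Im (phi x)).
  by apply/funext => x; case: (phi x).
exact: (fun x => @continuousN _ _ _ _ x (cI x)).
Qed.

Lemma path_integralB a b phi psi :
  continuous_path a b phi -> continuous_path a b psi ->
  path_integral a b (fun x => phi x - psi x) =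
  path_integral a b phi - path_integral a b psi.
Proof.
move=> cphi cpsi; rewrite path_integralD ?path_integralN //.
exact: continuous_pathN.
Qed.

Lemma eq_path_integral a b phi psi :
  (forall x, a <= x <= b -> phi x = psi x) ->
  path_integral a b phi = path_integral a b psi.
Proof.
move=> e; rewrite /path_integral; congr (_ +i* _); apply: eq_Rintegral => x;
  by move=> /set_mem /=; rewrite in_itv /= => /e ->.
Qed.

Lemma path_integral_cat a b c phi : a <= b -> b <= c ->
  continuous_path a c phi ->
  path_integral a c phi = path_integral a b phi + path_integral b c phi.
Proof.
move=> ab bc cphi; have [f1 f2] := continuous_path_integrable cphi.
have [g1 g2] := continuous_path_integrable (continuous_path_sub ab (lexx c) cphi).
have cat (g : R -> R) : mu.-integrable `[a, c] (EFin \o g) ->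
    mu.-integrable `[b, c] (EFin \o g) ->
    \int[mu]_(x in `[a, c]) g x =
    \int[mu]_(x in `[a, b]) g x + \int[mu]_(x in `[b, c]) g x.
  move=> ig ig'; rewrite -(subrKC (\int[mu]_(x in `[a, b]) g x)
    (\int[mu]_(x in `[a, c]) g x)); congr (_ + _).
  rewrite Rintegral_itvB ?bnd_simp // Rintegral_itv_obnd_cbnd //.
  apply: integrableS ig' => //.
  by move=> x /=; rewrite !in_itv /= => /andP[/ltW -> ->].
by rewrite /path_integral; apply/eqP; rewrite eq_complex /= -!cat // !eqxx.
Qed.

(** The factor 2 comes from bounding real and imaginary parts separately; sharp
    constants are never needed. *)
Lemma path_integral_bound a b phi (B : R) : a <= b -> continuous_path a b phi ->
  (forall x, a <= x <= b -> modulus (phi x) <= B) ->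
  modulus (path_integral a b phi) <= 2 * B * (b - a).
Proof.
move=> ab cphi hB; have [f1 f2] := continuous_path_integrable cphi.
have bnd (g : R -> R) : mu.-integrable `[a, b] (EFin \o g) ->
    (forall x, a <= x <= b -> `|g x| <= B) ->
    `|\int[mu]_(x in `[a, b]) g x| <= B * (b - a).
  move=> ig gB; apply: le_trans (le_normr_Rintegral _ ig) _ => //.
  have -> : B * (b - a) = \int[mu]_(x in `[a, b]) B.
    rewrite Rintegral_cst //= lebesgue_measure_itv /= lte_fin.
    case: ltP => //= ba.
    by rewrite (le_anti (_ : a <= b <= a)) ?ab // subrr.
  apply: le_Rintegral => //.
  - by have := integrable_norm ig; apply.
  - apply: continuous_compact_integrable; first exact: segment_compact.
    by move=> x; exact: cst_continuous.
apply: le_trans (modulus_Complex _ _) _.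
have -> : 2 * B * (b - a) = B * (b - a) + B * (b - a) by ring.
apply: lerD; apply: bnd => // x /hB; apply: le_trans.
  exact: Re_le_modulus.
exact: Im_le_modulus.
Qed.

Lemma Rintegral_primitive a b (G h : R -> R) : a < b ->
  {within `[a, b], continuous h} ->
  (forall x, a <= x <= b -> is_derive x 1 G (h x)) ->
  \int[mu]_(x in `[a, b]) h x = G b - G a.
Proof.
move=> ab ch dG.
have itv x : x \in `]a, b[ -> a <= x <= b.
  by rewrite in_itv /= => /andP[/ltW -> /ltW ->].
have cG x : a <= x <= b -> {for x, continuous G}.
  move=> /dG dGx; apply: differentiable_continuous; apply/derivable1_diffP.
  exact: ex_derive.
rewrite /Rintegral (@continuous_FTC2 _ _ G) //.
- split.
  + by move=> x /itv /dG ?; exact: ex_derive.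
  + by apply: cvg_at_right_filter; apply: cG; rewrite lexx ltW.
  + by apply: cvg_at_left_filter; apply: cG; rewrite lexx ltW.
- by move=> x /itv /dG ?; rewrite derive1E derive_val.
Qed.

(** The real and imaginary parts of [F (z0 + x v)] are real functions of [x] with
    derivatives those of [v f (z0 + x v)]; the fundamental theorem of calculus
    applies to each. *)
Lemma path_integral_primitive a b (F f : R[i] -> R[i]) (z0 v : R[i]) : a <= b ->
  modulus v = 1 ->
  (forall x, a <= x <= b -> cderiv F (z0 + x%:C * v) (f (z0 + x%:C * v))) ->
  continuous_path a b (fun x => v * f (z0 + x%:C * v)) ->
  path_integral a b (fun x => v * f (z0 + x%:C * v)) =
  F (z0 + b%:C * v) - F (z0 + a%:C * v).
Proof.
move=> + v1 dF cf; rewrite le_eqVlt => /predU1P[->|ab].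
  rewrite subrr /path_integral set_itv1 !Rintegral_set1; by [].
pose g x := F (z0 + x%:C * v).
have dg x : a <= x <= b -> exists phi : R -> R[i],
    [/\ (forall e : R, 0 < e -> exists2 d : R, 0 < d &
        forall x', `|x' - x| < d -> modulus (phi x' - phi x) < e),
      phi x = v * f (z0 + x%:C * v) &
      forall x', g x' - g x = (x' - x)%:C * phi x'].
  move=> /dF[p [cp pf gE]]; exists (fun x' => v * p (z0 + x'%:C * v)).
  have lin x' x'' : z0 + x'%:C * v - (z0 + x''%:C * v) = (x' - x'')%:C * v.
    by rewrite rmorphB /=; ring.
  split; last 2 first.
  - by rewrite pf.
  - by move=> x'; rewrite /g (gE (z0 + x'%:C * v)) lin; ring.
  move=> e /cp[d d0 hd]; exists d => // x' xd.
  by rewrite -mulrBr modulusM v1 mul1r hd // lin modulusM v1 mulr1 modulus_real.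
have ReZ (r : R) z : complex.Re (r%:C * z) = r * complex.Re z.
  by case: z => ? ? /=; rewrite mul0r subr0.
have ImZ (r : R) z : complex.Im (r%:C * z) = r * complex.Im z.
  by case: z => ? ? /=; rewrite mul0r addr0.
have is_derR x : a <= x <= b ->
    is_derive x 1 (fun x => complex.Re (g x))
      (complex.Re (v * f (z0 + x%:C * v))).
  move=> /dg[p [cp <- pE]]; apply/is_derive1_caratheodory.
  exists (fun x' => complex.Re (p x')); split=> //.
    by move=> x'; rewrite -ReB pE ReZ mulrC.
  apply/cvgrPdist_lt => e /cp[d d0 hd]; apply/nbhs_ballP; exists d => // x' /=.
  rewrite /ball /= distrC => /hd; apply: le_lt_trans.
  by rewrite modulus_distC -ReB Re_le_modulus.
have is_derI x : a <= x <= b ->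
    is_derive x 1 (fun x => complex.Im (g x))
      (complex.Im (v * f (z0 + x%:C * v))).
  move=> /dg[p [cp <- pE]]; apply/is_derive1_caratheodory.
  exists (fun x' => complex.Im (p x')); split=> //.
    by move=> x'; rewrite -ImB pE ImZ mulrC.
  apply/cvgrPdist_lt => e /cp[d d0 hd]; apply/nbhs_ballP; exists d => // x' /=.
  rewrite /ball /= distrC => /hd; apply: le_lt_trans.
  by rewrite modulus_distC -ImB Im_le_modulus.
case: cf => cR cI; rewrite /path_integral.
rewrite (Rintegral_primitive ab cR is_derR) (Rintegral_primitive ab cI is_derI).
rewrite /g -ReB -ImB; by case: (F _ - F _).
Qed.

End PathIntegral.

(** * Geometric decay *)

Section Geometric.
Context {R : realType}.

Lemma geometric_small (q M e : R) : 0 <= q < 1 -> 0 < e ->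
  exists n, M * q ^+ n < e.
Proof.
move=> /andP[q0 q1] e0.
have /cvgrPdist_lt/(_ (e / (`|M| + 1))) :
    (fun n => q ^+ n) @ \oo --> (0 : R).
  by apply: cvg_expr; rewrite ger0_norm.
have M0 : 0 < `|M| + 1 by rewrite ltr_wpDl.
rewrite divr_gt0 // => /(_ isT)[n _ /(_ n (leqnn n))] /=.
rewrite sub0r normrN ger0_norm ?exprn_ge0 // ltr_pdivlMr // => h; exists n.
apply: le_lt_trans h; rewrite mulrC ler_wpM2l ?exprn_ge0 //.
by apply: ler_wpDr => //; exact: ler_norm.
Qed.

Lemma nested_point (s t : nat -> R) :
  (forall n, s n <= s n.+1) -> (forall n, t n.+1 <= t n) ->
  (forall n, s n <= t n) -> exists x, forall n, s n <= x <= t n.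
Proof.
move=> s_incr t_decr st.
have st' m n : s m <= t n.
  apply: (@le_trans _ _ (s (maxn m n))).
    have : {homo s : m n / (m <= n)%N >-> m <= n} by apply: homo_leq => //; exact: le_trans.
    by apply; exact: leq_maxl.
  apply: le_trans (st _) _.
  have : {homo t : m n / (m <= n)%N >-> n <= m}.
    by apply: homo_leq => // ? ? ? h1 h2; exact: le_trans h2 h1.
  by apply; exact: leq_maxr.
exists (sup (range s)) => n; apply/andP; split.
  by apply: ub_le_sup; [exists (t 0%N) => _ [m _ <-] | exists n].
by apply: ge_sup; [exists (s 0%N), 0%N | move=> _ [m _ <-]].
Qed.

(** The nested intervals are centred at the terms, with the geometric tails as
    radii. *)
Lemma geometric_cauchy (s : nat -> R) (M q : R) : 0 <= q < 1 ->
  (forall n, `|s n.+1 - s n| <= M * q ^+ n) ->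
  exists l, forall n, `|s n - l| <= M * q ^+ n / (1 - q).
Proof.
move=> /andP[q0 q1] hs; have q10 : 0 < 1 - q by lra.
have step n : M * q ^+ n / (1 - q) = M * q ^+ n + M * q ^+ n.+1 / (1 - q).
  by rewrite exprS; field; rewrite gt_eqF.
have M0 n : 0 <= M * q ^+ n / (1 - q).
  by rewrite divr_ge0 ?(ltW q10) //; exact: le_trans (hs n).
have [||| l hl] := @nested_point (fun n => s n - M * q ^+ n / (1 - q))
    (fun n => s n + M * q ^+ n / (1 - q)).
- by move=> n; have := hs n; rewrite ler_norml (step n); lra.
- by move=> n; have := hs n; rewrite ler_norml (step n); lra.
- by move=> n; have := M0 n; lra.
- by exists l => n; have := hl n; rewrite ler_norml; lra.
Qed.

Lemma geometric_cauchy_complex (s : nat -> R[i]) (M q : R) : 0 <= q < 1 ->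
  (forall n, modulus (s n.+1 - s n) <= M * q ^+ n) ->
  exists l, forall n, modulus (s n - l) <= 2 * (M * q ^+ n / (1 - q)).
Proof.
move=> q01 hs.
have [n|x hx] := @geometric_cauchy (fun n => complex.Re (s n)) M q q01.
  by rewrite -ReB; exact: le_trans (Re_le_modulus _) (hs n).
have [n|y hy] := @geometric_cauchy (fun n => complex.Im (s n)) M q q01.
  by rewrite -ImB; exact: le_trans (Im_le_modulus _) (hs n).
exists (x +i* y) => n; apply: le_trans (modulus_le_ReIm _) _.
by rewrite ReB ImB /=; have := hx n; have := hy n; lra.
Qed.

End Geometric.

(** * Integrals over boundaries of rectangles *)

Section Rectangles.
Context {R : realType}.
Implicit Types (f g h : R[i] -> R[i]) (a b c d x y r : R) (z w : R[i]).

Definition hor_integral f y a b := path_integral a b (fun x => f (x +i* y)).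
Definition ver_integral f x c d := path_integral c d (fun y => 'i * f (x +i* y)).

(** Counterclockwise; the factor ['i] of [dw] on vertical sides is part of
    [ver_integral]. *)
Definition rect_integral f a b c d :=
  hor_integral f c a b + ver_integral f b c d - hor_integral f d a b - ver_integral f a c d.

Definition in_rect a b c d z :=
  (a <= complex.Re z <= b) && (c <= complex.Im z <= d).

Definition frame a b c d z := in_rect a b c d z /\
  [\/ complex.Re z = a, complex.Re z = b, complex.Im z = c | complex.Im z = d].

Definition continuous_frame f a b c d :=
  forall z, frame a b c d z -> continuous_pt f z.

Lemma continuous_hpath f y a b :
  (forall x, a <= x <= b -> continuous_pt f (x +i* y)) ->
  continuous_path a b (fun x => f (x +i* y)).
Proof.
move=> cf; apply: continuous_pathP => x /cf cfx e /cfx[d d0 hd].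
exists d => // x' xd; apply: hd; rewrite (_ : _ - _ = (x' - x)%:C) ?modulus_real //.
by by_parts.
Qed.

Lemma continuous_vpath f x c d :
  (forall y, c <= y <= d -> continuous_pt f (x +i* y)) ->
  continuous_path c d (fun y => 'i * f (x +i* y)).
Proof.
move=> cf; apply: continuous_pathP => y /cf cfy e /cfy[r r0 hr].
exists r => // y' yr; rewrite -mulrBr modulusiM; apply: hr.
rewrite (_ : _ - _ = 'i * (y' - y)%:C) ?modulusiM ?modulus_real //.
by by_parts.
Qed.

Lemma hor_integral_bound f y a b (B : R) : a <= b ->
  (forall x, a <= x <= b -> continuous_pt f (x +i* y)) ->
  (forall x, a <= x <= b -> modulus (f (x +i* y)) <= B) ->
  modulus (hor_integral f y a b) <= 2 * B * (b - a).
Proof. by move=> ab /continuous_hpath cf; exact: path_integral_bound. Qed.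

Lemma ver_integral_bound f x c d (B : R) : c <= d ->
  (forall y, c <= y <= d -> continuous_pt f (x +i* y)) ->
  (forall y, c <= y <= d -> modulus (f (x +i* y)) <= B) ->
  modulus (ver_integral f x c d) <= 2 * B * (d - c).
Proof.
move=> cd /continuous_vpath cf fB; apply: path_integral_bound => // y yc.
by rewrite modulusiM fB.
Qed.

Lemma hor_integralD f g y a b :
  (forall x, a <= x <= b -> continuous_pt f (x +i* y)) ->
  (forall x, a <= x <= b -> continuous_pt g (x +i* y)) ->
  hor_integral (fun w => f w + g w) y a b = hor_integral f y a b + hor_integral g y a b.
Proof.
by move=> /continuous_hpath cf /continuous_hpath cg; rewrite /hor_integral path_integralD.
Qed.

Lemma ver_integralD f g x c d :
  (forall y, c <= y <= d -> continuous_pt f (x +i* y)) ->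
  (forall y, c <= y <= d -> continuous_pt g (x +i* y)) ->
  ver_integral (fun w => f w + g w) x c d = ver_integral f x c d + ver_integral g x c d.
Proof.
move=> /continuous_vpath cf /continuous_vpath cg; rewrite /ver_integral -path_integralD //.
by congr path_integral; apply/funext => t; rewrite mulrDr.
Qed.

Lemma hor_integralZ l f y a b :
  (forall x, a <= x <= b -> continuous_pt f (x +i* y)) ->
  hor_integral (fun w => l * f w) y a b = l * hor_integral f y a b.
Proof. by move=> /continuous_hpath cf; rewrite /hor_integral path_integralZ. Qed.

Lemma ver_integralZ l f x c d :
  (forall y, c <= y <= d -> continuous_pt f (x +i* y)) ->
  ver_integral (fun w => l * f w) x c d = l * ver_integral f x c d.
Proof.
move=> /continuous_vpath cf; rewrite /ver_integral -path_integralZ //.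
by congr path_integral; apply/funext => t; rewrite mulrCA.
Qed.

Lemma eq_hor_integral f g y a b : (forall x, a <= x <= b -> f (x +i* y) = g (x +i* y)) ->
  hor_integral f y a b = hor_integral g y a b.
Proof. exact: eq_path_integral. Qed.

Lemma eq_ver_integral f g x c d : (forall y, c <= y <= d -> f (x +i* y) = g (x +i* y)) ->
  ver_integral f x c d = ver_integral g x c d.
Proof. by move=> e; apply: eq_path_integral => y /e ->. Qed.

Lemma hor_integral_cat f y a b c : a <= b -> b <= c ->
  (forall x, a <= x <= c -> continuous_pt f (x +i* y)) ->
  hor_integral f y a c = hor_integral f y a b + hor_integral f y b c.
Proof. by move=> ab bc /continuous_hpath; exact: path_integral_cat. Qed.

Lemma ver_integral_cat f x a b c : a <= b -> b <= c ->
  (forall y, a <= y <= c -> continuous_pt f (x +i* y)) ->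
  ver_integral f x a c = ver_integral f x a b + ver_integral f x b c.
Proof. by move=> ab bc /continuous_vpath; exact: path_integral_cat. Qed.

Lemma hor_integral_primitive F f y a b : a <= b ->
  (forall x, a <= x <= b -> cderiv F (x +i* y) (f (x +i* y))) ->
  (forall x, a <= x <= b -> continuous_pt f (x +i* y)) ->
  hor_integral f y a b = F (b +i* y) - F (a +i* y).
Proof.
move=> ab dF /continuous_hpath cf.
have lin x : x +i* y = 0 +i* y + x%:C * 1.
  by by_parts.
rewrite /hor_integral [LHS](@eq_path_integral _ _ _ _
  (fun x => 1 * f (0 +i* y + x%:C * 1))); last by move=> x _; rewrite mul1r -lin.
rewrite (path_integral_primitive (F := F)) ?modulus1 //; first by rewrite -!lin.
  by move=> x /dF; rewrite -lin.
by under [X in continuous_path _ _ X]eq_fun do rewrite mul1r -lin.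
Qed.

Lemma ver_integral_primitive F f x c d : c <= d ->
  (forall y, c <= y <= d -> cderiv F (x +i* y) (f (x +i* y))) ->
  (forall y, c <= y <= d -> continuous_pt f (x +i* y)) ->
  ver_integral f x c d = F (x +i* d) - F (x +i* c).
Proof.
move=> cd dF /continuous_vpath cf.
have lin y : x +i* y = x +i* 0 + y%:C * 'i.
  by by_parts.
rewrite /ver_integral [LHS](@eq_path_integral _ _ _ _
  (fun y => 'i * f (x +i* 0 + y%:C * 'i))); last by move=> y _; rewrite -lin.
rewrite (path_integral_primitive (F := F)) ?modulus_i //; first by rewrite -!lin.
  by move=> y /dF; rewrite -lin.
by under [X in continuous_path _ _ X]eq_fun do rewrite -lin.
Qed.

Section Frame.
Context a b c d (ab : a <= b) (cd : c <= d).

Lemma frame_side f : continuous_frame f a b c d ->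
  [/\ forall x, a <= x <= b -> continuous_pt f (x +i* c),
      forall x, a <= x <= b -> continuous_pt f (x +i* d),
      forall y, c <= y <= d -> continuous_pt f (a +i* y) &
      forall y, c <= y <= d -> continuous_pt f (b +i* y)].
Proof.
move=> cf; split=> t tt; apply: cf; split; rewrite /in_rect /= ?tt ?lexx ?ab ?cd //.
- exact: Or43.
- exact: Or44.
- exact: Or41.
- exact: Or42.
Qed.

Lemma rect_integralD f g :
  continuous_frame f a b c d -> continuous_frame g a b c d ->
  rect_integral (fun w => f w + g w) a b c d =
  rect_integral f a b c d + rect_integral g a b c d.
Proof.
move=> /frame_side[f1 f2 f3 f4] /frame_side[g1 g2 g3 g4].
by rewrite /rect_integral !hor_integralD // !ver_integralD //; ring.
Qed.

Lemma rect_integralZ l f : continuous_frame f a b c d ->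
  rect_integral (fun w => l * f w) a b c d = l * rect_integral f a b c d.
Proof.
move=> /frame_side[f1 f2 f3 f4].
by rewrite /rect_integral !hor_integralZ // !ver_integralZ //; ring.
Qed.

Lemma eq_rect_integral f g : (forall z, frame a b c d z -> f z = g z) ->
  rect_integral f a b c d = rect_integral g a b c d.
Proof.
move=> e; rewrite /rect_integral; congr (_ + _ - _ - _);
  [apply: eq_hor_integral|apply: eq_ver_integral
  |apply: eq_hor_integral|apply: eq_ver_integral] => t tt;
  apply: e; split; rewrite /in_rect /= ?tt ?lexx ?ab ?cd //.
- exact: Or43.
- exact: Or42.
- exact: Or44.
- exact: Or41.
Qed.

Lemma rect_integral_bound f (B : R) : continuous_frame f a b c d ->
  (forall z, frame a b c d z -> modulus (f z) <= B) ->
  modulus (rect_integral f a b c d) <= 4 * B * ((b - a) + (d - c)).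
Proof.
move=> /frame_side[f1 f2 f3 f4] fB; rewrite /rect_integral.
have fr z : frame a b c d z -> modulus (f z) <= B by exact: fB.
have h1 : modulus (hor_integral f c a b) <= 2 * B * (b - a).
  apply: hor_integral_bound => // x xab; apply: fB; split; last exact: Or43.
  by rewrite /in_rect /= xab lexx cd.
have h2 : modulus (hor_integral f d a b) <= 2 * B * (b - a).
  apply: hor_integral_bound => // x xab; apply: fB; split; last exact: Or44.
  by rewrite /in_rect /= xab lexx cd.
have h3 : modulus (ver_integral f a c d) <= 2 * B * (d - c).
  apply: ver_integral_bound => // y yab; apply: fB; split; last exact: Or41.
  by rewrite /in_rect /= yab lexx ab.
have h4 : modulus (ver_integral f b c d) <= 2 * B * (d - c).
  apply: ver_integral_bound => // y yab; apply: fB; split; last exact: Or42.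
  by rewrite /in_rect /= yab lexx ab.
have := modulus_le_sub (hor_integral f c a b + ver_integral f b c d - hor_integral f d a b)
  (ver_integral f a c d).
have := modulus_le_sub (hor_integral f c a b + ver_integral f b c d) (hor_integral f d a b).
have := modulus_le_add (hor_integral f c a b) (ver_integral f b c d).
by clear -h1 h2 h3 h4; lra.
Qed.

Lemma continuous_frame_bounded f : continuous_frame f a b c d ->
  exists2 B : R, 0 < B & forall z, frame a b c d z -> modulus (f z) <= B.
Proof.
move=> /frame_side[/continuous_hpath f1 /continuous_hpath f2
  /continuous_vpath f3 /continuous_vpath f4].
have [B1 B10 h1] := continuous_path_bounded ab f1.
have [B2 B20 h2] := continuous_path_bounded ab f2.
have [B3 B30 h3] := continuous_path_bounded cd f3.
have [B4 B40 h4] := continuous_path_bounded cd f4.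
exists (B1 + B2 + B3 + B4); first by rewrite !addr_gt0.
move=> [x y] [/andP[/= xab ycd]] [] e.
- have := h3 y ycd; rewrite modulusiM -e; lra.
- have := h4 y ycd; rewrite modulusiM -e; lra.
- have := h1 x xab; rewrite -e; lra.
- have := h2 x xab; rewrite -e; lra.
Qed.

Lemma rect_integral_primitive F f :
  (forall z, frame a b c d z -> cderiv F z (f z)) -> continuous_frame f a b c d ->
  rect_integral f a b c d = 0.
Proof.
move=> dF /frame_side[f1 f2 f3 f4]; rewrite /rect_integral.
rewrite !(hor_integral_primitive (F := F)) // ?(ver_integral_primitive (F := F)) //; first ring.
- move=> t tt; apply: dF; split; last exact: Or41.
  by rewrite /in_rect /= tt ?lexx ?ab ?cd.
- move=> t tt; apply: dF; split; last exact: Or42.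
  by rewrite /in_rect /= tt ?lexx ?ab ?cd.
- move=> t tt; apply: dF; split; last exact: Or44.
  by rewrite /in_rect /= tt ?lexx ?ab ?cd.
- move=> t tt; apply: dF; split; last exact: Or43.
  by rewrite /in_rect /= tt ?lexx ?ab ?cd.
Qed.

End Frame.

Lemma rect_integral_cutx f a b c d m : a <= m <= b ->
  (forall x, a <= x <= b -> continuous_pt f (x +i* c)) ->
  (forall x, a <= x <= b -> continuous_pt f (x +i* d)) ->
  rect_integral f a b c d = rect_integral f a m c d + rect_integral f m b c d.
Proof.
move=> /andP[am mb] fc fd; rewrite /rect_integral.
by rewrite (hor_integral_cat am mb fc) (hor_integral_cat am mb fd); ring.
Qed.

Lemma rect_integral_cuty f a b c d m : c <= m <= d ->
  (forall y, c <= y <= d -> continuous_pt f (a +i* y)) ->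
  (forall y, c <= y <= d -> continuous_pt f (b +i* y)) ->
  rect_integral f a b c d = rect_integral f a b c m + rect_integral f a b m d.
Proof.
move=> /andP[cm md] fa fb; rewrite /rect_integral.
by rewrite (ver_integral_cat cm md fa) (ver_integral_cat cm md fb); ring.
Qed.

End Rectangles.

(** * Goursat's theorem *)

Section Goursat.
Context {R : realType}.
Implicit Types (f g h : R[i] -> R[i]) (a b c d x y r : R) (z w : R[i]).

Lemma in_rect_sub a b c d a' b' c' d' z : a <= a' -> b' <= b -> c <= c' -> d' <= d ->
  in_rect a' b' c' d' z -> in_rect a b c d z.
Proof.
move=> h1 h2 h3 h4 /andP[/andP[h5 h6] /andP[h7 h8]]; rewrite /in_rect.
by rewrite (le_trans h1 h5) (le_trans h6 h2) (le_trans h3 h7) (le_trans h8 h4).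
Qed.

Lemma modulus_half_or z w :
  modulus (z + w) <= 2 * modulus z \/ modulus (z + w) <= 2 * modulus w.
Proof.
have := modulus_le_add z w; have [h|h] := leP (modulus z) (modulus w) => H.
  by right; lra.
by left; lra.
Qed.

(* one of the four quarters carries at least a quarter of the integral *)
Let quarter f (q q' : R * R * R * R) :=
  let: (a, b, c, d) := q in let: (a', b', c', d') := q' in
  [/\ [/\ a <= a', b' <= b, c <= c' & d' <= d],
      b' - a' = (b - a) / 2, d' - c' = (d - c) / 2 &
      modulus (rect_integral f a b c d) <= 4 * modulus (rect_integral f a' b' c' d')].

Let quarter_exists f a b c d : a <= b -> c <= d ->
  (forall z, in_rect a b c d z -> continuous_pt f z) ->
  exists q', quarter f (a, b, c, d) q'.
Proof.
move=> ab cd cf.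
have am : a <= (a + b) / 2 by lra.
have mb : (a + b) / 2 <= b by lra.
have cm : c <= (c + d) / 2 by lra.
have md : (c + d) / 2 <= d by lra.
have four (u v t : R) : u <= 2 * v -> v <= 2 * t -> u <= 4 * t by lra.
have hx a' b' : a <= a' -> a' <= b' -> b' <= b ->
    exists c' d', [/\ c <= c', d' <= d, d' - c' = (d - c) / 2 &
    modulus (rect_integral f a' b' c d) <= 2 * modulus (rect_integral f a' b' c' d')].
  move=> aa ab' bb; rewrite (@rect_integral_cuty _ f a' b' c d ((c + d) / 2)) ?cm //.
  - case: (modulus_half_or (rect_integral f a' b' c ((c + d) / 2))
      (rect_integral f a' b' ((c + d) / 2) d)) => h.
      by exists c, ((c + d) / 2); split=> //; lra.
    by exists ((c + d) / 2), d; split=> //; lra.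
  - move=> y yc; apply: cf; rewrite /in_rect /= yc andbT; lra.
  - move=> y yc; apply: cf; rewrite /in_rect /= yc andbT; lra.
rewrite /quarter (@rect_integral_cutx _ f a b c d ((a + b) / 2)) ?am //; last 2 first.
- by move=> x xc; apply: cf; rewrite /in_rect /= xc lexx.
- by move=> x xc; apply: cf; rewrite /in_rect /= xc lexx cd.
case: (modulus_half_or (rect_integral f a ((a + b) / 2) c d)
      (rect_integral f ((a + b) / 2) b c d)) => h.
  have [c' [d' [h1 h2 h3 h4]]] := hx _ _ (lexx a) am mb.
  exists (a, (a + b) / 2, c', d').
  by split; [split | clear -h2; lra | exact: h3 | exact: four h h4].
have [c' [d' [h1 h2 h3 h4]]] := hx _ _ am mb (lexx b).
exists ((a + b) / 2, b, c', d').
by split; [split | clear -h2; lra | exact: h3 | exact: four h h4].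
Qed.

(** Goursat's argument: quartering keeps at least a quarter of the integral, so
    the integral over the [n]-th rectangle is at least [4 ^- n] times the first
    one. Near the common point [z0] of the rectangles, [f] differs from an affine
    function, whose integral vanishes, by [o(2 ^- n)], and the perimeter is
    [O(2 ^- n)]. *)
Lemma goursat f a b c d : a <= b -> c <= d ->
  (forall z, in_rect a b c d z -> holomorphic_at f z) ->
  rect_integral f a b c d = 0.
Proof.
move=> ab cd df.
have cf z : in_rect a b c d z -> continuous_pt f z.
  by move=> /df; exact: holomorphic_continuous.
pose ok (q : R * R * R * R) := let: (a', b', c', d') := q in
  [/\ a <= a' <= b', b' <= b, c <= c' <= d' & d' <= d].
have /choice[next nextP] : forall q, exists q', ok q -> quarter f q q'.
  move=> [[[a' b'] c'] d']; have [|nok] := pselect (ok (a', b', c', d')); last first.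
    by exists (a, b, c, d).
  move=> [/andP[aa ab'] bb /andP[cc cd'] dd].
  have [|q' qq] := @quarter_exists f a' b' c' d' ab' cd'; last by exists q'.
  by move=> z /(in_rect_sub aa bb cc dd); exact: cf.
pose q n := iter n next (a, b, c, d).
have okq n : ok (q n).
  elim: n => [|n]; first by rewrite /q /= !lexx ab cd.
  rewrite {2}/q iterS -/(q n) => okn; move: (nextP _ okn) (okn).
  case: (q n) => [[[a1 b1] c1] d1]; case: (next _) => [[[a2 b2] c2] d2].
  rewrite /quarter /ok => -[[h1 h2 h3 h4] h5 h6 _] [/andP[h7 h8] h9 /andP[h10 h11] h12].
  by split; rewrite ?(le_trans _ h1) ?(le_trans h2) ?(le_trans _ h3) ?(le_trans h4)
    ?andTb //; rewrite -subr_ge0 ?h5 ?h6 divr_ge0 // subr_ge0.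
have stepq n : quarter f (q n) (q n.+1) by exact: nextP.
have [x0 hx0] : exists x, forall n, (q n).1.1.1 <= x <= (q n).1.1.2.
  apply: nested_point => // n.
  - by move: (stepq n); case: (q n) (q n.+1) => [[[? ?] ?] ?] [[[? ?] ?] ?] [[]].
  - by move: (stepq n); case: (q n) (q n.+1) => [[[? ?] ?] ?] [[[? ?] ?] ?] [[]].
  - by move: (okq n); case: (q n) => [[[? ?] ?] ?] [/andP[]].
have [y0 hy0] : exists y, forall n, (q n).1.2 <= y <= (q n).2.
  apply: nested_point => // n.
  - by move: (stepq n); case: (q n) (q n.+1) => [[[? ?] ?] ?] [[[? ?] ?] ?] [[]].
  - by move: (stepq n); case: (q n) (q n.+1) => [[[? ?] ?] ?] [[[? ?] ?] ?] [[]].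
  - by move: (okq n); case: (q n) => [[[? ?] ?] ?] [_ _ /andP[]].
pose L := (b - a) + (d - c).
have L0 : 0 <= L by rewrite /L; lra.
have sizeq n : (q n).1.1.2 - (q n).1.1.1 + ((q n).2 - (q n).1.2) = L * 2^-1 ^+ n.
  elim: n => [|n]; first by rewrite /= expr0 mulr1.
  rewrite exprSr mulrA; move: (stepq n).
  case: (q n) (q n.+1) => [[[? ?] ?] ?] [[[? ?] ?] ?] /= [_ -> -> _] <-.
  by rewrite -mulrDl.
have intq n : modulus (rect_integral f a b c d) <= 4 ^+ n *
    modulus (rect_integral f (q n).1.1.1 (q n).1.1.2 (q n).1.2 (q n).2).
  elim: n => [|n IH]; first by rewrite expr0 mul1r.
  apply: le_trans IH _; rewrite exprSr -mulrA ler_wpM2l ?exprn_ge0 //.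
  move: (stepq n).
  by case: (q n) (q n.+1) => [[[? ?] ?] ?] [[[? ?] ?] ?] /= [_ _ _].
pose z0 := x0 +i* y0.
have [l [phi [cphi _ fE]]] : holomorphic_at f z0.
  by apply: df; rewrite /in_rect /=; have := hx0 0%N; have := hy0 0%N => /= -> ->.
apply: modulus_le0 => e e0.
have e'0 : 0 < e / (4 * (L ^+ 2 + 1)).
  by rewrite divr_gt0 // mulr_gt0 // ltr_wpDl // exprn_ge0.
have [r r0 hr] := cphi _ e'0.
have half01 : 0 <= (2^-1 : R) < 1 by rewrite invr_ge0 ler0n invf_lt1 // ltr1n.
have [n hn] := geometric_small L half01 r0.
move: (intq n) (okq n) (hx0 n) (hy0 n) (sizeq n).
case: (q n) => [[[a1 b1] c1] d1] /= hI [/andP[h1 h2] h3 /andP[h4 h5] h6] hx hy hs.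
have inr z : in_rect a1 b1 c1 d1 z -> modulus (z - z0) <= L * 2^-1 ^+ n.
  move=> /andP[hx' hy']; apply: le_trans (modulus_le_ReIm _) _.
  by rewrite -hs ReB ImB /=; apply: lerD; rewrite ler_norml; clear -hx hy hx' hy'; lra.
(* the affine approximation of f at z0, with an explicit primitive *)
pose A w := f z0 + phi z0 * (w - z0).
have dA w : cderiv (fun w => f z0 * w + phi z0 * (w - z0) ^+ 2 / 2) w (A w).
  exists (fun t => f z0 + phi z0 * ((t - z0) + (w - z0)) / 2); split.
  - apply: continuous_ptD; first exact: continuous_pt_cst.
    apply: continuous_ptM; last exact: continuous_pt_cst.
    apply: continuous_ptM; first exact: continuous_pt_cst.
    apply: continuous_ptD; last exact: continuous_pt_cst.
    apply: continuous_ptB; [exact: continuous_pt_id | exact: continuous_pt_cst].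
  - by rewrite /A; field.
  - by move=> t; field.
have cA w : continuous_pt A w.
  apply: continuous_ptD; first exact: continuous_pt_cst.
  apply: continuous_ptM; first exact: continuous_pt_cst.
  apply: continuous_ptB; [exact: continuous_pt_id | exact: continuous_pt_cst].
have cB : continuous_frame (fun w => f w - A w) a1 b1 c1 d1.
  move=> z [/(in_rect_sub h1 h3 h4 h6) hz _]; apply: continuous_ptB => //; exact: cf.
apply: le_trans hI _.
have -> : rect_integral f a1 b1 c1 d1 =
    rect_integral (fun w => f w - A w) a1 b1 c1 d1.
  rewrite -[RHS]addr0 -(rect_integral_primitive h2 h5 (fun w _ => dA w)) //.
  rewrite -rect_integralD //.
  by apply: eq_rect_integral => // z _; rewrite subrK.
apply: (@le_trans _ _ (4 ^+ n * (4 * (e / (4 * (L ^+ 2 + 1)) * (L * 2^-1 ^+ n)) *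
   ((b1 - a1) + (d1 - c1))))).
  rewrite ler_wpM2l ?exprn_ge0 // rect_integral_bound // => z [hz _].
  rewrite /A (fE z) opprD addrACA subrr add0r -mulrBl modulusM.
  apply: ler_pM; rewrite ?modulus_ge0 //; last exact: inr.
  by apply/ltW/hr; apply: le_lt_trans (inr z hz) hn.
rewrite hs.
have -> : 4 ^+ n * (4 * (e / (4 * (L ^+ 2 + 1)) * (L * 2^-1 ^+ n)) * (L * 2^-1 ^+ n))
   = e * (L ^+ 2 / (L ^+ 2 + 1)).
  have -> : (4 : R) ^+ n = 2 ^+ n * 2 ^+ n by rewrite -exprMn; congr (_ ^+ n); ring.
  have n20 : (2 : R) ^+ n != 0 by rewrite expf_neq0.
  rewrite exprVn; field; rewrite n20 /=.
  by rewrite gt_eqF // ltr_wpDl // exprn_ge0.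
rewrite ger_pMr // ler_pdivrMr ?mul1r ?lerDl //.
by rewrite ltr_wpDl // exprn_ge0.
Qed.

End Goursat.

(** * Residues and Cauchy's formula *)

Section CauchyFormula.
Context {R : realType}.
Implicit Types (f g h psi : R[i] -> R[i]) (a b c d x y r e : R) (z w : R[i]).

Definition twopii : R[i] := 0 +i* (2 * pi).

Lemma twopii_neq0 : twopii != 0.
Proof.
by rewrite /twopii eq_complex /= eqxx /= mulf_eq0 pnatr_eq0 /= gt_eqF // pi_gt0.
Qed.

Lemma modulus_twopii_ge1 : 1 <= modulus twopii.
Proof.
apply: le_trans (Im_le_modulus _); rewrite /= ger0_norm ?mulr_ge0 ?pi_ge0 //.
by have := pi_ge2 R; lra.
Qed.

(** Opposite sides of a centred square together contribute [i * pi] to the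
    integral of [1 / w], through the primitive [2 atan (x / e)]. *)
Let atan_integral (x0 e : R) : 0 < e ->
  path_integral (x0 - e) (x0 + e)
    (fun x => 0 +i* (2 * e / (e ^+ 2 + (x - x0) ^+ 2))) = 0 +i* pi.
Proof.
move=> e0; rewrite /path_integral; congr (_ +i* _).
  transitivity (\int[@lebesgue_measure R]_(x in `[x0 - e, x0 + e]) (0 : R)) => //.
  by rewrite Rintegral_cst // mul0r.
have den0 x : e ^+ 2 + (x - x0) ^+ 2 != 0.
  by rewrite gt_eqF // ltr_pwDl ?exprn_gt0 // sqr_ge0.
transitivity (2 * atan ((x0 + e - x0) / e) - 2 * atan ((x0 - e - x0) / e)); last first.
  have -> : x0 + e - x0 = e by ring.
  have -> : x0 - e - x0 = - e by ring.
  by rewrite mulNr divff ?gt_eqF // atanN atan1; field.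
apply: (Rintegral_primitive (G := fun x => 2 * atan ((x - x0) / e))).
- by lra.
- apply: continuous_in_subspaceT => x _.
  apply: (@continuousM _ R^o (fun=> 2 * e) (fun x => (e ^+ 2 + (x - x0) ^+ 2)^-1)).
    exact: cst_continuous.
  apply: (@continuousV _ R^o (fun x => e ^+ 2 + (x - x0) ^+ 2)); first exact: den0.
  apply: (@continuousD R R^o R^o (fun=> e ^+ 2) (fun x => (x - x0) ^+ 2)).
    exact: cst_continuous.
  have cx : {for x, continuous (fun x : R => x - x0)}.
    apply: (@continuousB R R^o R^o id (fun=> x0)); first exact: cvg_id.
    exact: cst_continuous.
  exact: (continuousM cx cx).
- move=> x _.
  have -> : 2 * e / (e ^+ 2 + (x - x0) ^+ 2) =
      2 * ((1 + ((x - x0) / e) ^+ 2)^-1 * e^-1).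
    by field; rewrite den0 gt_eqF.
  have d1 : is_derive x 1 (fun x => (x - x0) / e) e^-1.
    apply/is_derive1_caratheodory; exists (fun=> e^-1); split=> //.
      by move=> t; field; rewrite gt_eqF.
    exact: cst_continuous.
  have d2 := @is_derive1_comp _ atan (fun x => (x - x0) / e) x _ _
    (is_derive1_atan _) d1.
  exact: (is_deriveZ 2 d2).
Qed.

Lemma square_sub_neq0 (x0 y0 e : R) z : 0 < e ->
  frame (x0 - e) (x0 + e) (y0 - e) (y0 + e) z -> e <= modulus (z - (x0 +i* y0)).
Proof.
move=> e0 [_ [] h].
- apply: le_trans (Re_le_modulus _); rewrite ReB h /= addrAC subrr add0r normrN.
  exact: ler_norm.
- apply: le_trans (Re_le_modulus _); rewrite ReB h /= addrAC subrr add0r.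
  exact: ler_norm.
- apply: le_trans (Im_le_modulus _); rewrite ImB h /= addrAC subrr add0r normrN.
  exact: ler_norm.
- apply: le_trans (Im_le_modulus _); rewrite ImB h /= addrAC subrr add0r.
  exact: ler_norm.
Qed.

Lemma holomorphic_cauchy_kernel z0 z : z != z0 ->
  holomorphic_at (fun w => (w - z0)^-1) z.
Proof.
by move=> zz; apply: holomorphicV; [exact: holomorphic_sub_cst | rewrite subr_eq0].
Qed.

Lemma frame_neq (x0 y0 e : R) z : 0 < e ->
  frame (x0 - e) (x0 + e) (y0 - e) (y0 + e) z -> z != x0 +i* y0.
Proof.
move=> e0 /(square_sub_neq0 e0) h; rewrite -subr_eq0 -modulus_gt0.
exact: lt_le_trans h.
Qed.

Lemma rect_integral_inv (x0 y0 e : R) : 0 < e ->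
  rect_integral (fun w => (w - (x0 +i* y0))^-1) (x0 - e) (x0 + e) (y0 - e) (y0 + e)
  = twopii.
Proof.
move=> e0; set k := fun w => _.
have xe : x0 - e <= x0 + e by lra.
have ye : y0 - e <= y0 + e by lra.
have ck : continuous_frame k (x0 - e) (x0 + e) (y0 - e) (y0 + e).
  move=> z hz; apply: holomorphic_continuous; apply: holomorphic_cauchy_kernel.
  exact: frame_neq hz.
have [k1 k2 k3 k4] := frame_side xe ye ck.
have {}k1 := continuous_hpath k1; have {}k2 := continuous_hpath k2.
have {}k3 := continuous_vpath k3; have {}k4 := continuous_vpath k4.
have -> : rect_integral k (x0 - e) (x0 + e) (y0 - e) (y0 + e) =
   (hor_integral k (y0 - e) (x0 - e) (x0 + e) - hor_integral k (y0 + e) (x0 - e) (x0 + e)) +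
   (ver_integral k (x0 + e) (y0 - e) (y0 + e) - ver_integral k (x0 - e) (y0 - e) (y0 + e)).
  by rewrite /rect_integral; ring.
rewrite /hor_integral /ver_integral -!path_integralB //.
have den0 t : e ^+ 2 + t ^+ 2 != 0.
  by rewrite gt_eqF // ltr_pwDl ?exprn_gt0 // sqr_ge0.
have -> : path_integral (x0 - e) (x0 + e)
    (fun x => k (x +i* (y0 - e)) - k (x +i* (y0 + e))) = 0 +i* pi.
  rewrite -(atan_integral x0 e0); apply: eq_path_integral => x _.
  apply/eqP; rewrite /k eq_complex /=.
  have -> : y0 - e - y0 = - e by ring.
  have -> : y0 + e - y0 = e by ring.
  have := den0 (x - x0); rewrite addrC sqrrN; set D := _ + _ => D0.
  by apply/andP; split; apply/eqP; field.
have -> : path_integral (y0 - e) (y0 + e)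
    (fun y => 'i * k ((x0 + e) +i* y) - 'i * k ((x0 - e) +i* y)) = 0 +i* pi.
  rewrite -(atan_integral y0 e0); apply: eq_path_integral => x _.
  apply/eqP; rewrite /k eq_complex /=.
  have -> : x0 - e - x0 = - e by ring.
  have -> : x0 + e - x0 = e by ring.
  have := den0 (x - y0); rewrite sqrrN; set D := _ + _ => D0.
  by apply/andP; split; apply/eqP; field.
by rewrite /twopii; by_parts.
Qed.

(** Cutting off the four strips around the small square loses nothing, by
    Goursat's theorem. *)
Lemma rect_integral_shrink h a b c d (x0 y0 e : R) : 0 < e ->
  a <= x0 - e -> x0 + e <= b -> c <= y0 - e -> y0 + e <= d ->
  (forall z, in_rect a b c d z -> z != x0 +i* y0 -> holomorphic_at h z) ->
  rect_integral h a b c d =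
  rect_integral h (x0 - e) (x0 + e) (y0 - e) (y0 + e).
Proof.
move=> e0 ha hb hc hd dh.
have ch z : in_rect a b c d z -> z != x0 +i* y0 -> continuous_pt h z.
  by move=> hz zz; apply: holomorphic_continuous; exact: dh.
have neqx x y : x != x0 -> x +i* y != x0 +i* y0.
  by apply: contraNneq => -[->].
have neqy x y : y != y0 -> x +i* y != x0 +i* y0.
  by apply: contraNneq => -[_ ->].
have gx z : complex.Re z != x0 -> z != x0 +i* y0 by apply: contraNneq => ->.
have gy z : complex.Im z != y0 -> z != x0 +i* y0 by apply: contraNneq => ->.
rewrite (@rect_integral_cutx _ h a b c d (x0 - e)); last 3 first.
- by lra.
- move=> x hx; apply: ch; last by apply: neqy; lra.
  by rewrite /in_rect /= hx; lra.
- move=> x hx; apply: ch; last by apply: neqy; lra.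
  by rewrite /in_rect /= hx; lra.
rewrite (@goursat _ h a (x0 - e) c d) ?add0r //; last 2 first.
- by lra.
- move=> z /andP[h1 h2]; apply: dh; last by apply: gx; lra.
  by rewrite /in_rect h2; lra.
rewrite (@rect_integral_cutx _ h (x0 - e) b c d (x0 + e)); last 3 first.
- by lra.
- move=> x hx; apply: ch; last by apply: neqy; lra.
  by rewrite /in_rect /=; lra.
- move=> x hx; apply: ch; last by apply: neqy; lra.
  by rewrite /in_rect /=; lra.
rewrite (@goursat _ h (x0 + e) b c d) ?addr0 //; last 2 first.
- by lra.
- move=> z /andP[h1 h2]; apply: dh; last by apply: gx; lra.
  by rewrite /in_rect h2; lra.
rewrite (@rect_integral_cuty _ h (x0 - e) (x0 + e) c d (y0 - e)); last 3 first.
- by lra.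
- move=> y hy; apply: ch; last by apply: neqx; lra.
  by rewrite /in_rect /= hy; lra.
- move=> y hy; apply: ch; last by apply: neqx; lra.
  by rewrite /in_rect /= hy; lra.
rewrite (@goursat _ h (x0 - e) (x0 + e) c (y0 - e)) ?add0r //; last 2 first.
- by lra.
- move=> z /andP[h1 h2]; apply: dh; last by apply: gy; lra.
  by rewrite /in_rect; lra.
rewrite (@rect_integral_cuty _ h (x0 - e) (x0 + e) (y0 - e) d (y0 + e)); last 3 first.
- by lra.
- move=> y hy; apply: ch; last by apply: neqx; lra.
  by rewrite /in_rect /=; lra.
- move=> y hy; apply: ch; last by apply: neqx; lra.
  by rewrite /in_rect /=; lra.
rewrite (@goursat _ h (x0 - e) (x0 + e) (y0 + e) d) ?addr0 //; first by lra.
move=> z /andP[h1 h2]; apply: dh; last by apply: gy; lra.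
by rewrite /in_rect; lra.
Qed.

(** After shrinking to the square of half-side [e] around [z0], [h] differs from
    [psi z0 / (w - z0)] by [o(1 / e)] on a contour of length [8 e].
    Here [psi] is the continuous extension of [h z * (z - z0)] to [z0]. *)
Lemma residue_formula h psi a b c d z0 :
  a < complex.Re z0 < b -> c < complex.Im z0 < d ->
  (forall z, in_rect a b c d z -> z != z0 -> holomorphic_at h z) ->
  continuous_pt psi z0 ->
  (forall z, in_rect a b c d z -> z != z0 -> h z * (z - z0) = psi z) ->
  rect_integral h a b c d = twopii * psi z0.
Proof.
case: z0 => x0 y0 /= /andP[ax xb] /andP[cy yd] dh cpsi hpsi.
apply/eqP; rewrite -subr_eq0; apply/eqP; apply: modulus_le0 => eta eta0.
have eta'0 : 0 < eta / 16 by lra.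
have [r r0 hr] := cpsi _ eta'0.
pose e := Num.min (r / 3) (Num.min (Num.min (x0 - a) (b - x0)) (Num.min (y0 - c) (d - y0))).
have e0 : 0 < e by rewrite /e !lt_min !subr_gt0 ax xb cy yd divr_gt0.
have [[er ea eb] ec ed] : [/\ [/\ e <= r / 3, e <= x0 - a & e <= b - x0],
    e <= y0 - c & e <= d - y0].
  have : e <= e by []. 
  by rewrite {2}/e !le_min => /andP[-> /andP[/andP[-> ->] /andP[-> ->]]].
rewrite (@rect_integral_shrink h a b c d x0 y0 e) //; try by clear -ea eb ec ed; lra.
have xe : x0 - e <= x0 + e by lra.
have ye : y0 - e <= y0 + e by lra.
have sub z : in_rect (x0 - e) (x0 + e) (y0 - e) (y0 + e) z -> in_rect a b c d z.
  by apply: in_rect_sub; clear -ea eb ec ed; lra.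
have ck : continuous_frame (fun w => (w - (x0 +i* y0))^-1)
    (x0 - e) (x0 + e) (y0 - e) (y0 + e).
  move=> z hz; apply: holomorphic_continuous; apply: holomorphic_cauchy_kernel.
  exact: frame_neq hz.
have ch : continuous_frame h (x0 - e) (x0 + e) (y0 - e) (y0 + e).
  move=> z hz; apply: holomorphic_continuous; apply: dh; last exact: frame_neq hz.
  by apply: sub; case: hz.
have ck' : continuous_frame (fun w => - psi (x0 +i* y0) * (w - (x0 +i* y0))^-1)
    (x0 - e) (x0 + e) (y0 - e) (y0 + e).
  by move=> z /ck; apply: continuous_ptM; exact: continuous_pt_cst.
rewrite (mulrC twopii) -mulNr -(rect_integral_inv x0 y0 e0).
rewrite -(rect_integralZ xe ye) // -(rect_integralD xe ye) //.
apply: (@le_trans _ _ (4 * (eta / 16 / e) * ((x0 + e - (x0 - e)) + (y0 + e - (y0 - e))))).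
  apply: rect_integral_bound => //.
    by move=> z hz; apply: continuous_ptD; [exact: ch | exact: ck'].
  move=> z hz; have zz := frame_neq e0 hz; have ze := square_sub_neq0 e0 hz.
  have z0 : z - (x0 +i* y0) != 0 by rewrite subr_eq0.
  have -> : h z + - psi (x0 +i* y0) * (z - (x0 +i* y0))^-1 =
     (psi z - psi (x0 +i* y0)) / (z - (x0 +i* y0)).
    by rewrite -(hpsi z) ?mulrBl ?mulfK ?mulNr //; apply: sub; case: hz.
  rewrite modulusM modulusV; apply: ler_pM; rewrite ?invr_ge0 ?modulus_ge0 //.
    apply/ltW/hr; apply: le_lt_trans (modulus_le_ReIm _) _.
    case: hz => /andP[hx hy] _; rewrite ReB ImB /=.
    apply: (@le_lt_trans _ _ (e + e)); last by lra.
    by apply: lerD; rewrite ler_norml; clear -hx hy; lra.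
  by rewrite lef_pV2 // posrE ?modulus_gt0.
rewrite (_ : _ * _ = eta) //; field; rewrite gt_eqF //.
Qed.

Lemma cauchy_formula f a b c d z0 :
  a < complex.Re z0 < b -> c < complex.Im z0 < d ->
  (forall z, in_rect a b c d z -> holomorphic_at f z) ->
  rect_integral (fun w => f w * (w - z0)^-1) a b c d = twopii * f z0.
Proof.
move=> hx hy df; apply: residue_formula => //.
- move=> z hz zz; apply: holomorphicM; first exact: df.
  exact: holomorphic_cauchy_kernel.
- apply: holomorphic_continuous; apply: df; rewrite /in_rect; lra.
- by move=> z _ zz; rewrite divfK // subr_eq0.
Qed.

End CauchyFormula.

(** * Cauchy estimates and zeros *)

Section CauchyEstimates.
Context {R : realType}.
Implicit Types (f g h : R[i] -> R[i]) (a b c d x y r e B : R) (z w : R[i]).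

Definition in_square z0 r z :=
  (`|complex.Re (z - z0)| <= r) && (`|complex.Im (z - z0)| <= r).

Definition square_frame z0 r z :=
  frame (complex.Re z0 - r) (complex.Re z0 + r) (complex.Im z0 - r) (complex.Im z0 + r) z.

Definition square_integral f z0 r :=
  rect_integral f (complex.Re z0 - r) (complex.Re z0 + r)
    (complex.Im z0 - r) (complex.Im z0 + r).

Lemma in_squareE z0 r z : in_square z0 r z =
  in_rect (complex.Re z0 - r) (complex.Re z0 + r)
    (complex.Im z0 - r) (complex.Im z0 + r) z.
Proof. by rewrite /in_square /in_rect ReB ImB !ler_distl. Qed.

Lemma modulus_in_square z0 r z : modulus (z - z0) <= r -> in_square z0 r z.
Proof.
move=> h; rewrite /in_square (le_trans (Re_le_modulus _) h).
by rewrite (le_trans (Im_le_modulus _) h).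
Qed.

Lemma in_square_le z0 r r' z : r <= r' -> in_square z0 r z -> in_square z0 r' z.
Proof.
by move=> rr /andP[h1 h2]; rewrite /in_square (le_trans h1 rr) (le_trans h2 rr).
Qed.

Lemma square_frame_in z0 r z : square_frame z0 r z -> in_square z0 r z.
Proof. by rewrite in_squareE => -[]. Qed.

Lemma square_frame_dist z0 r s z w : 0 <= s -> s < r -> in_square z0 s z ->
  square_frame z0 r w -> r - s <= modulus (w - z).
Proof.
move=> s0 sr; rewrite in_squareE => /andP[/andP[h1 h2] /andP[h3 h4]] [_ [] h].
- by apply: le_trans (Re_le_modulus _); rewrite ReB h ler_normr; lra.
- by apply: le_trans (Re_le_modulus _); rewrite ReB h ler_normr; lra.
- by apply: le_trans (Im_le_modulus _); rewrite ImB h ler_normr; lra.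
- by apply: le_trans (Im_le_modulus _); rewrite ImB h ler_normr; lra.
Qed.

Lemma square_integral_bound f z0 r B : 0 <= r ->
  (forall z, square_frame z0 r z -> continuous_pt f z) ->
  (forall z, square_frame z0 r z -> modulus (f z) <= B) ->
  modulus (square_integral f z0 r) <= 16 * B * r.
Proof.
move=> r0 cf fB; by apply: le_trans (rect_integral_bound _ _ cf fB) _; lra.
Qed.

Lemma square_cauchy_formula f z0 r z : 0 < r -> in_square z0 (r / 2) z ->
  (forall z, in_square z0 r z -> holomorphic_at f z) ->
  square_integral (fun w => f w * (w - z)^-1) z0 r = twopii * f z.
Proof.
move=> r0; rewrite in_squareE => /andP[/andP[h1 h2] /andP[h3 h4]] df.
by apply: cauchy_formula; [lra | lra | move=> w; rewrite -in_squareE; exact: df].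
Qed.

Lemma square_frame_neq z0 r z w : 0 < r -> in_square z0 (r / 2) z ->
  square_frame z0 r w -> w != z.
Proof.
move=> r0 hz hw; rewrite -subr_eq0 -modulus_gt0.
apply: lt_le_trans (square_frame_dist _ _ hz hw); lra.
Qed.

Lemma continuous_kernel_frame f z0 r z w : 0 < r -> in_square z0 (r / 2) z ->
  (forall z, in_square z0 r z -> holomorphic_at f z) ->
  square_frame z0 r w -> continuous_pt (fun w => f w * (w - z)^-1) w.
Proof.
move=> r0 hz df hw; apply: holomorphic_continuous; apply: holomorphicM.
  by apply: df; exact: square_frame_in.
by apply: holomorphic_cauchy_kernel; exact: square_frame_neq hw.
Qed.

Lemma cauchy_kernel_bound z0 r z w : 0 < r -> in_square z0 (r / 2) z ->
  square_frame z0 r w -> modulus (w - z)^-1 <= 2 / r.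
Proof.
move=> r0 hz hw; have := square_frame_dist (ltW _) _ hz hw.
rewrite modulusV => h; rewrite -[leRHS]invrK lef_pV2 ?posrE ?invr_gt0 ?divr_gt0 //.
  by rewrite invfM invrK; apply: le_trans (h _ _); lra.
by rewrite modulus_gt0 subr_eq0; exact: square_frame_neq hw.
Qed.

(** Second divided differences are Cauchy integrals, hence bounded by the
    supremum on a larger square. *)
Lemma divided_difference_bound f z0 r B z1 z2 z3 : 0 < r ->
  (forall z, in_square z0 r z -> holomorphic_at f z) ->
  (forall z, square_frame z0 r z -> modulus (f z) <= B) ->
  in_square z0 (r / 2) z1 -> in_square z0 (r / 2) z2 -> in_square z0 (r / 2) z3 ->
  z1 != z2 -> z3 != z2 ->
  modulus ((z1 - z2)^-1 * (f z1 - f z2) - (z3 - z2)^-1 * (f z3 - f z2)) <=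
  128 * B / r ^+ 2 * modulus (z1 - z3).
Proof.
move=> r0 df fB i1 i2 i3 n12 n32.
pose k z w := f w * (w - z)^-1.
have ck z : in_square z0 (r / 2) z ->
    forall w, square_frame z0 r w -> continuous_pt (k z) w.
  by move=> hz w; exact: continuous_kernel_frame.
have cZ z l : in_square z0 (r / 2) z ->
    forall w, square_frame z0 r w -> continuous_pt (fun w => l * k z w) w.
  by move=> hz w hw; apply: continuous_ptM; [exact: continuous_pt_cst | exact: ck].
have xe : complex.Re z0 - r <= complex.Re z0 + r by lra.
have ye : complex.Im z0 - r <= complex.Im z0 + r by lra.
pose A := (z1 - z2)^-1; pose D := (z3 - z2)^-1.
set dd := _ - _.
have ddE : twopii * dd =
    square_integral (fun w => A * k z1 w + ((D - A) * k z2 w + (- D) * k z3 w)) z0 r.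
  rewrite /square_integral !rect_integralD //.
  - rewrite !rect_integralZ //; try by move=> w; exact: ck.
    rewrite -/(square_integral _ _ _) -/(square_integral _ _ _).
    rewrite -/(square_integral _ _ _) !square_cauchy_formula // /dd -/A -/D; ring.
  - by move=> w; exact: cZ.
  - by move=> w; exact: cZ.
  - by move=> w; exact: cZ.
  - by move=> w hw; apply: continuous_ptD; exact: cZ.
have : modulus dd <= modulus (twopii * dd).
  by rewrite modulusM ler_peMl ?modulus_ge0 // modulus_twopii_ge1.
move/le_trans; apply; rewrite ddE.
have -> : 128 * B / r ^+ 2 * modulus (z1 - z3) =
    16 * (B * ((2 / r) * (2 / r) * (2 / r)) * modulus (z1 - z3)) * r.
  by field; rewrite gt_eqF.
apply: square_integral_bound; first exact: ltW.
  move=> w hw; apply: continuous_ptD; first exact: cZ.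
  by apply: continuous_ptD; exact: cZ.
move=> w hw.
have m1 := square_frame_neq r0 i1 hw; have m2 := square_frame_neq r0 i2 hw.
have m3 := square_frame_neq r0 i3 hw.
have -> : A * k z1 w + ((D - A) * k z2 w + (- D) * k z3 w) =
   f w * ((w - z1)^-1 * (w - z2)^-1 * (w - z3)^-1) * (z1 - z3).
  by rewrite /k /A /D; field; rewrite !subr_eq0 m1 m2 m3 n12 n32.
rewrite modulusM ler_wpM2r ?modulus_ge0 // modulusM.
apply: ler_pM; rewrite ?modulus_ge0 ?fB // !modulusM.
have [b1 b2 b3] := And3 (cauchy_kernel_bound r0 i1 hw) (cauchy_kernel_bound r0 i2 hw)
  (cauchy_kernel_bound r0 i3 hw).
by rewrite !ler_pM ?mulr_ge0 ?modulus_ge0.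
Qed.

Lemma difference_bound f z0 r B z1 z2 : 0 < r ->
  (forall z, in_square z0 r z -> holomorphic_at f z) ->
  (forall z, square_frame z0 r z -> modulus (f z) <= B) ->
  in_square z0 (r / 2) z1 -> in_square z0 (r / 2) z2 ->
  modulus (f z1 - f z2) <= 64 * B / r * modulus (z1 - z2).
Proof.
move=> r0 df fB i1 i2.
pose k z w := f w * (w - z)^-1.
have ck z : in_square z0 (r / 2) z ->
    forall w, square_frame z0 r w -> continuous_pt (k z) w.
  by move=> hz w; exact: continuous_kernel_frame.
have cZ z l : in_square z0 (r / 2) z ->
    forall w, square_frame z0 r w -> continuous_pt (fun w => l * k z w) w.
  by move=> hz w hw; apply: continuous_ptM; [exact: continuous_pt_cst | exact: ck].
have xe : complex.Re z0 - r <= complex.Re z0 + r by lra.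
have ye : complex.Im z0 - r <= complex.Im z0 + r by lra.
set dd := _ - _.
have ddE : twopii * dd = square_integral (fun w => k z1 w + -1 * k z2 w) z0 r.
  rewrite /square_integral !rect_integralD //.
  - rewrite rect_integralZ //; last by move=> w; exact: ck.
    rewrite -/(square_integral _ _ _) -/(square_integral _ _ _).
    by rewrite !square_cauchy_formula // /dd; ring.
  - by move=> w; exact: ck.
  - by move=> w; exact: cZ.
have : modulus dd <= modulus (twopii * dd).
  by rewrite modulusM ler_peMl ?modulus_ge0 // modulus_twopii_ge1.
move/le_trans; apply; rewrite ddE.
have -> : 64 * B / r * modulus (z1 - z2) =
    16 * (B * ((2 / r) * (2 / r)) * modulus (z1 - z2)) * r.
  by field; rewrite gt_eqF.
apply: square_integral_bound; first exact: ltW.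
  by move=> w hw; apply: continuous_ptD; [exact: ck | exact: cZ].
move=> w hw.
have m1 := square_frame_neq r0 i1 hw; have m2 := square_frame_neq r0 i2 hw.
have -> : k z1 w + -1 * k z2 w =
   f w * ((w - z1)^-1 * (w - z2)^-1) * (z1 - z2).
  by rewrite /k; field; rewrite !subr_eq0 m1 m2.
rewrite modulusM ler_wpM2r ?modulus_ge0 // modulusM.
apply: ler_pM; rewrite ?modulus_ge0 ?fB // !modulusM.
have [b1 b2] := conj (cauchy_kernel_bound r0 i1 hw) (cauchy_kernel_bound r0 i2 hw).
by rewrite !ler_pM ?mulr_ge0 ?modulus_ge0.
Qed.

Lemma square_frame_bounded f z0 r : 0 <= r ->
  (forall z, in_square z0 r z -> holomorphic_at f z) ->
  exists2 B : R, 0 < B & forall z, square_frame z0 r z -> modulus (f z) <= B.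
Proof.
move=> r0 df; apply: continuous_frame_bounded; try lra.
by move=> z /square_frame_in /df; exact: holomorphic_continuous.
Qed.

(** If [f] vanishes near the centre, so do all quotients [f w / (w - z0) ^ m],
    and Cauchy's formula for these forces [f z] to be as small as
    [(|z - z0| / r) ^ m]. *)
Lemma zero_near_center f z0 r e : 0 < r -> 0 < e ->
  (forall z, in_square z0 r z -> holomorphic_at f z) ->
  (forall z, modulus (z - z0) < e -> f z = 0) ->
  forall z, modulus (z - z0) <= r / 2 -> f z = 0.
Proof.
move=> r0 e0 df f0 z hz; have i1 := modulus_in_square hz.
have [->|zz] := eqVneq z z0; first by rewrite f0 // subrr modulus0.
have zz0 : z - z0 != 0 by rewrite subr_eq0.
have [B B0 fB] := square_frame_bounded (ltW r0) df.
have dh m w : in_square z0 r w ->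
    holomorphic_at (fun w => f w / (w - z0) ^+ m) w.
  move=> hw; have [->|wz] := eqVneq w z0.
    apply: holomorphic_near e0 _ (holomorphic_cst 0 z0) => t te.
    by rewrite (f0 _ te) mul0r.
  apply: holomorphicM; first exact: df.
  apply: holomorphicV; last by rewrite expf_neq0 // subr_eq0.
  by apply: holomorphicX; exact: holomorphic_sub_cst.
have bnd m : modulus (f z) <= 32 * B * 2^-1 ^+ m.
  have fh w : square_frame z0 r w -> modulus (f w / (w - z0) ^+ m) <= B * r^-1 ^+ m.
    move=> hw; rewrite modulusM ler_pM ?modulus_ge0 ?fB //.
    rewrite modulusV modulusX -exprVn; apply: lerXn2r; rewrite ?nnegrE ?invr_ge0 ?modulus_ge0 //.
      exact: ltW.
    have c0 : in_square z0 0 z0 by apply: modulus_in_square; rewrite subrr modulus0.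
    have := square_frame_dist (lexx 0) r0 c0 hw; rewrite subr0 => h.
    by rewrite lef_pV2 // posrE; exact: lt_le_trans h.
  have : modulus (f z / (z - z0) ^+ m) <= 32 * B * r^-1 ^+ m.
    set v := f z / _.
    have : modulus v <= modulus (twopii * v).
      by rewrite modulusM ler_peMl ?modulus_ge0 // modulus_twopii_ge1.
    move/le_trans; apply; rewrite -(square_cauchy_formula r0 i1 (dh m)).
    have -> : 32 * B * r^-1 ^+ m = 16 * (B * r^-1 ^+ m * (2 / r)) * r.
      by field; rewrite gt_eqF.
    apply: square_integral_bound; first exact: ltW.
      by move=> w hw; apply: continuous_kernel_frame hw => // t; exact: dh.
    move=> w hw; rewrite modulusM ler_pM ?modulus_ge0 //; first exact: fh.
    exact: cauchy_kernel_bound i1 hw.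
  rewrite modulusM modulusV modulusX ler_pdivrMr ?exprn_gt0 ?modulus_gt0 //.
  move/le_trans; apply; rewrite -[leLHS]mulrA.
  apply: ler_wpM2l; first by rewrite mulr_ge0 // ltW.
  rewrite -exprMn; apply: lerXn2r; rewrite ?nnegrE ?mulr_ge0 ?invr_ge0 ?modulus_ge0 //.
    exact: ltW.
  by rewrite mulrC ler_pdivrMr // mulrC.
apply: modulus_le0 => eta eta0.
have half01 : 0 <= (2^-1 : R) < 1 by rewrite invr_ge0 ler0n invf_lt1 // ltr1n.
have [n hn] := geometric_small (32 * B) half01 eta0.
exact: le_trans (bnd n) (ltW hn).
Qed.

End CauchyEstimates.

(** * The complex exponential *)

Section ComplexExponential.
Context {R : realType}.
Implicit Types (z w : R[i]).

Definition cexp z : R[i] :=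
  (expR (complex.Re z) * cos (complex.Im z)) +i*
  (expR (complex.Re z) * sin (complex.Im z)).

Lemma cexp0 : cexp 0 = 1.
Proof. by rewrite /cexp /= expR0 cos0 sin0 mulr1 mulr0. Qed.

Lemma cexpD z w : cexp (z + w) = cexp z * cexp w.
Proof.
rewrite /cexp ReD ImD expRD cosD sinD; by_parts.
Qed.

Lemma modulus_cexp z : modulus (cexp z) = expR (complex.Re z).
Proof.
rewrite /modulus normc_def /= !exprMn -mulrDr cos2Dsin2 mulr1 sqrtr_sqr.
by rewrite ger0_norm // expR_ge0.
Qed.

Lemma cexp_natmul n z : cexp (n%:R * z) = cexp z ^+ n.
Proof.
elim: n => [|n IH]; first by rewrite mul0r cexp0 expr0.
by rewrite -natr1 mulrDl mul1r cexpD IH exprSr.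
Qed.

Let expansion_at0 (g : R -> R) (l : R) : is_derive (0 : R) 1 g l ->
  forall e : R, 0 < e -> exists2 d : R, 0 < d &
  forall x, `|x| < d -> `|g x - g 0 - x * l| <= e * `|x|.
Proof.
move=> /is_derive1_caratheodory[p [gE cp <-]] e e0.
have /cvgrPdist_lt/(_ _ e0)/nbhs_ballP[d /= d0 hd] := cp.
exists d => // x xd; rewrite gE subr0 -(mulrC (p 0)) -mulrBl normrM ler_wpM2r //.
by rewrite distrC ltW // hd // /ball /= sub0r normrN.
Qed.

(** The first-order expansions of [expR], [cos] and [sin] at 0 combine to one of
    [cexp]. *)
Let cexp_expansion_at0 (e : R) : 0 < e -> exists2 d : R, 0 < d &
  forall z, modulus z < d -> modulus (cexp z - 1 - z) <= e * modulus z.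
Proof.
move=> e0; pose t := Num.min 1 (e / 6).
have t0 : 0 < t by rewrite /t lt_min ltr01 divr_gt0.
have t1 : t <= 1 by rewrite /t ge_min lexx.
have te : 6 * t <= e.
  by rewrite mulrC -ler_pdivlMr // /t ge_min lexx orbT.
have [d1 d10 h1] := expansion_at0 (is_derive_expR 0) t0.
have [d2 d20 h2] := expansion_at0 (is_derive_cos 0) t0.
have [d3 d30 h3] := expansion_at0 (is_derive_sin 0) t0.
pose d := Num.min (Num.min d1 d2) (Num.min d3 (t / 2)).
exists d; first by rewrite !lt_min d10 d20 d30 divr_gt0.
move=> [x y] zd; set z := x +i* y in zd *.
have xz : `|x| <= modulus z := Re_le_modulus z.
have yz : `|y| <= modulus z := Im_le_modulus z.
move: zd; rewrite /d !lt_min => /andP[/andP[zd1 zd2] /andP[zd3 zd4]].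
have {}h1 := h1 x (le_lt_trans xz zd1).
have {}h2 := h2 y (le_lt_trans yz zd2).
have {}h3 := h3 y (le_lt_trans yz zd3).
rewrite expR0 mulr1 in h1; rewrite sin0 oppr0 mulr0 subr0 cos0 in h2.
rewrite sin0 subr0 cos0 mulr1 in h3.
have Ex : `|expR x - 1| <= t.
  have -> : expR x - 1 = (expR x - 1 - x) + x by ring.
  apply: le_trans (ler_normD _ _) _.
  have : t * `|x| <= `|x| by rewrite ler_piMl.
  by lra.
have Ex2 : `|expR x| <= 2.
  have -> : expR x = (expR x - 1) + 1 by ring.
  by apply: le_trans (ler_normD _ _) _; rewrite normr1; lra.
apply: le_trans (modulus_le_ReIm _) _.
have -> : complex.Re (cexp z - 1 - z) = (expR x - 1 - x) + expR x * (cos y - 1).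
  by rewrite /cexp /=; ring.
have -> : complex.Im (cexp z - 1 - z) = expR x * (sin y - y) + (expR x - 1) * y.
  by rewrite /cexp /=; ring.
have k1 : `|expR x * (cos y - 1)| <= 2 * (t * `|y|) by rewrite normrM ler_pM.
have k2 : `|expR x * (sin y - y)| <= 2 * (t * `|y|) by rewrite normrM ler_pM.
have k3 : `|(expR x - 1) * y| <= t * `|y| by rewrite normrM ler_wpM2r.
have k4 := ler_normD (expR x - 1 - x) (expR x * (cos y - 1)).
have k5 := ler_normD (expR x * (sin y - y)) ((expR x - 1) * y).
have k6 : t * `|x| <= t * modulus z by rewrite ler_wpM2l // ltW.
have k7 : t * `|y| <= t * modulus z by rewrite ler_wpM2l // ltW.
have k8 : 6 * t * modulus z <= e * modulus z by rewrite ler_wpM2r // modulus_ge0.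
by clear -h1 k1 k2 k3 k4 k5 k6 k7 k8; lra.
Qed.

Lemma cderiv_cexp z : cderiv cexp z (cexp z).
Proof.
exists (fun w => if w == z then cexp z else (cexp w - cexp z) / (w - z)); split.
- move=> e e0; rewrite eqxx.
  have c0 : 0 < modulus (cexp z) by rewrite modulus_cexp expR_gt0.
  have e'0 : 0 < e / 2 / modulus (cexp z) by rewrite !divr_gt0.
  have [d d0 hd] := cexp_expansion_at0 e'0.
  exists d => // w wd; case: eqVneq => [_|wz]; first by rewrite subrr modulus0.
  have wz0 : w - z != 0 by rewrite subr_eq0.
  have -> : (cexp w - cexp z) / (w - z) - cexp z =
      cexp z * (cexp (w - z) - 1 - (w - z)) / (w - z).
    have -> : cexp w = cexp (w - z) * cexp z by rewrite -cexpD subrK.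
    by field.
  rewrite !modulusM modulusV ltr_pdivrMr ?modulus_gt0 //.
  apply: le_lt_trans (_ : e / 2 * modulus (w - z) < _).
    rewrite mulrC -ler_pdivlMr //; apply: le_trans (hd _ wd) _.
    by rewrite mulrAC.
  by rewrite ltr_pM2r ?modulus_gt0 // ltr_pdivrMr // ltr_pMr // ltr1n.
- by rewrite eqxx.
- move=> w; case: eqVneq => [->|wz]; first by rewrite subrr mulr0 addr0.
  by rewrite divfK ?subr_eq0 // subrKC.
Qed.

Lemma cderiv_cexp_scale l z : cderiv (fun w => cexp (l * w)) z (l * cexp (l * z)).
Proof.
rewrite mulrC; apply: (cderiv_comp (g := fun w => l * w) (f := cexp)); last first.
  exact: cderiv_cexp.
have := cderivM (cderiv_cst l z) (cderiv_id z).
by rewrite mul0r add0r mulr1.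
Qed.

Lemma holomorphic_cexp_scale l z : holomorphic_at (fun w => cexp (l * w)) z.
Proof. by eexists; exact: cderiv_cexp_scale. Qed.

Lemma holomorphic_cexp_sub t z : holomorphic_at (fun w => cexp (w - t)) z.
Proof.
have [l [p [cp pz pE]]] : holomorphic_at (fun w => w - t) z.
  exact: holomorphic_sub_cst.
by eexists; apply: cderiv_comp; [exists p; split | exact: cderiv_cexp].
Qed.

Lemma holomorphic_cexp_sub_l t z : holomorphic_at (fun w => cexp (t - w)) z.
Proof.
have [l [p [cp pz pE]]] : holomorphic_at (fun w => t - w) z.
  exact: holomorphic_cst_sub.
by eexists; apply: cderiv_comp; [exists p; split | exact: cderiv_cexp].
Qed.

Lemma sin_ge_of_ge (d y : R) : 0 < d -> d <= `|y| <= 1 -> sin d <= `|sin y|.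
Proof.
move=> d0 /andP[dy y1]; have := pihalf_ge1 R => p1.
have sy : sin `|y| <= `|sin y|.
  by case: (ger0P y) => _; rewrite ?sinN ?ler_norm // -normrN ler_norm.
apply: le_trans sy; move: dy; rewrite le_eqVlt => /predU1P[->//|dy].
by rewrite ltW // ltr_sin // in_itv /=; lra.
Qed.

Lemma one_sub_cexp_lower_Im z (d : R) : 0 < d -> d <= `|complex.Im z| <= 1 ->
  expR (complex.Re z) * sin d <= modulus (1 - cexp z).
Proof.
move=> d0 /(sin_ge_of_ge d0) hs; apply: le_trans (Im_le_modulus _).
rewrite /cexp /= sub0r normrN normrM ger0_norm ?expR_ge0 //.
by rewrite ler_wpM2l ?expR_ge0.
Qed.

Lemma one_sub_cexp_lower_Re z (d : R) : d <= complex.Re z ->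
  d <= modulus (1 - cexp z).
Proof.
move=> h; rewrite modulus_distC; apply: le_trans (modulus_sub_ge _ _).
rewrite modulus_cexp modulus1; have := expR_ge1Dx (complex.Re z); lra.
Qed.

(** The strip [|Im z| <= 1] stays away from the other zeros [2 pi i k]. *)
Lemma one_sub_cexp_neq0 z : `|complex.Im z| <= 1 -> z != 0 -> 1 - cexp z != 0.
Proof.
move=> z1 z0; rewrite -modulus_gt0; have [y0|y0] := eqVneq (complex.Im z) 0.
  apply: lt_le_trans (Re_le_modulus _); rewrite /cexp y0 /= cos0 mulr1.
  rewrite normr_gt0 subr_eq0 eq_sym -expR0 (inj_eq (@expR_inj R)).
  by apply: contraNneq z0 => x0; rewrite (complexE z) x0 y0 mulr0 addr0.
have yp : 0 < `|complex.Im z| by rewrite normr_gt0.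
apply: lt_le_trans (one_sub_cexp_lower_Im yp _); last by rewrite lexx z1.
rewrite mulr_gt0 ?expR_gt0 // sin_gt0_pi // yp /=.
by apply: le_lt_trans z1 _; have := pi_ge2 R; lra.
Qed.

End ComplexExponential.

(** * Integrals around the half-line *)

Section UIntegral.
Context {R : realType}.
Implicit Types (f g : R[i] -> R[i]) (l a : R) (z w : R[i]).

(** The contour runs from [a - i/2] left to [l - i/2], up to [l + i/2] and right
    to [a + i/2]: for [l < 0] it surrounds the part [[0, a]] of the half-line and
    is open at its right end. The half-height 1/2 keeps differences of two points
    of the strip in [|Im z| <= 1], where [1 - cexp z] has its only zero at 0. *)
Definition u_integral f l a : R[i] :=
  - hor_integral f (- 2^-1) l a + ver_integral f l (- 2^-1) 2^-1 + hor_integral f 2^-1 l a.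

Definition u_path l a z : Prop :=
  (complex.Re z = l /\ - 2^-1 <= complex.Im z <= 2^-1) \/
  ((complex.Im z = - 2^-1 \/ complex.Im z = 2^-1) /\ l <= complex.Re z <= a).

Let half_le : - 2^-1 <= 2^-1 :> R.
Proof. by lra. Qed.

Lemma u_path_sides (P : R[i] -> Prop) l a :
  (forall z, u_path l a z -> P z) ->
  [/\ forall x, l <= x <= a -> P (x +i* (- 2^-1)),
      forall y, - 2^-1 <= y <= 2^-1 -> P (l +i* y) &
      forall x, l <= x <= a -> P (x +i* 2^-1)].
Proof.
move=> h; split=> t tt; apply: h; [right | left | right] => //; split => //.
- by left.
- by right.
Qed.

Section Fixed.
Context l a (la : l <= a).
Local Notation cont f := (forall z, u_path l a z -> continuous_pt f z).

Lemma u_integralD f g : cont f -> cont g ->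
  u_integral (fun w => f w + g w) l a = u_integral f l a + u_integral g l a.
Proof.
move=> /u_path_sides[f1 f2 f3] /u_path_sides[g1 g2 g3].
by rewrite /u_integral !hor_integralD // ver_integralD //; ring.
Qed.

Lemma u_integralZ m f : cont f ->
  u_integral (fun w => m * f w) l a = m * u_integral f l a.
Proof.
move=> /u_path_sides[f1 f2 f3].
by rewrite /u_integral !hor_integralZ // ver_integralZ //; ring.
Qed.

Lemma eq_u_integral f g : (forall z, u_path l a z -> f z = g z) ->
  u_integral f l a = u_integral g l a.
Proof.
move=> /u_path_sides[h1 h2 h3]; rewrite /u_integral.
by rewrite (eq_hor_integral h1) (eq_ver_integral h2) (eq_hor_integral h3).
Qed.

Lemma u_integral_sum (n : nat) (F : nat -> R[i] -> R[i]) : (forall i, cont (F i)) ->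
  u_integral (fun w => \sum_(i < n) F i w) l a = \sum_(i < n) u_integral (F i) l a.
Proof.
move=> cF; elim: n => [|n IH].
  rewrite big_ord0 -[RHS](mul0r (u_integral (fun=> 0) l a)) -u_integralZ.
    by apply: eq_u_integral => z _; rewrite big_ord0 mul0r.
  by move=> z _; exact: continuous_pt_cst.
have cs : cont (fun w => \sum_(i < n) F i w).
  by move=> z hz; apply: continuous_pt_sum => i; exact: cF.
rewrite big_ord_recr /= -IH -(u_integralD cs (cF n)).
by apply: eq_u_integral => z _; rewrite big_ord_recr.
Qed.

Lemma u_integral_bound f (B : R) : cont f ->
  (forall z, u_path l a z -> modulus (f z) <= B) ->
  modulus (u_integral f l a) <= 2 * B * (2 * (a - l) + 1).
Proof.
move=> /u_path_sides[f1 f2 f3] /u_path_sides[h1 h2 h3]; rewrite /u_integral.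
have k1 := hor_integral_bound la f1 h1.
have k2 := ver_integral_bound half_le f2 h2.
have k3 := hor_integral_bound la f3 h3.
have := modulus_le_add (- hor_integral f (- 2^-1) l a + ver_integral f l (- 2^-1) 2^-1)
  (hor_integral f 2^-1 l a).
have := modulus_le_add (- hor_integral f (- 2^-1) l a) (ver_integral f l (- 2^-1) 2^-1).
by rewrite modulusN; clear -k1 k2 k3; lra.
Qed.

Lemma u_integral_primitive F f :
  (forall z, u_path l a z -> cderiv F z (f z)) -> cont f ->
  u_integral f l a = F (a +i* 2^-1) - F (a +i* (- 2^-1)).
Proof.
move=> /u_path_sides[h1 h2 h3] /u_path_sides[f1 f2 f3]; rewrite /u_integral.
rewrite (hor_integral_primitive la h1 f1) (hor_integral_primitive la h3 f3).
rewrite (ver_integral_primitive half_le h2 f2); ring.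
Qed.

(** The contour and the far side [Re w = a] bound a rectangle. *)
Lemma u_integral_entire f :
  (forall z, in_rect l a (- 2^-1) 2^-1 z -> holomorphic_at f z) ->
  u_integral f l a = ver_integral f a (- 2^-1) 2^-1.
Proof.
move=> /(goursat la half_le); rewrite /rect_integral /u_integral => h.
apply/eqP; rewrite -subr_eq0 -oppr_eq0 -h; apply/eqP; ring.
Qed.

Lemma continuous_u_bounded f : cont f ->
  exists2 B : R, 0 < B & forall z, u_path l a z -> modulus (f z) <= B.
Proof.
move=> /u_path_sides[/continuous_hpath f1 /continuous_vpath f2 /continuous_hpath f3].
have [B1 B10 h1] := continuous_path_bounded la f1.
have [B2 B20 h2] := continuous_path_bounded half_le f2.
have [B3 B30 h3] := continuous_path_bounded la f3.
exists (B1 + B2 + B3); first by rewrite !addr_gt0.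
move=> [x y] /= [[/= -> /h2]|[[]/= -> ]].
- by rewrite modulusiM; lra.
- by move=> /h1; lra.
- by move=> /h3; lra.
Qed.

End Fixed.

(** The horizontal sides between [l'] and [l] complete the difference of the two
    left sides to a rectangle. *)
Lemma u_integral_sub f l' l a : l' <= l <= a ->
  (forall z, u_path l' a z -> continuous_pt f z) ->
  u_integral f l a - u_integral f l' a = rect_integral f l' l (- 2^-1) 2^-1.
Proof.
move=> /andP[ll la] /u_path_sides[h1 h2 h3]; rewrite /u_integral /rect_integral.
by rewrite (hor_integral_cat ll la h1) (hor_integral_cat ll la h3); ring.
Qed.

End UIntegral.

(** * Differentiation with respect to seminorms *)

Section SeminormCalculus.
Context {R : realType}.

Section Space.
Context {X : lmodType R[i]} (p : seminorms X).

Lemma sn_distC a x y : p a (x - y) = p a (y - x).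
Proof. by rewrite -(snN a (x - y)) opprB. Qed.

Lemma sn_triangle a x y z : p a (x - z) <= p a (x - y) + p a (y - z).
Proof. by rewrite -[x - z](subrKA y) sn_ler_add. Qed.

Lemma sn_sub_ge a x y : p a x - p a y <= p a (x - y).
Proof. by rewrite lerBlDr -{1}(subrK y x) sn_ler_add. Qed.

Lemma sn_eq_small a x : (forall e : R, 0 < e -> p a x <= e) -> p a x = 0.
Proof.
move=> h; apply/eqP; rewrite eq_le sn_ge0 andbT.
by apply/ler_addgt0Pl => e e0; rewrite addr0 h.
Qed.

Definition sn_lim (s : nat -> X) (l : X) := forall a (e : R), 0 < e ->
  exists n0, forall n, (n0 <= n)%N -> p a (s n - l) <= e.

(** Geometrically small increments suffice: difference quotients are always
    evaluated along a geometric sequence of increments. *)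
Definition sn_complete := forall s : nat -> X,
  (forall a, exists C : R, forall n, p a (s n.+1 - s n) <= C * 2^-1 ^+ n) ->
  exists l, sn_lim s l.

(** Stated with seminorms only, so that it passes to [val], to [A] and to
    functionals by plain inequalities. *)
Definition sn_derivative (u : R[i] -> X) (z : R[i]) (l : X) :=
  forall a (e : R), 0 < e -> exists2 d : R, 0 < d & forall w,
  modulus (w - z) < d -> p a (u w - u z - (w - z) *: l) <= e * modulus (w - z).

Definition difference_quotient (u : R[i] -> X) z w : X := (w - z)^-1 *: (u w - u z).

(** The quotients at the increments [r / 2 ^ (n + 1)] converge; the Lipschitz
    bound then compares every other quotient with these. This is how
    differentiability is obtained everywhere below: bounds on second divided
    differences survive limits, integrals and the passage from weak to strong. *)
Lemma sn_derivative_of_lipschitz (u : R[i] -> X) z (r : R) : sn_complete -> 0 < r ->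
  (forall a, exists M : R, forall z1 z3, modulus (z1 - z) < r -> modulus (z3 - z) < r ->
     z1 != z -> z3 != z ->
     p a (difference_quotient u z z1 - difference_quotient u z z3)
       <= M * modulus (z1 - z3)) ->
  exists l, sn_derivative u z l.
Proof.
move=> cX r0 hL.
pose h n : R := r / 2 * 2^-1 ^+ n.
have h0 n : 0 < h n by rewrite /h mulr_gt0 ?divr_gt0 // exprn_gt0 // invr_gt0.
have hE n : h n = 2 * h n.+1 by rewrite /h exprS; field.
have hr n : h n < r.
  apply: (@le_lt_trans _ _ (r / 2)); last by lra.
  by rewrite /h ler_piMr ?divr_ge0 ?(ltW r0) // exprn_ile1 // ?invr_ge0 // invf_le1 // ler1n.
pose pt n : R[i] := z + (h n)%:C.
have ptz n : pt n - z = (h n)%:C by rewrite /pt addrAC subrr add0r.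
have ptn n : pt n != z.
  by rewrite -subr_eq0 ptz -modulus_gt0 modulus_real normr_gt0 gt_eqF.
have ptr n : modulus (pt n - z) = h n by rewrite ptz modulus_real gtr0_norm.
pose s n := difference_quotient u z (pt n).
have [l sl] : exists l, sn_lim s l.
  apply: cX => a; have [M hM] := hL a; exists (`|M| * r) => n.
  apply: le_trans (hM _ _ _ _ _ _) _; rewrite ?ptr //.
  have -> : modulus (pt n.+1 - pt n) = h n.+1.
    have -> : pt n.+1 - pt n = - (h n.+1)%:C.
      by rewrite /pt opprD addrACA subrr add0r (hE n) -rmorphB /= -rmorphN /=;
        congr (_%:C); ring.
    by rewrite modulusN modulus_real gtr0_norm.
  apply: (@le_trans _ _ (`|M| * h n.+1)).
    by apply: ler_wpM2r; [exact: ltW | exact: ler_norm].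
  rewrite -mulrA ler_wpM2l //; have := hE n; have := h0 n.+1; rewrite /h.
  by have := exprn_ge0 n (_ : 0 <= 2^-1 :> R); rewrite invr_ge0; lra.
exists l => a e e0; have [M hM] := hL a.
pose d := Num.min r (e / 2 / (`|M| + 1)).
have M1 : 0 < `|M| + 1 by rewrite ltr_wpDl.
have d0 : 0 < d by rewrite /d lt_min r0 !divr_gt0.
exists d => // w wd; have [->|wz] := eqVneq w z.
  by rewrite !subrr scale0r subrr sn0 modulus0 mulr0.
have wz0 : w - z != 0 by rewrite subr_eq0.
have -> : u w - u z - (w - z) *: l = (w - z) *: (difference_quotient u z w - l).
  by rewrite scalerBr /difference_quotient scalerA divff // scale1r.
rewrite sn_scale mulrC ler_wpM2r ?modulus_ge0 //.
move: wd; rewrite /d lt_min => /andP[wr wd].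
apply/ler_addgt0Pl => t t0.
have [n1 hn1] := sl a (t / 2) (divr_gt0 t0 (ltr0n _ 2)).
have t'0 : 0 < t / 2 / (`|M| + 1) by rewrite !divr_gt0.
have half01 : 0 <= (2^-1 : R) < 1 by rewrite invr_ge0 ler0n invf_lt1 // ltr1n.
have [n2 hn2] := geometric_small (r / 2) half01 t'0.
pose n := maxn n1 n2.
have hn : h n <= t / 2 / (`|M| + 1).
  apply: le_trans (ltW hn2); rewrite /h ler_wpM2l ?divr_ge0 ?(ltW r0) //.
  by apply: ler_wiXn2l; rewrite ?invr_ge0 ?invf_le1 ?ler1n // leq_maxr.
have k1 := sn_triangle a (difference_quotient u z w) (s n) l.
have k2 := hn1 n (leq_maxl _ _).
have k3 := hM w (pt n) wr (_ : modulus (pt n - z) < r) wz (ptn n).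
rewrite ptr in k3; have {}k3 := k3 (hr n).
have k4 : modulus (w - pt n) <= modulus (w - z) + h n.
  by rewrite -ptr (modulus_distC (pt n)); exact: modulus_triangle.
have k5 : M * modulus (w - pt n) <= (`|M| + 1) * (modulus (w - z) + h n).
  apply: (@le_trans _ _ ((`|M| + 1) * modulus (w - pt n))).
    by rewrite ler_wpM2r ?modulus_ge0 // ler_wpDr // ler_norm.
  by rewrite ler_wpM2l // ltW.
have k6 : (`|M| + 1) * modulus (w - z) <= e / 2.
  by rewrite mulrC -ler_pdivlMr // ltW.
have k7 : (`|M| + 1) * h n <= t / 2 by rewrite mulrC -ler_pdivlMr.
by rewrite mulrDr in k5; rewrite -/(s n) in k3; clear -t0 e0 k1 k2 k3 k4 k5 k6 k7; lra.
Qed.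

Lemma sn_derivative_near (u v : R[i] -> X) z l (r : R) : 0 < r ->
  (forall w, modulus (w - z) < r -> u w = v w) ->
  sn_derivative u z l -> sn_derivative v z l.
Proof.
move=> r0 uv du a e /(du a)[d d0 hd]; exists (Num.min d r); first by rewrite lt_min d0.
move=> w; rewrite lt_min => /andP[wd wr]; rewrite -!uv ?subrr ?modulus0 //.
exact: hd.
Qed.

Lemma sn_derivative_lipschitz (u : R[i] -> X) z l a : sn_derivative u z l ->
  exists2 d : R, 0 < d & forall w, modulus (w - z) < d ->
    p a (u w - u z) <= (1 + p a l) * modulus (w - z).
Proof.
move=> /(_ a 1 ltr01)[d d0 hd]; exists d => // w /hd h.
have -> : u w - u z = (u w - u z - (w - z) *: l) + (w - z) *: l by rewrite subrK.
apply: le_trans (sn_ler_add _ _ _) _; rewrite sn_scale mulrDl lerD //.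
by rewrite mulrC.
Qed.

(** Complex-valued, so that the boundedness of continuous functions on contours
    applies to seminorms. *)
Lemma sn_derivative_continuous (u : R[i] -> X) z l a : sn_derivative u z l ->
  continuous_pt (fun w => (p a (u w))%:C) z.
Proof.
move=> /(sn_derivative_lipschitz a)[d d0 hd] e e0.
have c0 : 0 < 1 + p a l by rewrite ltr_pwDl // sn_ge0.
exists (Num.min d (e / (1 + p a l))); first by rewrite lt_min d0 divr_gt0.
move=> w; rewrite lt_min => /andP[/hd h we].
rewrite -rmorphB modulus_real; apply: (@le_lt_trans _ _ (p a (u w - u z))).
  have := sn_sub_ge a (u w) (u z); have := sn_sub_ge a (u z) (u w).
  by rewrite (sn_distC a (u z)) ler_norml; lra.
by apply: le_lt_trans h _; rewrite mulrC -ltr_pdivlMr.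
Qed.

Lemma cderiv_functional (y : {linear X -> R[i]}) a (M : R) (u : R[i] -> X) z l :
  (forall x, modulus (y x) <= M * p a x) -> sn_derivative u z l ->
  cderiv (fun w => y (u w)) z (y l).
Proof.
move=> hy du; exists (fun w => if w == z then y l else (y (u w) - y (u z)) / (w - z)).
split; last 2 first.
- by rewrite eqxx.
- move=> w; case: eqVneq => [->|wz]; first by rewrite subrr mulr0 addr0.
  by rewrite divfK ?subr_eq0 // subrKC.
move=> e e0; rewrite eqxx.
have M1 : 0 < `|M| + 1 by rewrite ltr_wpDl.
have [d d0 hd] := du a (e / 2 / (`|M| + 1)) (divr_gt0 (divr_gt0 e0 (ltr0n _ 2)) M1).
exists d => // w /hd h; case: eqVneq => [_|wz]; first by rewrite subrr modulus0.
have wz0 : w - z != 0 by rewrite subr_eq0.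
have -> : (y (u w) - y (u z)) / (w - z) - y l =
    (w - z)^-1 * y (u w - u z - (w - z) *: l).
  rewrite !raddfB /= linearZ /=.
  transitivity ((w - z)^-1 * (y (u w) - y (u z) - (w - z) * y l)) => //.
  by field.
rewrite modulusM modulusV mulrC ltr_pdivrMr ?modulus_gt0 //.
apply: le_lt_trans (hy _) _.
apply: (@le_lt_trans _ _ ((`|M| + 1) * (e / 2 / (`|M| + 1) * modulus (w - z)))).
  apply: (@le_trans _ _ ((`|M| + 1) * p a (u w - u z - (w - z) *: l))).
    by rewrite ler_wpM2r ?sn_ge0 // ler_wpDr // ler_norm.
  by rewrite ler_wpM2l // ltW.
have -> : (`|M| + 1) * (e / 2 / (`|M| + 1) * modulus (w - z)) = e / 2 * modulus (w - z).
  by field; rewrite gt_eqF.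
by rewrite ltr_pM2r ?modulus_gt0 //; lra.
Qed.

End Space.

End SeminormCalculus.

(** * Limits and parameter integrals of holomorphic functions *)

Section Limits.
Context {R : realType}.
Implicit Types (f g : R[i] -> R[i]) (z w : R[i]).

Let modulus_scale (a : unit) (l x : R[i]) : modulus (l *: x) = modulus l * modulus x.
Proof. exact: modulusM. Qed.

Let modulus_directed (a b : unit) : exists c : unit, exists2 M : R, 0 < M &
  forall x : R[i], modulus x <= M * modulus x /\ modulus x <= M * modulus x.
Proof. by exists tt, 1 => // x; rewrite mul1r. Qed.

(** The field itself as a seminormed space: scalar holomorphy becomes a special
    case of [sn_derivative]. *)
Definition modulus_seminorms : seminorms R[i] :=
  @Seminorms R R[i] unit (fun=> @modulus R) (fun=> @modulus_le_add R)
    modulus_scale (inhabits tt) modulus_directed.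

Lemma modulus_complete : sn_complete modulus_seminorms.
Proof.
move=> s /(_ tt)[C hC].
have half01 : 0 <= (2^-1 : R) < 1 by rewrite invr_ge0 ler0n invf_lt1 // ltr1n.
have [l hl] := geometric_cauchy_complex half01 hC.
exists l => a e e0; have [n0 hn0] := geometric_small (2 * C / (1 - 2^-1)) half01 e0.
exists n0 => n n0n; apply: le_trans (ltW hn0); apply: le_trans (hl n) _.
have C0 : 0 <= C by have := hC 0%N; rewrite expr0 mulr1; apply: le_trans; exact: modulus_ge0.
have -> : 2 * (C * 2^-1 ^+ n / (1 - 2^-1)) = 2 * C / (1 - 2^-1) * 2^-1 ^+ n by ring.
rewrite ler_wpM2l //; last by apply: ler_wiXn2l; rewrite ?invr_ge0 ?invf_le1 ?ler1n.
by rewrite divr_ge0 ?mulr_ge0 //; lra.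
Qed.

Lemma holomorphic_of_lipschitz f z0 (r M : R) : 0 < r ->
  (forall z1 z3, in_square z0 r z1 -> in_square z0 r z3 -> z1 != z0 -> z3 != z0 ->
    modulus ((z1 - z0)^-1 * (f z1 - f z0) - (z3 - z0)^-1 * (f z3 - f z0))
      <= M * modulus (z1 - z3)) ->
  holomorphic_at f z0.
Proof.
move=> r0 hM.
have [l dl] : exists l, sn_derivative modulus_seminorms f z0 l.
  apply: (sn_derivative_of_lipschitz modulus_complete r0) => a.
  exists M => z1 z3 h1 h3 n1 n3; apply: hM => //; apply: modulus_in_square; exact: ltW.
have id1 (x : R[i]) : modulus (idfun x) <= 1 * modulus_seminorms tt x by rewrite mul1r.
exists l; exact: (@cderiv_functional R R[i] modulus_seminorms idfun tt 1 f z0 l id1 dl).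
Qed.

(** The divided-difference bound depends only on the uniform bound [B], hence
    passes to the pointwise limit. *)
Lemma holomorphic_limit (F : nat -> R[i] -> R[i]) g z0 (r B : R) : 0 < r ->
  (forall n z, in_square z0 r z -> holomorphic_at (F n) z) ->
  (forall n z, in_square z0 r z -> modulus (F n z) <= B) ->
  (forall z, in_square z0 r z -> forall e : R, 0 < e ->
     exists n0, forall n, (n0 <= n)%N -> modulus (F n z - g z) <= e) ->
  holomorphic_at g z0.
Proof.
move=> r0 dF FB Fg.
apply: (@holomorphic_of_lipschitz _ _ (r / 2) (128 * B / r ^+ 2)).
  by rewrite divr_gt0.
move=> z1 z3 i1 i3 n1 n3.
have i0 : in_square z0 (r / 2) z0.
  by apply: modulus_in_square; rewrite subrr modulus0 divr_ge0 // ltW.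
have rr : r / 2 <= r by lra.
apply/ler_addgt0Pl => e e0.
set A := (z1 - z0)^-1; set D := (z3 - z0)^-1.
pose K := 2 * (modulus A + modulus D) + 1.
have K0 : 0 < K by rewrite /K ltr_wpDl // mulr_ge0 // addr_ge0 // modulus_ge0.
have t0 : 0 < e / K by rewrite divr_gt0.
have [k1 h1] := Fg z1 (in_square_le rr i1) _ t0.
have [k0 h0] := Fg z0 (in_square_le rr i0) _ t0.
have [k3 h3] := Fg z3 (in_square_le rr i3) _ t0.
pose n := maxn k1 (maxn k0 k3).
have {}h1 := h1 n (leq_maxl _ _).
have {}h0 := h0 n (leq_trans (leq_maxl _ _) (leq_maxr _ _)).
have {}h3 := h3 n (leq_trans (leq_maxr _ _) (leq_maxr _ _)).
have dd := divided_difference_bound r0 (dF n)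
  (fun z hz => FB n z (square_frame_in hz)) i1 i0 i3 n1 n3.
rewrite -/A -/D in dd.
have -> : A * (g z1 - g z0) - D * (g z3 - g z0) =
    (A * (F n z1 - F n z0) - D * (F n z3 - F n z0)) +
    (A * ((F n z0 - g z0) - (F n z1 - g z1)) + D * ((F n z3 - g z3) - (F n z0 - g z0))).
  by ring.
apply: le_trans (modulus_le_add _ _) _; rewrite addrC lerD //.
apply: le_trans (modulus_le_add _ _) _; rewrite !modulusM.
have b1 : modulus (F n z0 - g z0 - (F n z1 - g z1)) <= e / K + e / K.
  by apply: le_trans (modulus_le_sub _ _) _; rewrite lerD.
have b2 : modulus (F n z3 - g z3 - (F n z0 - g z0)) <= e / K + e / K.
  by apply: le_trans (modulus_le_sub _ _) _; rewrite lerD.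
apply: (@le_trans _ _ (modulus A * (e / K + e / K) + modulus D * (e / K + e / K))).
  by rewrite lerD // ler_wpM2l // modulus_ge0.
have -> : modulus A * (e / K + e / K) + modulus D * (e / K + e / K) =
   (2 * (modulus A + modulus D)) * (e / K) by ring.
rewrite mulrA ler_pdivrMr // mulrC ler_wpM2l ?(ltW e0) //.
by rewrite /K lerDl.
Qed.

(** The divided difference in [z] moves under the integral sign, where the bound
    for the kernel is uniform along the contour. *)
Lemma holomorphic_u_integral f (kappa : R[i] -> R[i] -> R[i]) (l a : R) z0 (r B : R) :
  l <= a -> 0 < r ->
  (forall w, u_path l a w -> continuous_pt f w) ->
  (forall w z, u_path l a w -> in_square z0 r z -> holomorphic_at (kappa w) z) ->
  (forall w z, u_path l a w -> in_square z0 r z -> modulus (kappa w z) <= B) ->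
  (forall w z, u_path l a w -> in_square z0 r z ->
    continuous_pt (fun w => kappa w z) w) ->
  holomorphic_at (fun z => u_integral (fun w => f w * kappa w z) l a) z0.
Proof.
move=> la r0 cf dk kB ck.
have [Bf Bf0 fB] := continuous_u_bounded la cf.
apply: (@holomorphic_of_lipschitz _ _ (r / 2)
  (2 * (Bf * (128 * B / r ^+ 2)) * (2 * (a - l) + 1))).
  by rewrite divr_gt0.
move=> z1 z3 i1 i3 n1 n3.
have i0 : in_square z0 (r / 2) z0.
  by apply: modulus_in_square; rewrite subrr modulus0 divr_ge0 // ltW.
have rr : r / 2 <= r by lra.
set A := (z1 - z0)^-1; set D := (z3 - z0)^-1.
have cfk z : in_square z0 (r / 2) z ->
    forall w, u_path l a w -> continuous_pt (fun w => f w * kappa w z) w.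
  move=> hz w hw; apply: continuous_ptM; first exact: cf.
  by apply: ck => //; exact: in_square_le hz.
have cZ z m : in_square z0 (r / 2) z ->
    forall w, u_path l a w -> continuous_pt (fun w => m * (f w * kappa w z)) w.
  by move=> hz w hw; apply: continuous_ptM; [exact: continuous_pt_cst | exact: cfk].
have -> : A * (u_integral (fun w => f w * kappa w z1) l a -
      u_integral (fun w => f w * kappa w z0) l a) -
    D * (u_integral (fun w => f w * kappa w z3) l a -
      u_integral (fun w => f w * kappa w z0) l a) =
  u_integral (fun w => A * (f w * kappa w z1) +
    ((D - A) * (f w * kappa w z0) + (- D) * (f w * kappa w z3))) l a.
  have cDZ w : u_path l a w -> continuous_pt
      (fun w => (D - A) * (f w * kappa w z0) + (- D) * (f w * kappa w z3)) w.
    by move=> hw; apply: continuous_ptD; exact: cZ.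
  rewrite (u_integralD (cZ z1 A i1) cDZ) (u_integralD (cZ _ _ i0) (cZ _ _ i3)).
  rewrite (u_integralZ _ (cfk _ i1)) (u_integralZ _ (cfk _ i0)) (u_integralZ _ (cfk _ i3)).
  ring.
have -> : 2 * (Bf * (128 * B / r ^+ 2)) * (2 * (a - l) + 1) * modulus (z1 - z3) =
  2 * (Bf * (128 * B / r ^+ 2 * modulus (z1 - z3))) * (2 * (a - l) + 1) by ring.
apply: u_integral_bound => //.
- move=> w hw; apply: continuous_ptD; first exact: cZ.
  by apply: continuous_ptD; exact: cZ.
- move=> w hw.
  have -> : A * (f w * kappa w z1) + ((D - A) * (f w * kappa w z0) +
      - D * (f w * kappa w z3)) =
    f w * (A * (kappa w z1 - kappa w z0) - D * (kappa w z3 - kappa w z0)) by ring.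
  rewrite modulusM ler_pM ?modulus_ge0 ?fB //.
  apply: (divided_difference_bound r0 _ _ i1 i0 i3 n1 n3); first by move=> z; exact: dk.
  by move=> z hz; apply: kB => //; exact: square_frame_in.
Qed.

End Limits.

(** * Continuation of scalar functions across the half-line *)

Section ScalarExtension.
Context {R : realType}.
Implicit Types (f g : R[i] -> R[i]) (z w : R[i]).

Definition off_axis z := (complex.Im z != 0) || (complex.Re z < 0).

Lemma off_axisP z : off_axis z <-> (~` @nonneg_axis R) z.
Proof.
rewrite /off_axis /nonneg_axis; split.
  by move=> h [x /= x0 zE]; move: h; rewrite -zE /= eqxx ltNge x0.
case: z => x y h /=; case: eqVneq => //= y0; rewrite ltNge; apply/negP => x0.
by apply: h; exists x => //; rewrite y0.
Qed.

Lemma sum_geometric (q : R[i]) n : 1 - q != 0 ->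
  \sum_(j < n) q ^+ j = (1 - q ^+ n) / (1 - q).
Proof.
move=> q1; elim: n => [|n IH]; first by rewrite big_ord0 expr0 subrr mul0r.
by rewrite big_ord_recr /= IH exprSr; field.
Qed.

(** The substitution [exp z] for the variable of a power series with radius of
    convergence [exp N]. *)
Section ExponentialSeries.
Context (F : nat -> R[i]) (C N : R).
Context (FC : forall j, modulus (F j) <= C * expR (- (N * j%:R))).

Let S (n : nat) z := \sum_(j < n) F j * cexp (j%:R * z).

Let C0 : 0 <= C.
Proof. by have := FC 0%N; rewrite mulr0 oppr0 expR0 mulr1; apply: le_trans; exact: modulus_ge0. Qed.

Let term_bound j z : modulus (F j * cexp (j%:R * z)) <=
  C * expR (complex.Re z - N) ^+ j.
Proof.
rewrite modulusM cexp_natmul modulusX modulus_cexp -!expRM_natl.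
apply: le_trans (ler_wpM2r (expR_ge0 _) (FC j)) _.
by rewrite -mulrA -expRD (_ : - (N * j%:R) + _ = j%:R * (complex.Re z - N)) //; ring.
Qed.

Lemma exponential_series_cvg : exists s : R[i] -> R[i], forall z, complex.Re z < N ->
  forall e : R, 0 < e -> exists n0, forall n, (n0 <= n)%N ->
    modulus (S n z - s z) <= e.
Proof.
have /choice[s hs] : forall z, exists l, complex.Re z < N ->
  forall n, modulus (S n z - l) <=
    2 * (C * expR (complex.Re z - N) ^+ n / (1 - expR (complex.Re z - N))).
  move=> z; have [zN|] := ltP (complex.Re z) N; last by exists 0.
  have q01 : 0 <= expR (complex.Re z - N) < 1.
    by rewrite expR_ge0 /= expR_lt1 subr_lt0.
  have step n : modulus (S n.+1 z - S n z) <= C * expR (complex.Re z - N) ^+ n.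
    by rewrite /S big_ord_recr /= addrAC subrr add0r; exact: term_bound.
  by have [l hl] := geometric_cauchy_complex q01 step; exists l.
exists s => z zN e e0; set q := expR (complex.Re z - N).
have q1 : q < 1 by rewrite /q expR_lt1 subr_lt0.
have q01 : 0 <= q < 1 by rewrite expR_ge0.
have [n0 hn0] := geometric_small (2 * C / (1 - q)) q01 e0.
exists n0 => n n0n; apply: le_trans (ltW hn0); apply: le_trans (hs z zN n) _.
rewrite -/q (_ : 2 * _ = 2 * C / (1 - q) * q ^+ n); last by ring.
rewrite ler_wpM2l ?divr_ge0 ?mulr_ge0 //; first by lra.
by apply: ler_wiXn2l => //; [exact: expR_ge0 | exact: ltW].
Qed.

Lemma exponential_series_holomorphic (s : R[i] -> R[i]) z0 :
  (forall z, complex.Re z < N ->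
    forall e : R, 0 < e -> exists n0, forall n, (n0 <= n)%N ->
    modulus (S n z - s z) <= e) ->
  complex.Re z0 < N -> holomorphic_at s z0.
Proof.
move=> hs z0N; pose r := (N - complex.Re z0) / 2.
have r0 : 0 < r by rewrite divr_gt0 // subr_gt0.
have reN z : in_square z0 r z -> complex.Re z <= N - r.
  by move=> /andP[]; rewrite ReB ler_norml => /andP[_ h] _; rewrite /r in h *; lra.
have q1 : expR (- r) < 1 by rewrite expR_lt1 oppr_lt0.
apply: (@holomorphic_limit _ S s z0 r (C / (1 - expR (- r)))) => //.
- move=> n z hz; apply: holomorphic_sum => j; apply: holomorphicM.
    exact: holomorphic_cst.
  exact: holomorphic_cexp_scale.
- move=> n z /reN zN.
  have partial m : \sum_(j < m) C * expR (- r) ^+ j =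
      C * ((1 - expR (- r) ^+ m) / (1 - expR (- r))).
    elim: m => [|m IH]; first by rewrite big_ord0 expr0 subrr mul0r mulr0.
    by rewrite big_ord_recr /= IH exprSr; field; rewrite subr_eq0 gt_eqF.
  apply: (@le_trans _ _ (\sum_(j < n) C * expR (- r) ^+ j)).
    rewrite /S; elim: n => [|n IH]; first by rewrite !big_ord0 modulus0.
    rewrite !big_ord_recr /=; apply: le_trans (modulus_le_add _ _) _.
    rewrite lerD //; apply: le_trans (term_bound _ _) _.
    rewrite ler_wpM2l //; apply: lerXn2r; rewrite ?nnegrE ?expR_ge0 //.
    by rewrite ler_expR; lra.
  rewrite partial; apply: ler_wpM2l => //.
  rewrite -[leRHS]mul1r; apply: ler_wpM2r; first by rewrite invr_ge0; lra.
  by rewrite gerBl exprn_ge0 // expR_ge0.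
- by move=> z /reN zN; apply: hs; lra.
Qed.

End ExponentialSeries.

Context (f : R[i] -> R[i]).
Context (df : forall z, off_axis z -> holomorphic_at f z).

Lemma u_path_off_axis (l a : R) z : l < 0 -> u_path l a z -> off_axis z.
Proof.
rewrite /off_axis => l0 [[-> _]|[[->|->] _]].
- by rewrite l0 orbT.
- by rewrite oppr_eq0 invr_eq0 pnatr_eq0.
- by rewrite invr_eq0 pnatr_eq0.
Qed.

Let cf l a z : l < 0 -> u_path l a z -> continuous_pt f z.
Proof.
move=> l0 hz; apply: holomorphic_continuous; apply: df.
exact: u_path_off_axis hz.
Qed.

(** [\sum_j exp (j (z - w))], continued beyond [Re z < Re w]; at [w = z] it has
    the pole of Cauchy's kernel. *)
Let kernel z w := (1 - cexp (z - w))^-1.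

Let continuous_kernel z w : 1 - cexp (z - w) != 0 ->
  continuous_pt (kernel z) w.
Proof.
move=> h; apply: holomorphic_continuous; apply: holomorphicV => //.
by apply: holomorphicB; [exact: holomorphic_cst | exact: holomorphic_cexp_sub_l].
Qed.

Let holomorphic_kernel z w : 1 - cexp (z - w) != 0 ->
  holomorphic_at (fun t => kernel t w) z.
Proof.
move=> h; apply: holomorphicV => //.
by apply: holomorphicB; [exact: holomorphic_cst | exact: holomorphic_cexp_sub].
Qed.

Let outer (a : R) z := u_integral (fun w => f w * kernel z w) (- 3) a.

(** Inside the contour with left side [- 3] the kernel has no poles on the
    contour: against the left side [Re (z - w)] is positive, against the
    horizontal sides [|Im (z - w)|] lies strictly between 0 and 1. *)
Let outer_holomorphic (a : R) z : - 3 <= a -> - 3 < complex.Re z ->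
  `|complex.Im z| < 2^-1 -> holomorphic_at (outer a) z.
Proof.
move=> a3 z3; rewrite ltr_norml => /andP[zi1 zi2].
pose r := Num.min ((complex.Re z + 3) / 2)
  (Num.min ((complex.Im z + 2^-1) / 2) ((2^-1 - complex.Im z) / 2)).
have r0 : 0 < r by rewrite /r !lt_min !divr_gt0 //; lra.
have [r1 r2 r3] : [/\ r <= (complex.Re z + 3) / 2, r <= (complex.Im z + 2^-1) / 2 &
    r <= (2^-1 - complex.Im z) / 2].
  have : r <= r by []. 
  by rewrite {2}/r !le_min => /andP[-> /andP[-> ->]].
have rhalf : r <= 4^-1 by lra.
have sr0 : 0 < sin r by rewrite sin_gt0_pi // r0 /=; have := pi_ge2 R; lra.
pose m := Num.min r (expR (- 3 - a) * sin r).
have m0 : 0 < m by rewrite /m lt_min r0 mulr_gt0 // expR_gt0.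
have low w t : u_path (- 3) a w -> in_square z r t -> m <= modulus (1 - cexp (t - w)).
  move=> hw; rewrite in_squareE => /andP[/andP[h1 h2] /andP[h3 h4]].
  case: hw => [[hr hi]|[hi /andP[hr1 hr2]]].
    apply: (@le_trans _ _ r); first by rewrite /m ge_min lexx.
    by apply: one_sub_cexp_lower_Re; rewrite ReB hr; clear -r0 r1 h1 h2; lra.
  apply: (@le_trans _ _ (expR (- 3 - a) * sin r)); first by rewrite /m ge_min lexx orbT.
  apply: (@le_trans _ _ (expR (complex.Re (t - w)) * sin r)).
    by rewrite ler_wpM2r ?(ltW sr0) // ler_expR ReB; clear -r0 r1 h1 hr2; lra.
  apply: one_sub_cexp_lower_Im => //; rewrite ImB.
  by clear -r0 r2 r3 rhalf hi h3 h4; case: hi => ->; rewrite ler_normr ler_norml; lra.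
have neq0 w t : u_path (- 3) a w -> in_square z r t -> 1 - cexp (t - w) != 0.
  by move=> hw ht; rewrite -modulus_gt0; exact: lt_le_trans m0 (low _ _ hw ht).
apply: (@holomorphic_u_integral _ f (fun w t => kernel t w) (- 3) a z r m^-1) => //.
- by move=> w hw; apply: cf hw; rewrite oppr_lt0.
- by move=> w t hw ht; apply: holomorphic_kernel; exact: neq0.
- move=> w t hw ht; rewrite modulusV lef_pV2 ?posrE //; first exact: low.
  by apply: lt_le_trans m0 (low _ _ hw ht).
- by move=> w t hw ht; apply: continuous_kernel; exact: neq0.
Qed.

(** Shifting the left side of the path across [z] picks up the value [f z]: the
    kernel has a simple pole there and, on this strip, nowhere else. *)
Let residue_shift (a : R) z : - 1 <= a -> - 3 < complex.Re z < - 1 ->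
  - 2^-1 < complex.Im z < 2^-1 ->
  u_integral (fun w => f w * kernel z w) (- 1) a - outer a z = twopii * f z.
Proof.
move=> a1 /andP[z3 z1] /andP[zi1 zi2].
have imz w : - 2^-1 <= complex.Im w <= 2^-1 -> `|complex.Im (z - w)| <= 1.
  by move=> h; rewrite ImB ler_norml; lra.
have neq0 w : - 2^-1 <= complex.Im w <= 2^-1 -> w != z -> 1 - cexp (z - w) != 0.
  by move=> /imz h wz; apply: one_sub_cexp_neq0 => //; rewrite subr_eq0 eq_sym.
have dh w : off_axis w -> - 2^-1 <= complex.Im w <= 2^-1 -> w != z ->
    holomorphic_at (fun w => f w * kernel z w) w.
  move=> hw hi wz; apply: holomorphicM; first exact: df.
  apply: holomorphicV; last exact: neq0.
  by apply: holomorphicB; [exact: holomorphic_cst | exact: holomorphic_cexp_sub_l].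
rewrite /outer u_integral_sub; last 2 first.
- by lra.
- move=> w hw; apply: holomorphic_continuous; apply: dh.
  + by apply: u_path_off_axis hw; lra.
  + by case: hw => [[_ ->]//|[[] -> _]]; lra.
  + apply/eqP => e; case: hw; rewrite e; first by lra.
    by case=> -[]; lra.
have [phi [cphi phi1 phiE]] := cderiv_cexp (0 : R[i]).
rewrite cexp0 in phi1 phiE.
have -> : twopii * f z = twopii * (f z * (phi (z - z))^-1).
  by rewrite subrr phi1 invr1 mulr1.
apply: (residue_formula (psi := fun w => f w * (phi (z - w))^-1)) => //; first by lra.
- by lra.
- move=> w /andP[h1 h2] wz; apply: dh => //; rewrite /off_axis.
  by rewrite (_ : complex.Re w < 0) ?orbT //; lra.
- apply: continuous_ptM.
    apply: holomorphic_continuous; apply: df; rewrite /off_axis.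
    by rewrite (_ : complex.Re z < 0) ?orbT //; lra.
  apply: continuous_ptV; first by rewrite subrr phi1 oner_eq0.
  apply: (continuous_pt_comp (f := phi) (g := fun w => z - w)).
    by apply: continuous_ptB; [exact: continuous_pt_cst | exact: continuous_pt_id].
  by rewrite subrr.
- move=> w _ wz; rewrite /kernel.
  have -> : 1 - cexp (z - w) = phi (z - w) * (w - z).
    by rewrite (phiE (z - w)); ring.
  by rewrite invfM mulrA divfK // subr_eq0.
Qed.

Let inner_series (a : R) z : - 1 <= a -> complex.Re z < - 1 ->
  forall e : R, 0 < e -> exists n0, forall n, (n0 <= n)%N ->
  modulus (\sum_(j < n) u_integral (fun w => f w * cexp (- j%:R * w)) (- 1) a *
      cexp (j%:R * z) - u_integral (fun w => f w * kernel z w) (- 1) a) <= e.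
Proof.
move=> a1 z1 e e0; pose q := expR (complex.Re z + 1).
have q0 : 0 <= q := expR_ge0 _.
have q1 : q < 1 by rewrite expR_lt1; lra.
have cf' w : u_path (- 1) a w -> continuous_pt f w by apply: cf; rewrite oppr_lt0.
have [B B0 fB] := continuous_u_bounded a1 cf'.
have rew w : u_path (- 1) a w -> - 1 <= complex.Re w.
  by case=> [[-> _]//|[_ /andP[]]].
have qb w : u_path (- 1) a w -> modulus (cexp (z - w)) <= q.
  by move=> /rew h; rewrite modulus_cexp ler_expR ReB; lra.
have kb w : u_path (- 1) a w -> 1 - q <= modulus (1 - cexp (z - w)).
  move=> /qb h; apply: le_trans (modulus_sub_ge _ _); rewrite modulus1; lra.
have neq0 w : u_path (- 1) a w -> 1 - cexp (z - w) != 0.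
  by move=> /kb h; rewrite -modulus_gt0; apply: lt_le_trans h; lra.
have ck w : u_path (- 1) a w -> continuous_pt (kernel z) w.
  by move=> hw; apply: continuous_kernel; exact: neq0.
have cexpj m w : continuous_pt (fun w => cexp (m * w)) w.
  by apply: holomorphic_continuous; exact: holomorphic_cexp_scale.
have cq n w : continuous_pt (fun w => cexp (z - w) ^+ n) w.
  apply: holomorphic_continuous; apply: holomorphicX.
  exact: holomorphic_cexp_sub_l.
have q01 : 0 <= q < 1 by rewrite q0.
pose K := 2 * (B * (1 - q)^-1) * (2 * (a - - 1) + 1).
have [n0 hn0] := geometric_small K q01 e0.
have K0 : 0 <= K.
  by rewrite /K !mulr_ge0 ?invr_ge0 ?(ltW B0) //; lra.
exists n0 => n n0n; apply: le_trans (ltW hn0).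
apply: (@le_trans _ _ (K * q ^+ n)); last first.
  by rewrite ler_wpM2l //; apply: ler_wiXn2l => //; exact: ltW.
have -> : \sum_(j < n) u_integral (fun w => f w * cexp (- j%:R * w)) (- 1) a *
      cexp (j%:R * z) - u_integral (fun w => f w * kernel z w) (- 1) a =
    u_integral (fun w => (- 1) * (f w * (cexp (z - w) ^+ n * kernel z w))) (- 1) a.
  apply/eqP; rewrite subr_eq eq_sym; apply/eqP.
  rewrite -u_integralD; last 2 first.
  - move=> w hw; apply: continuous_ptM; first exact: continuous_pt_cst.
    by apply: continuous_ptM; [exact: cf' | apply: continuous_ptM; [exact: cq|exact: ck]].
  - by move=> w hw; apply: continuous_ptM; [exact: cf' | exact: ck].
  transitivity (u_integral (fun w => \sum_(j < n) cexp (j%:R * z) *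
      (f w * cexp (- j%:R * w))) (- 1) a).
    apply: eq_u_integral => w hw.
    transitivity (f w * \sum_(j < n) cexp (z - w) ^+ j).
      by rewrite sum_geometric ?neq0 // /kernel; ring.
    rewrite mulr_sumr; apply: eq_bigr => j _.
    by rewrite mulrCA -cexpD mulNr -mulrBr cexp_natmul.
  rewrite (@u_integral_sum R (- 1) a n (fun j w => cexp (j%:R * z) *
      (f w * cexp (- j%:R * w)))); last first.
    move=> j w hw; apply: continuous_ptM; first exact: continuous_pt_cst.
    by apply: continuous_ptM; [exact: cf' | exact: cexpj].
  apply: eq_bigr => j _.
  have cfe w : u_path (- 1) a w -> continuous_pt (fun w => f w * cexp (- j%:R * w)) w.
    by move=> hw; apply: continuous_ptM; [exact: cf' | exact: cexpj].
  by rewrite (u_integralZ _ cfe) mulrC.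
have -> : K * q ^+ n = 2 * (B * (q ^+ n * (1 - q)^-1)) * (2 * (a - - 1) + 1).
  by rewrite /K; ring.
apply: u_integral_bound => //.
  move=> w hw; apply: continuous_ptM; first exact: continuous_pt_cst.
  by apply: continuous_ptM; [exact: cf' | apply: continuous_ptM; [exact: cq|exact: ck]].
move=> w hw; rewrite mulN1r modulusN modulusM ler_pM ?modulus_ge0 ?fB //.
rewrite modulusM ler_pM ?modulus_ge0 //.
  by rewrite modulusX; apply: lerXn2r; rewrite ?nnegrE ?modulus_ge0 // qb.
rewrite modulusV lef_pV2 ?kb // posrE; first by rewrite modulus_gt0 neq0.
by lra.
Qed.

(** Identity theorem along the line [Im z = y]: zeros on a disc of radius [rho]
    spread to radius [2 rho] by [zero_near_center], which covers the disc of the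
    next centre. The step [rho] depends only on the distances of [y] to 0 and to
    [1/2], so finitely many steps reach any point. *)
Let zero_propagation (d : R[i] -> R[i]) (N : R) :
  (forall z, - 3 < complex.Re z < N -> `|complex.Im z| < 2^-1 -> off_axis z ->
     holomorphic_at d z) ->
  (forall z, - 3 < complex.Re z < - 1 -> `|complex.Im z| < 2^-1 -> d z = 0) ->
  forall z, - 2 <= complex.Re z <= N - 1 -> `|complex.Im z| < 2^-1 ->
    complex.Im z != 0 -> d z = 0.
Proof.
move=> dd d0 [x y] /= /andP[x2 xN] y1 y0.
pose rho := Num.min `|y| (2^-1 - `|y|) / 8.
have rho0 : 0 < rho by rewrite /rho divr_gt0 // lt_min normr_gt0 y0 subr_gt0.
have [rho1 rho2] : 8 * rho <= `|y| /\ 8 * rho <= 2^-1 - `|y|.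
  have -> : 8 * rho = Num.min `|y| (2^-1 - `|y|) by rewrite /rho; field.
  by split; rewrite ge_min lexx ?orbT.
pose c k : R[i] := (- 2 + k%:R * rho) +i* y.
have imc k z : in_square (c k) (4 * rho) z ->
    [/\ `|complex.Im z| < 2^-1, complex.Im z != 0 &
      complex.Re (c k) - 4 * rho <= complex.Re z <= complex.Re (c k) + 4 * rho].
  rewrite in_squareE => /andP[-> /andP[]] /=.
  move: rho1 rho2; have [yp|yn] := ger0P y => r1 r2 h1 h2; split=> //.
  - by rewrite ltr_norml; lra.
  - by rewrite gt_eqF //; lra.
  - by rewrite ltr_norml; lra.
  - by rewrite lt_eqF //; lra.
have rho4 : rho <= 4 * rho by lra.
have step k : complex.Re (c k) <= N - 1 ->
    forall z, modulus (z - c k) < rho -> d z = 0.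
  elim: k => [|k IH] ck z zk.
    have [h1 h2 h3] := imc 0%N z (in_square_le rho4 (modulus_in_square (ltW zk))).
    by apply: d0 => //; rewrite /= mul0r addr0 in h3; lra.
  have ckS : complex.Re (c k.+1) = complex.Re (c k) + rho.
    by rewrite /= -natr1; ring.
  have ckk : modulus (c k.+1 - c k) = rho.
    rewrite (_ : _ - _ = rho%:C) ?modulus_real ?gtr0_norm //.
    by rewrite /c; apply/eqP; rewrite eq_complex /= -natr1; apply/andP; split;
      apply/eqP; ring.
  have c2 : - 2 <= complex.Re (c k) by rewrite /= lerDl mulr_ge0 // ltW.
  apply: (@zero_near_center _ d (c k) (4 * rho) rho) => //.
  - by lra.
  - move=> t /imc[h1 h2 h3]; apply: dd => //; first by lra.
    by rewrite /off_axis h2.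
  - by move=> t tk; apply: IH => //; lra.
  - apply: le_trans (modulus_triangle (c k.+1) _ _) _; rewrite ckk; lra.
have u0 : 0 <= (x + 2) / rho by rewrite divr_ge0 ?(ltW rho0) //; lra.
have /andP[k1 k2] := truncn_itv u0; set k := Num.truncn _ in k1 k2.
rewrite ler_pdivlMr // in k1; rewrite ltr_pdivrMr // in k2.
have kS : k.+1%:R * rho = k%:R * rho + rho by rewrite -natr1; ring.
rewrite kS in k2.
apply: (step k); first by rewrite /=; lra.
rewrite (_ : _ - _ = (x - (- 2 + k%:R * rho))%:C); last by rewrite /c; by_parts.
by rewrite modulus_real ltr_norml; lra.
Qed.

Context (decay : forall n : nat, exists a C : R, n%:R <= a /\
  forall j : nat, modulus (u_integral (fun w => f w * cexp (- j%:R * w)) (- 1) a) <=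
    C * expR (- (n%:R * j%:R))).

(** Near [x0] the function equals [(s - outer) / (2 pi i)]: left of the contour
    this is the residue formula with the kernel expanded into its geometric
    series, and both sides are holomorphic up to [Re z < n] off the half-line. The
    right-hand side does not see the half-line: the decay of the coefficients
    makes [s] holomorphic on [Re z < n]. *)
Theorem holomorphic_extension (x0 : R) : 0 <= x0 -> exists g : R[i] -> R[i],
  (forall z, in_square x0%:C 4^-1 z -> holomorphic_at g z) /\
  (forall z, in_square x0%:C 4^-1 z -> off_axis z -> g z = f z).
Proof.
move=> x00; (* x0 + 2 < n leaves room for the square of half-side 1/4 left of n - 1 *)
pose n := (Num.truncn x0).+3.
have xn : x0 + 2 < n%:R.
  by have /andP[_] := truncn_itv x00; rewrite /n -(natr1 (_.+2)) -(natr1 (_.+1)); lra.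
have [a [C [na FC]]] := decay n.
have a1 : - 1 <= a by have := ler0n R n; lra.
pose F j := u_integral (fun w => f w * cexp (- j%:R * w)) (- 1) a.
have [s hs] := exponential_series_cvg FC.
pose g z := twopii^-1 * (s z - outer a z).
have dg z : - 3 < complex.Re z < n%:R -> `|complex.Im z| < 2^-1 -> holomorphic_at g z.
  move=> /andP[z3 zn] zi; apply: holomorphicM; first exact: holomorphic_cst.
  apply: holomorphicB; first exact: (exponential_series_holomorphic FC hs zn).
  by apply: outer_holomorphic => //; lra.
have gf z : - 3 < complex.Re z < - 1 -> `|complex.Im z| < 2^-1 -> g z = f z.
  move=> /andP[z3 z1] zi; rewrite /g.
  have -> : s z = u_integral (fun w => f w * kernel z w) (- 1) a.
    apply/eqP; rewrite -subr_eq0; apply/eqP; apply: modulus_le0 => e e0.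
    have e2 : 0 < e / 2 by rewrite divr_gt0.
    have zn : complex.Re z < n%:R by have := ler0n R n; lra.
    have [k1 h1] := hs z zn _ e2.
    have [k2 h2] := inner_series a1 z1 e2.
    have {}h1 := h1 (maxn k1 k2) (leq_maxl _ _).
    have {}h2 := h2 (maxn k1 k2) (leq_maxr _ _).
    apply: le_trans (modulus_triangle (\sum_(j < maxn k1 k2) F j * cexp (j%:R * z)) _ _) _.
    by rewrite modulus_distC [leRHS]splitr lerD.
  rewrite residue_shift ?z3 // ?mulKf ?twopii_neq0 //.
  by move: zi; rewrite ltr_norml.
have geq z : - 2 <= complex.Re z <= n%:R - 1 -> `|complex.Im z| < 2^-1 ->
    complex.Im z != 0 -> g z = f z.
  move=> zr zi z0; apply/eqP; rewrite -subr_eq0; apply/eqP.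
  apply: (@zero_propagation (fun z => g z - f z) n%:R) => //.
  - by move=> t tr ti t0; apply: holomorphicB; [exact: dg | exact: df].
  - by move=> t tr ti; rewrite gf // subrr.
exists g; split.
  move=> z; rewrite in_squareE /= => /andP[/andP[h1 h2] /andP[h3 h4]].
  by apply: dg; [lra | rewrite ltr_norml; lra].
move=> z zin hz; have := zin; rewrite in_squareE /= => /andP[/andP[h1 h2] /andP[h3 h4]].
have [zi|] := eqVneq (complex.Im z) 0; last first.
  by apply: geq; [lra | rewrite ltr_norml; lra].
move: hz (hz); rewrite {1}/off_axis zi eqxx /= => zr hz.
(* on the negative axis, by continuity from above *)
have cd : continuous_pt (fun z => g z - f z) z.
  apply: holomorphic_continuous; apply: holomorphicB; last exact: df.
  by apply: dg; [lra | rewrite zi normr0; lra].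
apply/eqP; rewrite -subr_eq0; apply/eqP; apply: modulus_le0 => e e0.
have [d d0 hd] := cd _ e0.
pose t := Num.min (d / 2) 4^-1.
have t0 : 0 < t by rewrite /t lt_min divr_gt0 //; lra.
have [td t4] : t <= d / 2 /\ t <= 4^-1 by rewrite /t !ge_min !lexx orbT.
have wz : modulus (complex.Re z +i* t - z) < d.
  apply: le_lt_trans (modulus_le_ReIm _) _; rewrite ReB ImB /= subrr zi subr0 normr0 add0r.
  by rewrite gtr0_norm //; lra.
have := hd _ wz; rewrite geq /=; first last.
- by rewrite gt_eqF.
- by rewrite gtr0_norm //; lra.
- by lra.
by rewrite subrr sub0r modulusN => /ltW.
Qed.

End ScalarExtension.

(** * The Hahn-Banach theorem *)

Section HahnBanach.
Context {R : realType} {X : lmodType R[i]}.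
Implicit Types (q phi : X -> R) (x z : X).

(** One inequality for positive factors gives the other one, applied to the
    inverse factor. *)
Definition sublinear (s : X -> R) := (forall x y, s (x + y) <= s x + s y) /\
  (forall (t : R) x, 0 < t -> s (t%:C *: x) <= t * s x).

Definition real_linear phi := (forall x y, phi (x + y) = phi x + phi y) /\
  (forall (t : R) x, phi (t%:C *: x) = t * phi x).

Lemma sublinear0 (s : X -> R) : sublinear s -> s 0 = 0.
Proof.
move=> [_ hs]; have h2 := hs 2 0 (ltr0n _ 2); have h1 := hs 2^-1 0.
rewrite !scaler0 in h1 h2; have {}h1 := h1 (_ : 0 < 2^-1).
by apply/eqP; rewrite eq_le; rewrite invr_gt0 ltr0n in h1; have := h1 isT; lra.
Qed.

Lemma sublinearN (s : X -> R) x : sublinear s -> - s (- x) <= s x.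
Proof.
by move=> hs; have := hs.1 x (- x); rewrite subrr (sublinear0 hs); lra.
Qed.

(** The largest sublinear functional below [s] whose value at [- x0] is at most
    [- s x0]: it is linear in the direction of [x0]. *)
Definition tilt (s : X -> R) x0 x : R :=
  inf [set s (x + t%:C *: x0) - t * s x0 | t in [set t : R | 0 <= t]].

Section Tilt.
Context (s : X -> R) (hs : sublinear s) x0.

Let lower x : lbound
  [set s (x + t%:C *: x0) - t * s x0 | t in [set t : R | 0 <= t]] (- s (- x)).
Proof.
move=> _ [t /= t0 <-]; have := hs.1 (x + t%:C *: x0) (- x).
rewrite addrAC subrr add0r; have [->|tn0] := eqVneq t 0.
  by rewrite scale0r addr0 mul0r (sublinear0 hs); lra.
have {}t0 : 0 < t by rewrite lt_neqAle eq_sym tn0.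
have ti : 0 < t^-1 by rewrite invr_gt0.
have := hs.2 t^-1 (t%:C *: x0) ti; rewrite scalerA -rmorphM /= mulVf ?gt_eqF //.
by rewrite scale1r mulrC ler_pdivlMr // mulrC; lra.
Qed.

Let tilt_le_val x (t : R) : 0 <= t -> tilt s x0 x <= s (x + t%:C *: x0) - t * s x0.
Proof. by move=> t0; apply: ge_inf; [exists (- s (- x)); exact: lower | exists t]. Qed.

Let le_tilt x (v : R) :
  (forall t : R, 0 <= t -> v <= s (x + t%:C *: x0) - t * s x0) -> v <= tilt s x0 x.
Proof.
move=> h; apply: lb_le_inf; first by exists (s (x + 0%:C *: x0) - 0 * s x0), 0 => /=.
by move=> _ [t /= t0 <-]; exact: h.
Qed.

Lemma tilt_le x : tilt s x0 x <= s x.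
Proof. by have := tilt_le_val x (lexx 0); rewrite scale0r addr0 mul0r subr0. Qed.

Lemma tilt_opp : tilt s x0 (- x0) <= - s x0.
Proof.
have := tilt_le_val (- x0) ler01.
by rewrite rmorph1 scale1r addNr (sublinear0 hs) mul1r sub0r.
Qed.

Lemma tilt_sublinear : sublinear (tilt s x0).
Proof.
split=> [x y|t x t0].
  rewrite -lerBlDr; apply: le_tilt => t t0; rewrite lerBlDl -lerBlDr.
  apply: le_tilt => r r0; rewrite lerBlDr.
  apply: le_trans (tilt_le_val _ (addr_ge0 r0 t0)) _.
  have := hs.1 (y + r%:C *: x0) (x + t%:C *: x0).
  rewrite rmorphD /= scalerDl [x + y]addrC addrACA mulrDl; lra.
rewrite mulrC -ler_pdivrMr //; apply: le_tilt => r r0.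
rewrite ler_pdivrMr //; have tr : 0 <= t * r by rewrite mulr_ge0 // ltW.
apply: le_trans (tilt_le_val _ tr) _.
have := hs.2 t (x + r%:C *: x0) t0; rewrite scalerDr scalerA -rmorphM /=; lra.
Qed.

End Tilt.

(** Zorn's lemma gives a minimal sublinear functional below [tilt q x0]; since
    tilting cannot decrease it any further, it is linear. *)
Lemma hahn_banach q x0 : sublinear q -> exists phi,
  [/\ real_linear phi, forall x, phi x <= q x & phi x0 = q x0].
Proof.
move=> hq; pose q0 := tilt q x0; have hq0 := tilt_sublinear hq x0.
pose T := {s : X -> R | sublinear s /\ forall x, s x <= q0 x}.
pose t0 : T := exist _ q0 (conj hq0 (fun=> lexx _)).
pose rel (s t : T) := `[< forall x, sval t x <= sval s x >].
have [|||m mP] := @ZL_preorder T t0 rel.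
- by move=> t; apply/asboolP.
- move=> r s t /asboolP rs /asboolP st; apply/asboolP => x.
  exact: le_trans (st x) (rs x).
- move=> A Atot; have [[s0 As0]|A0] := pselect (exists s, A s); last first.
    by exists t0 => s As; case: A0; exists s.
  pose V x := [set sval s x | s in A].
  have Vlb x : has_lbound (V x).
    exists (- q0 (- x)) => _ [s As <-].
    apply: le_trans (sublinearN x (svalP s).1); rewrite lerN2.
    exact: (svalP s).2.
  have inf_le s x : A s -> inf (V x) <= sval s x.
    by move=> As; apply: ge_inf => //; exists s.
  have le_inf' v x : (forall s, A s -> v <= sval s x) -> v <= inf (V x).
    by move=> h; apply: lb_le_inf; [exists (sval s0 x), s0 | move=> _ [s As <-]; exact: h].
  have hm : sublinear (fun x => inf (V x)) /\ forall x, inf (V x) <= q0 x.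
    split; last by move=> x; apply: le_trans (inf_le s0 x As0) _; exact: (svalP s0).2.
    split=> [x y|t x tp].
      rewrite -lerBlDr; apply: (le_inf') => s As; rewrite lerBlDl -lerBlDr.
      apply: (le_inf') => s' As'; rewrite lerBlDr.
      have [/asboolP ss|/asboolP ss] := Atot _ _ As As'.
        apply: le_trans (inf_le s' _ As') _; apply: le_trans ((svalP s').1.1 x y) _.
        by rewrite addrC lerD.
      apply: le_trans (inf_le s _ As) _; apply: le_trans ((svalP s).1.1 x y) _.
      by rewrite addrC lerD.
    rewrite mulrC -ler_pdivrMr //; apply: (le_inf') => s As; rewrite ler_pdivrMr //.
    apply: le_trans (inf_le s _ As) _; rewrite mulrC; exact: (svalP s).1.2.
  pose m : T := exist (fun s => sublinear s /\ forall x, s x <= q0 x) _ hm.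
  by exists m => s As; apply/asboolP => x; exact: inf_le.
case: m mP => s [hs sq0] /= mP.
have tilt_ge x z : s z <= tilt s x z.
  have ht : sublinear (tilt s x) /\ forall z, tilt s x z <= q0 z.
    split; first exact: tilt_sublinear.
    by move=> z'; apply: le_trans (tilt_le hs x z') (sq0 z').
  pose m' : T := exist (fun s => sublinear s /\ forall x, s x <= q0 x) _ ht.
  have /(mP m')/asboolP : rel (exist _ s (conj hs sq0)) m'; last exact.
  by apply/asboolP => z' /=; exact: tilt_le.
have sN x : s (- x) = - s x.
  apply/eqP; rewrite eq_le; apply/andP; split.
    exact: le_trans (tilt_ge x (- x)) (tilt_opp hs x).
  by have := sublinearN x hs; lra.
have sZ (t : R) x : 0 < t -> s (t%:C *: x) = t * s x.
  move=> tp; apply/eqP; rewrite eq_le hs.2 //=.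
  have ti : 0 < t^-1 by rewrite invr_gt0.
  have := hs.2 t^-1 (t%:C *: x) ti; rewrite scalerA -rmorphM /= mulVf ?gt_eqF //.
  by rewrite scale1r mulrC ler_pdivlMr // mulrC.
exists s; split.
- split=> [x y|t x].
    apply/eqP; rewrite eq_le hs.1 /=.
    by have := hs.1 (x + y) (- y); rewrite addrK sN; lra.
  have [tn|tp|->] := ltgtP t 0; last by rewrite scale0r mul0r (sublinear0 hs).
    rewrite -[t]opprK rmorphN /= scaleNr sN sZ ?oppr_gt0 //; ring.
  exact: sZ.
- by move=> x; apply: le_trans (sq0 x) _; exact: tilt_le.
- apply/eqP; rewrite eq_le (le_trans (sq0 x0) (tilt_le hq x0 x0)) /=.
  by have := le_trans (sq0 (- x0)) (tilt_opp hq x0); rewrite sN lerN2.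
Qed.

End HahnBanach.

(** * Weakly bounded sets *)

Section UniformBoundedness.
Context {R : realType} {X : lmodType R[i]} (p : seminorms X).

Lemma sn_sublinear a : sublinear (p a).
Proof.
split; first exact: sn_ler_add.
by move=> t x t0; rewrite sn_scale modulus_real gtr0_norm.
Qed.

(** The imaginary part of a complex-linear functional at [x] is forced to be minus
    its real part at ['i *: x]. *)
Lemma complexify (phi : X -> R) : real_linear phi ->
  exists y : {linear X -> R[i]}, forall x, y x = phi x +i* (- phi ('i *: x)).
Proof.
move=> [phiD phiZ]; pose y x := phi x +i* (- phi ('i *: x)).
have phiN x : phi (- x) = - phi x.
  by have := phiZ (-1) x; rewrite rmorphN rmorph1 scaleN1r mulN1r.
have lin : linear y.
  move=> [c d] u v.
  have E w : (c +i* d) *: w = c%:C *: w + d%:C *: ('i *: w).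
    by rewrite scalerA -scalerDl; congr (_ *: _); by_parts.
  have i2 w : 'i *: ('i *: w) = - w by rewrite scalerA -expr2 sqrCi scaleN1r.
  have iE : 'i *: (c%:C *: u + d%:C *: ('i *: u) + v) =
      c%:C *: ('i *: u) + d%:C *: (- u) + 'i *: v.
    rewrite !scalerDr; congr (_ + _ + _).
      by rewrite !scalerA mulrC.
    by rewrite -i2 !scalerA; congr (_ *: _); rewrite mulrCA mulrA.
  rewrite /y E iE !phiD !phiZ phiN.
  by apply/eqP; rewrite eq_complex /=; apply/andP; split; apply/eqP; ring.
pose Y : {linear X -> R[i]} :=
  HB.pack_for {linear X -> R[i]} y (GRing.isLinear.Build _ _ _ _ y lin).
by exists Y.
Qed.

Let five01 : 0 <= (5^-1 : R) < 1.
Proof. by rewrite invr_ge0 ler0n invf_lt1 // ltr1n. Qed.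

(** Weakly bounded sets are bounded, by a gliding hump: an unbounded sequence
    [x k] yields signs for which the sum of the [5 ^- k * phi k] with these signs
    is unbounded on it, where [phi k] norms [x k]. The sign makes the [k]-th
    partial sum at least [5 ^- k * p a (x k)] at [x k]; base 5 makes the tail at
    most a quarter of that. *)
Theorem weakly_bounded_bounded a (B : set X) :
  (forall y : {linear X -> R[i]}, (exists M : R, forall x, modulus (y x) <= M * p a x) ->
    exists C : R, forall x, B x -> modulus (y x) <= C) ->
  exists C : R, forall x, B x -> p a x <= C.
Proof.
move=> wB; apply: contrapT => unb.
have /choice[x xP] : forall k : nat, exists x, B x /\ 2 * k%:R * 5 ^+ k < p a x.
  move=> k; apply: contrapT => h; apply: unb; exists (2 * k%:R * 5 ^+ k) => x Bx.
  by rewrite leNgt; apply/negP => hx; apply: h; exists x.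
have /choice[phi phiP] : forall k : nat, exists phi,
    [/\ real_linear phi, forall z, phi z <= p a z & phi (x k) = p a (x k)].
  by move=> k; exact: hahn_banach (sn_sublinear a).
have phi_norm k z : `|phi k z| <= p a z.
  have [[_ phiZ] phip _] := phiP k; rewrite ler_norml phip andbT.
  have := phip (- z); rewrite snN; have := phiZ (-1) z.
  by rewrite rmorphN rmorph1 scaleN1r mulN1r => ->; lra.
(* the sign that does not cancel the value t *)
pose sg (t : R) : R := if 0 <= t then 1 else - 1.
pose S := fix S (n : nat) : X -> R := if n is k.+1 then
  (fun z => S k z + sg (S k (x k)) * 5^-1 ^+ k * phi k z) else (fun=> 0).
have sg1 t : `|sg t| = 1 by rewrite /sg; case: ifP; rewrite ?normrN normr1.
have five0 k : 0 <= 5^-1 ^+ k :> R by rewrite exprn_ge0 // invr_ge0.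
have step k z : `|S k.+1 z - S k z| <= p a z * 5^-1 ^+ k.
  rewrite /= addrAC subrr add0r !normrM sg1 mul1r ger0_norm // mulrC.
  by rewrite ler_wpM2r.
have /choice[Phi PhiP] : forall z, exists l, forall k,
    `|S k z - l| <= p a z * 5^-1 ^+ k / (1 - 5^-1).
  by move=> z; have [l hl] := geometric_cauchy five01 (step^~ z); exists l.
have S_lin k : real_linear (S k).
  elim: k => [|k [SD SZ]]; first by split=> *; rewrite /= ?addr0 ?mulr0.
  have [[phiD phiZ] _ _] := phiP k.
  by split=> [u v|t u]; rewrite /= ?SD ?SZ ?phiD ?phiZ; ring.
have small (M c : R) : (forall k, `|c| <= M * 5^-1 ^+ k) -> c = 0.
  move=> h; apply/eqP; rewrite -normr_le0; apply/ler_addgt0Pl => e e0.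
  have [n hn] := geometric_small M five01 e0.
  by rewrite addr0; exact: le_trans (h n) (ltW hn).
have Phi_lin : real_linear Phi.
  split=> [u v|t u].
    apply/eqP; rewrite -subr_eq0; apply/eqP.
    apply: (small ((p a (u + v) + p a u + p a v) / (1 - 5^-1))) => k.
    have -> : Phi (u + v) - (Phi u + Phi v) =
      - (S k (u + v) - Phi (u + v)) + (S k u - Phi u) + (S k v - Phi v).
      by rewrite (S_lin k).1; ring.
    apply: le_trans (ler_normD _ _) _; rewrite -lerBrDr.
    apply: le_trans (ler_normD _ _) _; rewrite normrN.
    by have := PhiP (u + v) k; have := PhiP u k; have := PhiP v k; lra.
  apply/eqP; rewrite -subr_eq0; apply/eqP.
  apply: (small ((p a (t%:C *: u) + `|t| * p a u) / (1 - 5^-1))) => k.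
  have -> : Phi (t%:C *: u) - t * Phi u =
    - (S k (t%:C *: u) - Phi (t%:C *: u)) + t * (S k u - Phi u).
    by rewrite (S_lin k).2; ring.
  apply: le_trans (ler_normD _ _) _; rewrite normrN normrM.
  have h1 := PhiP (t%:C *: u) k; have h2 := ler_wpM2l (normr_ge0 t) (PhiP u k).
  by apply: le_trans (lerD h1 h2) _; rewrite le_eqVlt; apply/orP; left; apply/eqP; ring.
have Phi_bound z : `|Phi z| <= 2 * p a z.
  have := PhiP z 0%N; rewrite /= sub0r normrN expr0 mulr1 => h.
  have d54 : (1 - 5^-1)^-1 = 5 / 4 :> R by field.
  by apply: le_trans h _; rewrite d54; have := sn_ge0 a z; lra.
have [y yE] := complexify Phi_lin.
have [|C hC] := wB y.
  exists 4 => z; rewrite yE; apply: le_trans (modulus_Complex _ _) _; rewrite normrN.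
  have := Phi_bound z; have := Phi_bound ('i *: z).
  by rewrite sn_scale modulus_i mul1r; lra.
have hump k : k%:R <= `|Phi (x k)|.
  have [Bx big] := xP k; have [_ _ phix] := phiP k.
  have h1 : 5^-1 ^+ k * p a (x k) <= `|S k.+1 (x k)|.
    rewrite /= phix /sg; have c0 : 0 <= 5^-1 ^+ k * p a (x k) by rewrite mulr_ge0 ?sn_ge0.
    by case: ifP => [s0|/negbT]; rewrite -?ltNge => *; rewrite ler_normr; lra.
  have h2 := PhiP (x k) k.+1; rewrite exprS in h2.
  have h3 := ler_normB (S k.+1 (x k) - Phi (x k)) (S k.+1 (x k)).
  rewrite (_ : _ - _ - _ = - Phi (x k)) ?normrN in h3; last by ring.
  have h4 : `|S k.+1 (x k)| <= `|S k.+1 (x k) - Phi (x k)| + `|Phi (x k)|.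
    by rewrite -{1}(subrK (Phi (x k)) (S k.+1 (x k))) ler_normD.
  have h5 : 2 * k%:R <= 5^-1 ^+ k * p a (x k).
    by rewrite exprVn [leRHS]mulrC ler_pdivlMr ?exprn_gt0 // ltW.
  have h6 : p a (x k) * (5^-1 * 5^-1 ^+ k) / (1 - 5^-1) = 5^-1 ^+ k * p a (x k) / 4.
    by field.
  have := ler0n R k; lra.
have [n /andP[_ hn]] : exists n : nat, 0 <= C + 1 < n%:R.
  have C0 : 0 <= C + 1.
    by have := hC _ (xP 0%N).1; have := modulus_ge0 (y (x 0%N)); lra.
  by exists (Num.truncn (C + 1)).+1; rewrite C0 /=; have /andP[] := truncn_itv C0.
have := hC _ (xP n).1; have := Re_le_modulus (y (x n)); rewrite yE /=.
by have := hump n; lra.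
Qed.

End UniformBoundedness.

(** * Continuation of vector-valued functions across the half-line *)

Section VectorExtension.
Context {R : realType} {X : lmodType R[i]} (p : seminorms X).
Implicit Types (z w : R[i]) (x : R).

Lemma off_axis_open z : @off_axis R z ->
  exists2 d : R, 0 < d & forall w, modulus (w - z) < d -> off_axis w.
Proof.
move=> /orP[zi|zr].
  exists `|complex.Im z|; rewrite ?normr_gt0 // => w wd; rewrite /off_axis.
  apply/orP; left; apply: contraTneq wd => w0; rewrite -leNgt.
  by apply: le_trans (Im_le_modulus _); rewrite ImB w0 sub0r normrN.
exists (- complex.Re z); first by rewrite oppr_gt0.
move=> w wd; rewrite /off_axis; apply/orP; right.
have := le_lt_trans (Re_le_modulus _) wd; rewrite ReB ltr_norml; lra.
Qed.

Lemma on_axis z : ~~ @off_axis R z -> 0 <= complex.Re z /\ z = (complex.Re z)%:C.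
Proof.
case: z => x y; rewrite /off_axis negb_or negbK -leNgt /= => /andP[/eqP -> x0].
by [].
Qed.

Lemma square_real_center x (r : R) : 0 <= r -> in_square (x%:C : R[i]) r x%:C.
Proof. by move=> r0; apply: modulus_in_square; rewrite subrr modulus0. Qed.

Context (u : R[i] -> X) (complete : sn_complete p).
Context (du : forall z, off_axis z -> exists l, sn_derivative p u z l).
Context (extension : forall (y : {linear X -> R[i]}) a (M : R),
  (forall v, modulus (y v) <= M * p a v) -> forall x, 0 <= x ->
  exists g : R[i] -> R[i],
    (forall z, in_square x%:C 4^-1 z -> holomorphic_at g z) /\
    (forall z, in_square x%:C 4^-1 z -> off_axis z -> g z = y (u z))).

Let quarter_gt0 : 0 < 4^-1 :> R.
Proof. by rewrite invr_gt0. Qed.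

Let half_quarter : 4^-1 / 2 = 8^-1 :> R.
Proof. by field. Qed.

(** Weak holomorphy bounds difference quotients weakly, hence in every
    seminorm. *)
Let locally_lipschitz x a : 0 <= x -> exists C : R, forall z1 z2,
  in_square x%:C 8^-1 z1 -> in_square x%:C 8^-1 z2 -> off_axis z1 -> off_axis z2 ->
  p a (u z1 - u z2) <= C * modulus (z1 - z2).
Proof.
move=> x0.
pose B := [set v : X | exists z1 z2, [/\ in_square x%:C 8^-1 z1, in_square x%:C 8^-1 z2,
  off_axis z1, off_axis z2 & z1 != z2 /\ v = (z1 - z2)^-1 *: (u z1 - u z2)]].
have [y [M yM]|C hC] := @weakly_bounded_bounded R X p a B.
  have [g [dg gE]] := extension yM x0.
  have [K K0 gK] := square_frame_bounded (ltW quarter_gt0) dg.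
  exists (64 * K / 4^-1) => v [z1 [z2 [i1 i2 o1 o2 [n12 ->]]]].
  have i4 z : in_square x%:C 8^-1 z -> in_square x%:C 4^-1 z.
    by apply: in_square_le; lra.
  have n0 : z1 - z2 != 0 by rewrite subr_eq0.
  rewrite linearZ /= raddfB /= -(gE _ (i4 _ i1) o1) -(gE _ (i4 _ i2) o2).
  rewrite [modulus _]modulusM modulusV mulrC ler_pdivrMr ?modulus_gt0 //.
  by apply: (difference_bound quarter_gt0 dg gK); rewrite half_quarter.
exists C => z1 z2 i1 i2 o1 o2; have [->|n12] := eqVneq z1 z2.
  by rewrite !subrr sn0 modulus0 mulr0.
have n0 : z1 - z2 != 0 by rewrite subr_eq0.
have /hC : B ((z1 - z2)^-1 *: (u z1 - u z2)) by exists z1, z2.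
by rewrite sn_scale modulusV mulrC ler_pdivrMr ?modulus_gt0.
Qed.

(** Boundary values are approached along vertical lines, at geometric heights. *)
Let height n : R := 2^-1 ^+ n / 16.

Let height_gt0 n : 0 < height n.
Proof. by rewrite /height divr_gt0 // exprn_gt0 // invr_gt0. Qed.

Let height_le n : height n <= 16^-1.
Proof.
rewrite /height ler_pdivrMr // mulVf ?pnatr_eq0 //.
by rewrite exprn_ile1 // ?invr_ge0 // invf_le1 // ler1n.
Qed.

Let above z n : R[i] := z + 'i * (height n)%:C.

Let aboveE z n : above z n = complex.Re z +i* (complex.Im z + height n).
Proof. by rewrite /above; case: z => a b; by_parts. Qed.

Let off_axis_above z n : ~~ off_axis z -> off_axis (above z n).
Proof.
move=> /on_axis[_ ->]; rewrite aboveE /off_axis /= add0r.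
by rewrite gt_eqF // height_gt0.
Qed.

Let modulus_above z n : modulus (above z n - z) = height n.
Proof.
by rewrite /above addrAC subrr add0r modulusiM modulus_real gtr0_norm.
Qed.

Let in_square_above x z n (r : R) : in_square x%:C r z -> r <= 8^-1 ->
  in_square x%:C 4^-1 (above z n).
Proof.
rewrite !in_squareE aboveE /= => /andP[/andP[h1 h2] /andP[h3 h4]] r8.
have := height_gt0 n; have := height_le n; move=> k1 k2.
by rewrite /in_rect /=; apply/andP; split; lra.
Qed.

Let boundary_value z : ~~ off_axis z ->
  exists l, sn_lim p (fun n => u (above z n)) l.
Proof.
move=> hz; have [x0 zE] := on_axis hz; apply: complete => a.
have [C hC] := locally_lipschitz a x0; exists `|C| => n.
have sq k : in_square (complex.Re z)%:C 8^-1 (above z k).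
  apply: modulus_in_square; rewrite -zE modulus_above.
  by apply: le_trans (height_le k) _; lra.
apply: le_trans (hC _ _ (sq _) (sq _) (off_axis_above _ hz) (off_axis_above _ hz)) _.
apply: (@le_trans _ _ (`|C| * modulus (above z n.+1 - above z n))).
  by rewrite ler_wpM2r ?modulus_ge0 // ler_norm.
rewrite ler_wpM2l //; apply: le_trans (modulus_triangle z _ _) _.
rewrite modulus_above (modulus_distC z) modulus_above /height exprS.
by have := exprn_ge0 n (_ : 0 <= 2^-1 :> R); rewrite invr_ge0 ler0n => /(_ isT); lra.
Qed.

(** On the half-line [v] is the limit of [u] from above, so every functional of
    [v] is the scalar continuation of that functional of [u]. Its divided
    differences are therefore weakly bounded, hence bounded, and [v] is
    differentiable. *)
Theorem entire_extension : exists v : R[i] -> X,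
  (forall z, exists l, sn_derivative p v z l) /\ (forall z, off_axis z -> v z = u z).
Proof.
have /choice[v vP] : forall z, exists l, (off_axis z -> l = u z) /\
    (~~ off_axis z -> sn_lim p (fun n => u (above z n)) l).
  move=> z; case: (boolP (off_axis z)) => hz; first by exists (u z).
  by have [l hl] := boundary_value hz; exists l.
have vu z : off_axis z -> v z = u z by move=> hz; apply: (vP z).1.
exists v; split=> // z; case: (boolP (off_axis z)) => hz.
  have [d d0 hd] := off_axis_open hz; have [l hl] := du hz; exists l.
  by apply: sn_derivative_near d0 _ hl => w /hd /vu ->.
have [] := on_axis hz; move: (complex.Re z) => x x0 -> {z hz}.
have yv (y : {linear X -> R[i]}) a M g : (forall v, modulus (y v) <= M * p a v) ->
    (forall z, in_square x%:C 4^-1 z -> holomorphic_at g z) ->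
    (forall z, in_square x%:C 4^-1 z -> off_axis z -> g z = y (u z)) ->
    forall z, in_square x%:C 8^-1 z -> y (v z) = g z.
  move=> yM dg gE z zx.
  have z4 : in_square x%:C 4^-1 z by apply: in_square_le zx; lra.
  case: (boolP (off_axis z)) => hz; first by rewrite vu // gE.
  apply/eqP; rewrite -subr_eq0; apply/eqP; apply: modulus_le0 => e e0.
  have M1 : 0 < `|M| + 1 by rewrite ltr_wpDl.
  have e2 : 0 < e / 2 by rewrite divr_gt0.
  have [n1 h1] := (vP z).2 hz a (e / 2 / (`|M| + 1)) (divr_gt0 e2 M1).
  have [d d0 hd] := holomorphic_continuous (dg z z4) e2.
  have half01 : 0 <= (2^-1 : R) < 1 by rewrite invr_ge0 ler0n invf_lt1 // ltr1n.
  have [n2 h2] := geometric_small 16^-1 half01 d0.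
  pose n := maxn n1 n2.
  have hn : height n < d.
    apply: le_lt_trans h2; rewrite /height mulrC ler_wpM2l ?invr_ge0 //.
    by apply: ler_wiXn2l; rewrite ?invr_ge0 ?invf_le1 ?ler1n // leq_maxr.
  have k1 := h1 n (leq_maxl _ _).
  have k2 : modulus (g (above z n) - g z) < e / 2 by apply: hd; rewrite modulus_above.
  rewrite gE in k2; last 2 first.
  - exact: in_square_above zx _.
  - exact: off_axis_above.
  apply: le_trans (modulus_triangle (y (u (above z n))) _ _) _.
  rewrite [leRHS]splitr lerD ?(ltW k2) //.
  rewrite -raddfB /=; apply: le_trans (yM _) _; rewrite sn_distC.
  apply: (@le_trans _ _ ((`|M| + 1) * p a (u (above z n) - v z))).
    by rewrite ler_wpM2r ?sn_ge0 // ler_wpDr // ler_norm.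
  by rewrite mulrC -ler_pdivlMr.
apply: (sn_derivative_of_lipschitz (r := 8^-1) complete); first by rewrite invr_gt0.
move=> a; pose B := [set t : X | exists z1 z3, [/\ in_square x%:C 8^-1 z1,
  in_square x%:C 8^-1 z3, z1 != x%:C, z3 != x%:C & z1 != z3 /\
  t = (z1 - z3)^-1 *: (difference_quotient v x%:C z1 - difference_quotient v x%:C z3)]].
have [y [M yM]|C hC] := @weakly_bounded_bounded R X p a B.
  have [g [dg gE]] := extension yM x0.
  have [K K0 gK] := square_frame_bounded (ltW quarter_gt0) dg.
  have ic : in_square (x%:C : R[i]) 8^-1 x%:C by apply: square_real_center; rewrite invr_ge0.
  exists (128 * K / 4^-1 ^+ 2) => t [z1 [z3 [i1 i3 n1 n3 [n13 ->]]]].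
  have n0 : z1 - z3 != 0 by rewrite subr_eq0.
  have yq z : in_square x%:C 8^-1 z ->
      y (difference_quotient v x%:C z) = (z - x%:C)^-1 * (g z - g x%:C).
    by move=> hz; rewrite /difference_quotient linearZ /= raddfB /= !(yv y a M g yM dg gE).
  rewrite linearZ /= raddfB /= !yq //.
  rewrite [modulus _]modulusM modulusV mulrC ler_pdivrMr ?modulus_gt0 //.
  have dd := divided_difference_bound (z1 := z1) (z2 := x%:C) (z3 := z3)
    quarter_gt0 dg gK.
  rewrite half_quarter in dd; exact: dd.
exists C => z1 z3 m1 m3 n1 n3; have [->|n13] := eqVneq z1 z3.
  by rewrite !subrr sn0 modulus0 mulr0.
have n0 : z1 - z3 != 0 by rewrite subr_eq0.
have /hC : B ((z1 - z3)^-1 *: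
    (difference_quotient v x%:C z1 - difference_quotient v x%:C z3)).
  by exists z1, z3; split=> //; apply: modulus_in_square; exact: ltW.
by rewrite sn_scale modulusV mulrC ler_pdivrMr ?modulus_gt0.
Qed.

End VectorExtension.

(** * Seminorms and topology *)

Section Topology.
Context {R : realType}.

Section Derivatives.
Context {T : tvsType R[i]} (q : seminorms T).
Implicit Types (f g : R[i] -> T) (z : R[i]).

Lemma complex_derivable_sn f z :
  (forall l a (e : R), 0 < e -> nbhs l [set y | q a (y - l) < e]) ->
  complex_derivable f z -> sn_derivative q f z (complex_derive f z).
Proof.
move=> qnbhs dfz a e e0.
have /(_ _ (qnbhs _ a e e0)) : complex_quotient f z h @[h --> (0 : R[i])^'] -->
    complex_derive f z by exact: (xgetPex 0 dfz).
move=> /nbhs_modulusP[d d0 hd]; exists d => // w wd.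
have [->|wz] := eqVneq w z; first by rewrite !subrr scale0r subrr sn0 modulus0 mulr0.
have wz0 : w - z != 0 by rewrite subr_eq0.
have := hd (w - z); rewrite subr0 => /(_ wd wz0) /=.
rewrite /complex_quotient subrKC => h.
have -> : f w - f z - (w - z) *: complex_derive f z =
    (w - z) *: ((w - z)^-1 *: (f w - f z) - complex_derive f z).
  by rewrite scalerBr scalerA divff // scale1r.
by rewrite sn_scale mulrC ler_wpM2r ?modulus_ge0 // ltW.
Qed.

Lemma sn_complex_derivable f z l :
  (forall U : set T, nbhs l U -> exists a, exists2 e : R, 0 < e &
     [set y | q a (y - l) < e] `<=` U) ->
  sn_derivative q f z l -> complex_derivable f z.
Proof.
move=> qbasis dfz; exists l => U /qbasis[a [e e0 eU]].
have e20 : 0 < e / 2 by rewrite divr_gt0.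
have [d d0 hd] := dfz a _ e20; apply/nbhs_modulusP; exists d => // h.
rewrite subr0 => hh h0; apply: eU => /=.
have -> : complex_quotient f z h - l = h^-1 *: (f (z + h) - f z - h *: l).
  by rewrite scalerBr scalerA mulVf // scale1r.
rewrite sn_scale modulusV mulrC ltr_pdivrMr ?modulus_gt0 //.
have zh : z + h - z = h by rewrite addrC addKr.
have := hd (z + h); rewrite zh => /(_ hh) k.
apply: le_lt_trans k _; rewrite ltr_pM2r ?modulus_gt0 //; lra.
Qed.

Lemma sn_derivativeD f g z l m : sn_derivative q f z l -> sn_derivative q g z m ->
  sn_derivative q (fun w => f w + g w) z (l + m).
Proof.
move=> df dg a e e0; have e20 : 0 < e / 2 by rewrite divr_gt0.
have [d1 d10 h1] := df a _ e20; have [d2 d20 h2] := dg a _ e20.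
exists (Num.min d1 d2); first by rewrite lt_min d10.
move=> w; rewrite lt_min => /andP[/h1 k1 /h2 k2].
have -> : f w + g w - (f z + g z) - (w - z) *: (l + m) =
   (f w - f z - (w - z) *: l) + (g w - g z - (w - z) *: m).
  by rewrite scalerDr !opprD [RHS]addrACA; congr (_ + _); rewrite addrACA.
apply: le_trans (sn_ler_add _ _ _) _.
by apply: le_trans (lerD k1 k2) _; rewrite -mulrDl -splitr.
Qed.

Lemma sn_derivativeN f z l : sn_derivative q f z l ->
  sn_derivative q (fun w => - f w) z (- l).
Proof.
move=> df a e /(df a)[d d0 hd]; exists d => // w /hd.
by rewrite scalerN -!opprD snN.
Qed.

Lemma sn_derivative_cst c z : sn_derivative q (fun=> c) z 0.
Proof.
move=> a e e0; exists 1 => // w _.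
by rewrite subrr scaler0 subrr sn0 mulr_ge0 ?modulus_ge0 // ltW.
Qed.

End Derivatives.

Lemma generates_nbhs (E : tvsType R[i]) (p : seminorms E) (l : E) a (e : R) :
  generates_topology p -> 0 < e -> nbhs l [set y | p a (y - l) < e].
Proof.
move=> gp e0; have /(nbhsT l) : nbhs (0 : E) [set x | p a x < e].
  by apply/gp; exists a, e.
by apply: filterS => _ [x /= xe <-]; rewrite addrAC subrr add0r.
Qed.

Section Bounded.
Context {V : lmodType R[i]} (q : seminorms V).

Lemma seminormed_ball (l : seminormed_space q) a (e : R) :
  0 < e -> nbhs l [set y | q a (y - l) < e].
Proof. by move=> e0; apply/sn_nbhsE; exists a, e. Qed.

Lemma bounded_continuous (y : seminormed_space q -> R[i]) a (M : R) :
  (forall v w, y (v - w) = y v - y w) ->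
  (forall v, modulus (y v) <= M * q a v) -> continuous y.
Proof.
move=> yB yM v.
apply/(@cvg_modulusP _ _ (nbhs v) (nbhs_filter v) y (y v)) => e e0.
have M1 : 0 < `|M| + 1 by rewrite ltr_wpDl.
have := @seminormed_ball v a (e / (`|M| + 1)) (divr_gt0 e0 M1).
apply: filterS => w /= wv; rewrite -yB; apply: le_lt_trans (yM _) _.
apply: (@le_lt_trans _ _ ((`|M| + 1) * q a (w - v))).
  by rewrite ler_wpM2r ?sn_ge0 // ler_wpDr // ler_norm.
by rewrite mulrC -ltr_pdivlMr.
Qed.

End Bounded.

Section GraphSpaceComplete.
Context (E : tvsType R[i]) (p : seminorms E).
Context (D : pred E) (F : subLmodType D) (A : {linear F -> E}).
Context (gp : generates_topology p) (completeE : sequentially_complete E).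

(** Geometric increments make the sequence Cauchy for the additive group. *)
Let fast_cvg (s : nat -> E) :
  (forall a, exists C : R, forall n, p a (s n.+1 - s n) <= C * 2^-1 ^+ n) ->
  exists l : E, s @ \oo --> l.
Proof.
move=> hs; apply: completeE => U /gp[a [e e0 eU]].
have [C hC] := hs a.
have C0 : 0 <= C by have := hC 0%N; rewrite expr0 mulr1; apply: le_trans; exact: sn_ge0.
have tail n k : p a (s (n + k)%N - s n) <= 2 * C * (2^-1 ^+ n - 2^-1 ^+ (n + k)).
  elim: k => [|k IH]; first by rewrite addn0 !subrr sn0 mulr0.
  rewrite addnS; apply: le_trans (sn_triangle a _ (s (n + k)%N) _) _.
  by apply: le_trans (lerD (hC _) IH) _; rewrite exprS; lra.
have tail' n m : (n <= m)%N -> p a (s m - s n) <= 2 * C * 2^-1 ^+ n.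
  move=> nm; have := tail n (m - n)%N; rewrite subnKC //; move/le_trans; apply.
  rewrite ler_wpM2l ?mulr_ge0 // gerBl exprn_ge0 // invr_ge0 //.
have half01 : 0 <= (2^-1 : R) < 1 by rewrite invr_ge0 ler0n invf_lt1 // ltr1n.
have e20 : 0 < e / 2 by rewrite divr_gt0.
have [N hN] := geometric_small (2 * C) half01 e20.
exists ([set n | (N <= n)%N], [set n | (N <= n)%N]); first by split; exists N.
move=> [m n] [/= Nm Nn]; apply: eU => /=.
apply: le_lt_trans (sn_triangle a _ (s N) _) _; rewrite (sn_distC a (s N)) [ltRHS]splitr.
by rewrite ltrD // (le_lt_trans _ hN) // tail'.
Qed.

Lemma cvg_sn_lim (s : nat -> E) (l : E) : s @ \oo --> l -> sn_lim p s l.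
Proof.
move=> sl a e e0; have /sl[N _ hN] := generates_nbhs l a gp e0.
by exists N => n Nn; apply: ltW; exact: hN.
Qed.

(** Convergence in the graph seminorms is convergence of [val (s n)] and of
    [A (s n)]; closedness of [A] puts the limits together. *)
Lemma graph_space_complete : sequentially_closed A ->
  sn_complete (graph_seminorms p A : seminorms (graph_space p A)).
Proof.
move=> closedA s hs.
have [a | x hx] := @fast_cvg (fun n => val (s n : F)).
  have [C hC] := hs a; exists C => n; apply: le_trans (hC n).
  by rewrite -raddfB /= /graph_sn lerDl sn_ge0.
have [a | y hy] := @fast_cvg (fun n => A (s n)).
  have [C hC] := hs a; exists C => n; apply: le_trans (hC n).
  by rewrite -raddfB /= /graph_sn lerDr sn_ge0.
have [w wx wy] := closedA _ _ _ hx hy; exists (w : graph_space p A) => a e e0.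
have e20 : 0 < e / 2 by rewrite divr_gt0.
have [n1 h1] := cvg_sn_lim hx a e20.
have [n2 h2] := cvg_sn_lim hy a e20.
exists (maxn n1 n2) => n; rewrite geq_max => /andP[/h1 k1 /h2 k2].
by rewrite /= /graph_sn !raddfB /= wx wy [leRHS]splitr lerD.
Qed.

Lemma graph_derivative (u : R[i] -> graph_space p A) z l :
  sn_derivative (graph_seminorms p A : seminorms (graph_space p A)) u z l ->
  sn_derivative p (fun w => val (u w : F)) z (val (l : F)).
Proof.
move=> du a e /(du a)[d d0 hd]; exists d => // w /hd; apply: le_trans.
rewrite /= /graph_sn (_ : val _ - _ - _ = val (u w - u z - (w - z) *: l : F)).
  by rewrite lerDl sn_ge0.
have vB (x y : F) : val (x - y) = val x - val y :> E by rewrite raddfB.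
have vZ c (x : F) : val (c *: x) = c *: val x :> E by rewrite linearZ.
by rewrite !vB vZ.
Qed.

Lemma graph_complex_derivable (f : R[i] -> graph_space p A) z l :
  sn_derivative (graph_seminorms p A : seminorms (graph_space p A)) f z l ->
  complex_derivable f z.
Proof. by apply: sn_complex_derivable => U /sn_nbhsE. Qed.

Lemma graph_sn_derivative (f : R[i] -> graph_space p A) z :
  complex_derivable f z ->
  sn_derivative (graph_seminorms p A : seminorms (graph_space p A)) f z
    (complex_derive f z).
Proof. by apply: complex_derivable_sn => l a e; exact: seminormed_ball. Qed.

Lemma hausdorff_sn_eq0 (x : E) : hausdorff_space E -> (forall a, p a x = 0) -> x = 0.
Proof.
move=> hE px; apply/esym; apply: hE => U V /gp[a [e e0 eU]] Vx.
exists x; split; last exact: nbhs_singleton.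
by apply: eU; rewrite /= px.
Qed.

End GraphSpaceComplete.
End Topology.

(** * Decay of the truncated Laplace transform *)

Section Decay.
Context {R : realType} (E : tvsType R[i]) (p : seminorms E).
Context (D : pred E) (F : subLmodType D) (A : {linear F -> E}).
Local Notation F_A := (graph_space p A).
Local Notation q := (graph_seminorms p A : seminorms F_A).
Context (u du : R[i] -> F_A) (g : R[i] -> E).
Context (u_deriv : forall z, off_axis z -> sn_derivative q u z (du z)).
Context (g_deriv : forall z, exists l, sn_derivative p g z l).
Context (equation : forall z, off_axis z -> val (du z : F) - A (u z) = g z).

Let path_off_axis (a : R) (z : R[i]) : u_path (- 1) a z -> off_axis z.
Proof. by apply: u_path_off_axis; rewrite oppr_lt0. Qed.

Let modulus_cexp_real (t : R) (z : R[i]) : modulus (cexp (- t%:C * z)) =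
  expR (- (t * complex.Re z)).
Proof. by rewrite modulus_cexp; case: z => a b /=; congr expR; ring. Qed.

(** Inserting [y = (t - A^t) yt - s] and [A u = u' - g] shows that
    [y (u w) exp (- t w)] is minus the derivative of [yt (u w) exp (- t w)], plus
    [yt (g w) exp (- t w)], minus [s (u w) exp (- t w)]. The derivative leaves
    endpoint values at [Re w = a]; the second term is holomorphic across the
    half-line, so its integral moves to the segment [Re w = a]; the third is
    small because [s] is. *)
Lemma u_integral_resolvent_bound (y s : {linear F_A -> R[i]})
    (yt : {linear E -> R[i]}) b (M t a Cy Cs Q G : R) al :
  0 <= t -> -1 <= a -> 0 <= Cs ->
  (forall v, modulus (y v) <= M * q b v) ->
  (forall x, modulus (yt x) <= Cy * p al x) ->
  (forall v, modulus (s v) <= Cs * q al v) ->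
  (forall v : F, yt (t%:C *: val v - A v) = y v + s v) ->
  (forall z, u_path (- 1) a z -> q al (u z) <= Q) ->
  (forall r : R, - 2^-1 <= r <= 2^-1 -> p al (g (a +i* r)) <= G) ->
  0 <= Cy ->
  modulus (u_integral (fun w => y (u w) * cexp (- t%:C * w)) (- 1) a) <=
    2 * (Cy * Q * expR (- (t * a))) + 2 * (Cy * G * expR (- (t * a))) +
    2 * (Cs * Q * expR t) * (2 * (a - -1) + 1).
Proof.
move=> t0 a1 Cs0 yM ytM sM res uQ gG Cy0.
pose e w := cexp (- t%:C * w).
have de z : cderiv e z (- t%:C * e z) by exact: cderiv_cexp_scale.
have ce z : continuous_pt e z by exact: cderiv_continuous (de z).
have dy z : off_axis z -> cderiv (fun w => y (u w)) z (y (du z)).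
  by move=> hz; exact: cderiv_functional yM (u_deriv hz).
have ds z : off_axis z -> cderiv (fun w => s (u w)) z (s (du z)).
  by move=> hz; exact: cderiv_functional sM (u_deriv hz).
have dP z : off_axis z -> cderiv (fun w => yt (val (u w : F))) z (yt (val (du z : F))).
  by move=> hz; exact: cderiv_functional ytM (graph_derivative (u_deriv hz)).
have dG z : holomorphic_at (fun w => yt (g w)) z.
  by have [l gl] := g_deriv z; exists (yt l); exact: cderiv_functional ytM gl.
have split z : off_axis z -> y (u z) =
    - (yt (val (du z : F)) + - t%:C * yt (val (u z : F))) + (yt (g z) - s (u z)).
  move=> hz; have := res (u z); rewrite raddfB /= linearZ /=.
  have -> : A (u z) = val (du z : F) - g z by rewrite -(equation hz) subKr.
  rewrite raddfB /= => h.
  have -> : y (u z) = y (u z) + s (u z) - s (u z) by rewrite addrK.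
  rewrite -h; set v := t%:C *: _; have -> : v = t%:C * yt (val (u z : F)) by [].
  ring.
pose d w := yt (val (du w : F)) + - t%:C * yt (val (u w : F)).
have cy z : u_path (- 1) a z -> continuous_pt (fun w => y (u w)) z.
  by move=> /path_off_axis hz; exact: cderiv_continuous (dy z hz).
have cs z : u_path (- 1) a z -> continuous_pt (fun w => s (u w)) z.
  by move=> /path_off_axis hz; exact: cderiv_continuous (ds z hz).
have cG z : continuous_pt (fun w => yt (g w)) z by exact: holomorphic_continuous.
have cd z : u_path (- 1) a z -> continuous_pt d z.
  move=> hz; have [r r0 hr] := off_axis_open (path_off_axis hz).
  apply: (@continuous_pt_near _ (fun w => (yt (g w) - s (u w)) - y (u w)) d z r r0).
    by move=> w /hr hw; rewrite (split w hw) /d; ring.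
  by apply: continuous_ptB; [apply: continuous_ptB; [exact: cG|exact: cs] | exact: cy].
have cde z : u_path (- 1) a z -> continuous_pt (fun w => - 1 * (d w * e w)) z.
  move=> hz; apply: continuous_ptM; first exact: continuous_pt_cst.
  by apply: continuous_ptM; [exact: cd | exact: ce].
have cde' z : u_path (- 1) a z -> continuous_pt (fun w => d w * e w) z.
  by move=> hz; apply: continuous_ptM; [exact: cd | exact: ce].
have cGe z : u_path (- 1) a z -> continuous_pt (fun w => yt (g w) * e w) z.
  by move=> hz; apply: continuous_ptM; [exact: cG | exact: ce].
have cse z : u_path (- 1) a z -> continuous_pt (fun w => - 1 * (s (u w) * e w)) z.
  move=> hz; apply: continuous_ptM; first exact: continuous_pt_cst.
  by apply: continuous_ptM; [exact: cs | exact: ce].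
have cse' z : u_path (- 1) a z -> continuous_pt (fun w => s (u w) * e w) z.
  by move=> hz; apply: continuous_ptM; [exact: cs | exact: ce].
have -> : u_integral (fun w => y (u w) * cexp (- t%:C * w)) (- 1) a =
    (- 1 * u_integral (fun w => d w * e w) (- 1) a +
     u_integral (fun w => yt (g w) * e w) (- 1) a) +
    - 1 * u_integral (fun w => s (u w) * e w) (- 1) a.
  rewrite -(u_integralZ (- 1) cde') -(u_integralZ (- 1) cse').
  rewrite -(u_integralD cde cGe) -u_integralD //; last first.
    by move=> z hz; apply: continuous_ptD; [exact: cde | exact: cGe].
  apply: eq_u_integral => z /path_off_axis hz; rewrite (split z hz) /d /e; ring.
have endpoint r : - 2^-1 = r \/ 2^-1 = r ->
    modulus (yt (val (u (a +i* r) : F)) * e (a +i* r)) <= Cy * Q * expR (- (t * a)).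
  move=> hr; rewrite modulusM modulus_cexp_real /= ler_wpM2r ?expR_ge0 //.
  apply: le_trans (ytM _) _; rewrite ler_wpM2l //.
  apply: le_trans (uQ (a +i* r) _); first by rewrite /= /graph_sn lerDl sn_ge0.
  by right; split; [case: hr => <-; [left | right] | rewrite /= a1 lexx].
have part1 : modulus (- 1 * u_integral (fun w => d w * e w) (- 1) a) <=
    2 * (Cy * Q * expR (- (t * a))).
  rewrite mulN1r modulusN.
  rewrite (@u_integral_primitive _ _ _ a1 (fun w => yt (val (u w : F)) * e w)) //.
    apply: le_trans (modulus_le_sub _ _) _.
    by rewrite mulr_natl mulr2n lerD // endpoint //; [right | left].
  move=> z /path_off_axis hz; have := cderivM (dP z hz) (de z).
  by rewrite /d (_ : _ + _ = (yt (val (du z : F)) + - t%:C * yt (val (u z : F))) * e z) //;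
    ring.
have part2 : modulus (u_integral (fun w => yt (g w) * e w) (- 1) a) <=
    2 * (Cy * G * expR (- (t * a))).
  rewrite u_integral_entire //; last first.
    by move=> z _; apply: holomorphicM; [exact: dG | exists (- t%:C * e z)].
  have -> : 2 * (Cy * G * expR (- (t * a))) =
    2 * (Cy * G * expR (- (t * a))) * (2^-1 - - 2^-1) by field.
  apply: ver_integral_bound; first by rewrite (@le_trans _ _ 0) ?oppr_le0 ?invr_ge0 ?ler0n.
    by move=> r _; apply: continuous_ptM; [exact: cG | exact: ce].
  move=> r hr; rewrite modulusM modulus_cexp_real /= ler_wpM2r ?expR_ge0 //.
  by apply: le_trans (ytM _) _; rewrite ler_wpM2l // gG.
have part3 : modulus (- 1 * u_integral (fun w => s (u w) * e w) (- 1) a) <=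
    2 * (Cs * Q * expR t) * (2 * (a - -1) + 1).
  rewrite mulN1r modulusN; apply: u_integral_bound => // z hz.
  rewrite modulusM modulus_cexp_real; apply: ler_pM; rewrite ?modulus_ge0 ?expR_ge0 //.
    by apply: le_trans (sM _) _; rewrite ler_wpM2l // uQ.
  rewrite ler_expR -mulrN -[leRHS]mulr1 ler_wpM2l //.
  by case: hz => [[-> _]|[_ /andP[h _]]]; rewrite ?opprK // lerNl.
apply: le_trans (modulus_le_add _ _) _; rewrite lerD //.
by apply: le_trans (modulus_le_add _ _) _; rewrite lerD.
Qed.

(** The truncation point [a = k + n] absorbs the growth [exp (k t)] of [yt]; the
    rate [n + 1] for [s] absorbs the factor [exp t] from the left side
    [Re w = - 1] of the contour. *)
Lemma u_integral_decay (y : {linear F_A -> R[i]}) b (M : R) :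
  (forall v, modulus (y v) <= M * q b v) ->
  (forall n : nat, (0 < n)%N ->
     exists (k : nat) (al : sn_index p) (C1 t0 : R), 0 < C1 /\
       forall t : R, t0 <= t ->
         exists (yt : {linear E -> R[i]}) (s : {linear F_A -> R[i]}),
           forall (x : E) (z : F),
             [/\ yt (t%:C *: val z - A z) = y z + s z,
                 modulus (yt x) <= C1 * p al x * expR (k%:R * t) &
                 modulus (s z) <=
                   C1 * (p al (val z) + p al (A z)) * expR (- (n%:R * t))]) ->
  forall n : nat, exists a C : R, n%:R <= a /\ forall j : nat,
    modulus (u_integral (fun w => y (u w) * cexp (- j%:R * w)) (- 1) a) <=
      C * expR (- (n%:R * j%:R)).
Proof.
move=> yM resolvent n; have [k [al [C1 [t0 [C10 res]]]]] := resolvent n.+1 isT.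
pose a : R := (k + n)%:R.
have a1 : - 1 <= a by have := ler0n R (k + n); rewrite /a; lra.
have [Q Q0 uQ] : exists2 Q : R, 0 < Q & forall z, u_path (- 1) a z -> q al (u z) <= Q.
  have cq z : u_path (- 1) a z -> continuous_pt (fun w => (q al (u w))%:C) z.
    by move=> /path_off_axis hz; exact: sn_derivative_continuous (u_deriv hz).
  have [Q Q0 hQ] := continuous_u_bounded a1 cq; exists Q => // z /hQ.
  by rewrite modulus_real ger0_norm // sn_ge0.
have [G G0 gG] : exists2 G : R, 0 < G & forall r : R, - 2^-1 <= r <= 2^-1 ->
    p al (g (a +i* r)) <= G.
  have cg z : continuous_pt (fun w => (p al (g w))%:C) z.
    by have [l gl] := g_deriv z; exact: sn_derivative_continuous gl.
  have half : - 2^-1 <= 2^-1 :> R by lra.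
  have [G G0 hG] := continuous_path_bounded half
    (@continuous_vpath _ _ a (- 2^-1) 2^-1 (fun r _ => cg (a +i* r))).
  exists G => // r /hG; rewrite modulusiM modulus_real ger0_norm //.
  exact: sn_ge0.
pose I j := u_integral (fun w => y (u w) * cexp (- j%:R * w)) (- 1) a.
pose K := 2 * (C1 * Q) + 2 * (C1 * G) + 2 * (C1 * Q) * (2 * (a - -1) + 1).
have K0 : 0 <= K.
  by rewrite /K !addr_ge0 ?mulr_ge0 ?(ltW C10) ?(ltW Q0) ?(ltW G0) //; lra.
have large (j : nat) : t0 <= j%:R -> modulus (I j) <= K * expR (- (n%:R * j%:R)).
  move=> /res[yt [s hyp]].
  pose Cy := C1 * expR (k%:R * j%:R); pose Cs := C1 * expR (- (n.+1%:R * j%:R)).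
  have Cy0 : 0 <= Cy by rewrite mulr_ge0 ?expR_ge0 // ltW.
  have Cs0 : 0 <= Cs by rewrite mulr_ge0 ?expR_ge0 // ltW.
  have ytM x : modulus (yt x) <= Cy * p al x.
    by have [_ h _] := hyp x 0; apply: le_trans h _; rewrite /Cy mulrAC.
  have sM v : modulus (s v) <= Cs * q al v.
    by have [_ _ h] := hyp 0 v; apply: le_trans h _; rewrite /Cs mulrAC.
  have r v : yt (j%:R%:C *: val (v : F) - A v) = y v + s v by have [] := hyp 0 v.
  have := u_integral_resolvent_bound (ler0n R j) a1 Cs0 yM ytM sM r uQ gG Cy0.
  rewrite rmorph_nat => /le_trans; apply.
  have EQ (c : R) : Cy * c * expR (- (j%:R * a)) = C1 * c * expR (- (n%:R * j%:R)).
    transitivity (C1 * c * (expR (k%:R * j%:R) * expR (- (j%:R * a)))).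
      by rewrite /Cy; ring.
    by rewrite -expRD /a natrD; congr (_ * expR _); ring.
  have ES (c : R) : Cs * c * expR j%:R = C1 * c * expR (- (n%:R * j%:R)).
    transitivity (C1 * c * (expR (- (n.+1%:R * j%:R)) * expR j%:R)).
      by rewrite /Cs; ring.
    by rewrite -expRD -natr1; congr (_ * expR _); ring.
  by rewrite !EQ ES /K le_eqVlt; apply/orP; left; apply/eqP; ring.
have [j0 hj0] : exists j0 : nat, t0 <= j0%:R.
  have := truncn_itv (normr_ge0 t0) => /andP[_ h].
  by exists (Num.truncn `|t0|).+1; apply: le_trans (ler_norm _) (ltW h).
exists a, (K + \sum_(i < j0) modulus (I i) * expR (n%:R * i%:R)).
split; first by rewrite /a ler_nat leq_addl.
have sum_ge0 (P : pred 'I_j0) :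
    0 <= \sum_(i < j0 | P i) modulus (I i) * expR (n%:R * i%:R).
  by apply: sumr_ge0 => i _; rewrite mulr_ge0 ?modulus_ge0 ?expR_ge0.
move=> j; rewrite -/(I j); have [jj|jj] := ltnP j j0; last first.
  have := large j (le_trans hj0 _); rewrite ler_nat => /(_ jj)/le_trans; apply.
  by rewrite ler_wpM2r ?expR_ge0 // lerDl sum_ge0.
apply: (@le_trans _ _ (modulus (I j) * expR (n%:R * j%:R) * expR (- (n%:R * j%:R)))).
  by rewrite -mulrA -expRD subrr expR0 mulr1.
rewrite ler_wpM2r ?expR_ge0 // (bigD1 (Ordinal jj)) //= addrCA lerDl.
by rewrite addr_ge0 // sum_ge0.
Qed.

End Decay.

(** * The uniqueness property *)

Theorem theorem3p4 (R : realType) (E : tvsType R[i]) (p : seminorms E)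
    (D : pred E) (F : subLmodType D) (A : {linear F -> E}) :
  hausdorff_space E -> generates_topology p -> sequentially_complete E ->
  admissible p -> sequentially_closed A ->
  admissible (graph_seminorms p A : seminorms (graph_space p A)) ->
  (forall (y : {linear graph_space p A -> R[i]}) (n : nat),
     continuous y -> (0 < n)%N ->
     exists (k : nat) (a : sn_index p) (C1 t0 : R),
       [/\ (0 < k)%N, 0 < C1, 0 < t0 &
       forall t : R, t0 <= t ->
         exists (yt : {linear E -> R[i]}) (s : {linear graph_space p A -> R[i]}),
           [/\ continuous yt, continuous s &
           forall (x : E) (z : F),
             [/\ yt (t%:C *: val z - A z) = y z + s z,
                 modulus (yt x) <= C1 * p a x * expR (k%:R * t) &
                 modulus (s z) <=
                   C1 * (p a (val z) + p a (A z)) * expR (- (n%:R * t))]]]) ->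
  uniqueness_property p A.
Proof.
move=> hausE gp completeE _ closedA _ resolvent.
have basisE (U : set E) : nbhs (0 : E) U -> exists a, exists2 e : R, 0 < e &
    [set y | p a (y - 0) < e] `<=` U.
  move=> /gp[a [e e0 eU]]; exists a, e => // y /=; rewrite subr0; exact: eU.
have self (f : R[i] -> E) : hyperfunction f f.
  exists (fun=> 0); last by move=> z _; rewrite subrr.
  by move=> z _; apply: sn_complex_derivable basisE _; exact: sn_derivative_cst.
move=> c; split=> [[u [hu -> eqn]] | ->]; last first.
  exists (fun=> 0); split=> //.
    by move=> z _; apply: graph_complex_derivable; exact: sn_derivative_cst.
  congr hyperfunction; apply/funext => z; rewrite scaler0 raddf0 subr0.
  apply: (hausdorff_sn_eq0 gp) => // a; apply: sn_eq_small => e e0.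
  have dz : complex_derivable (fun=> 0 : graph_space p A) z.
    by apply: graph_complex_derivable; exact: sn_derivative_cst.
  have := graph_sn_derivative dz.
  move=> /graph_derivative /(_ a e e0)[d d0 hd].
  have h2 : 0 < d / 2 by rewrite divr_gt0.
  have h3 : d / 2 < d by lra.
  have val0 : val (0 : F) = 0 :> E by rewrite raddf0.
  have := hd (z + (d / 2)%:C); rewrite addrAC subrr add0r modulus_real gtr0_norm //.
  move=> /(_ h3); rewrite val0 subr0 sub0r snN sn_scale modulus_real gtr0_norm //.
  by rewrite mulrC ler_pM2r.
have u_deriv z : off_axis z ->
    sn_derivative (graph_seminorms p A : seminorms (graph_space p A)) u z
      (complex_derive u z).
  by move=> /off_axisP /hu; exact: graph_sn_derivative.
have [g hg gE] : hyperfunction (fun z => - (2 * (pi : R)%:C * 'i * z)^-1 *: (0 : E))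
    (fun z => val (complex_derive u z : F) - A (u z)) by rewrite -eqn; exact: self.
have equation z : off_axis z -> val (complex_derive u z : F) - A (u z) = g z.
  by move=> /off_axisP /gE; rewrite scaler0 subr0.
have g_deriv z : exists l, sn_derivative p g z l.
  exists (complex_derive g z); apply: complex_derivable_sn (hg z I) => l a e e0.
  exact: generates_nbhs.
have complete := graph_space_complete gp completeE closedA.
have [] := @entire_extension R (graph_space p A) (graph_seminorms p A) u complete.
- by move=> z hz; exists (complex_derive u z); exact: u_deriv.
- move=> y a M yM x x0; apply: (holomorphic_extension (f := fun w => y (u w))) => //.
    by move=> z hz; eexists; exact: cderiv_functional yM (u_deriv z hz).
  apply: (u_integral_decay u_deriv g_deriv equation yM) => n n0.
  have cy : continuous y by apply: (bounded_continuous _ yM) => v w; rewrite raddfB.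
  have [k [al [C1 [t0 [_ C10 _ h]]]]] := resolvent y n cy n0.
  exists k, al, C1, t0; split=> // t /h[yt [s [_ _ hs]]].
  by exists yt, s.
move=> v [dv vu]; apply/seteqP; split=> f [h hh hE].
  exists (fun z => h z + v z).
    move=> z _; have [l vl] := dv z.
    apply: graph_complex_derivable.
    exact: sn_derivativeD (graph_sn_derivative (hh z I)) vl.
  by move=> z /[dup] /off_axisP hz /hE <-; rewrite subr0 vu // subrK.
exists (fun z => h z - v z).
  move=> z _; have [l vl] := dv z.
  apply: graph_complex_derivable.
  exact: sn_derivativeD (graph_sn_derivative (hh z I)) (sn_derivativeN vl).
by move=> z /[dup] /off_axisP hz /hE <-; rewrite subr0 vu.
Qed.
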